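(* There exist constants $C_W,C_{BL},\gamma_W,\gamma_{BL},\delta,C,b>0$, independent of $\mu$ and $\varepsilon$, such that for all $0<\varepsilon\le\mu\le1$ the solution $\mathbf U$ of $L_{\varepsilon,\mu}\mathbf U=\mathbf F$ in $I$, $\mathbf U(0)=\mathbf U(1)=0$, can be written as $\mathbf U=\mathbf W+\widetilde{\mathbf U}_{BL}+\widehat{\mathbf U}_{BL}+\mathbf R$, where $$\mathbf W\in\mathcal A(1,C_W,\gamma_W),\qquad \widetilde{\mathbf U}_{BL}\in\mathcal{BL}^\infty(\delta\mu,C_{BL},\gamma_{BL}),\qquad \widehat{\mathbf U}_{BL}\in\mathcal{BL}^\infty(\delta\varepsilon,C_{BL},\gamma_{BL}),$$ and $$\|\mathbf R\|_{L^\infty(\partial I)}+\|L_{\varepsilon,\mu}\mathbf R\|_{L^\infty(I)}\le C\left[e^{-b/\mu}+e^{-b\mu/\varepsilon}\right].$$ In particular, $\|\mathbf R\|_{E,I}\le C\left[e^{-b/\mu}+e^{-b\mu/\varepsilon}\right]$. Additionally, the second component $\widehat v$ of $\widehat{\mathbf U}_{BL}$ satisfies $\widehat v\in\mathcal{BL}^\infty(\delta\varepsilon,C_{BL}(\varepsilon/\mu)^2,\gamma_{BL})$.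
   Context: $I=(0,1)$, $\partial I=\{0,1\}$. Fixed real data: $\mathbf F=(f,g)^T$ and $\mathbf A(x)=(a_{ij}(x))_{i,j=1,2}$ with $f,g,a_{ij}$ analytic on $[0,1]$: for some constants $C_f,\gamma_f,C_g,\gamma_g,C_a,\gamma_a>0$ and all $n\in\mathbb N_0$, $\|f^{(n)}\|_{L^\infty(I)}\le C_f\gamma_f^n n!$, $\|g^{(n)}\|_{L^\infty(I)}\le C_g\gamma_g^n n!$, $\|a_{ij}^{(n)}\|_{L^\infty(I)}\le C_a\gamma_a^n n!$. For some fixed $\alpha>0$, $\xi^T\mathbf A(x)\xi\ge\alpha^2\xi^T\xi$ for all $\xi\in\mathbb R^2$, $x\in[0,1]$. $L_{\varepsilon,\mu}\mathbf U:=-\mathrm{diag}(\varepsilon^2,\mu^2)\mathbf U''+\mathbf A(x)\mathbf U$; the problem has a unique solution in $[H_0^1(I)]^2$. Energy norm: $\|(u,v)\|_{E,I}^2=\varepsilon^2\|u'\|_{L^2(I)}^2+\mu^2\|v'\|_{L^2(I)}^2+\alpha^2(\|u\|_{L^2(I)}^2+\|v\|_{L^2(I)}^2)$. $\|\mathbf R\|_{L^\infty(\partial I)}$ is the maximum of $|\mathbf R|$ over the two endpoints. $w\in\mathcal A(\nu,C_w,\gamma_w)$ means $\|w^{(n)}\|_{L^\infty(I)}\le C_w\gamma_w^n\max\{n,\nu^{-1}\}^n$ for all $n\in\mathbb N_0$. $w\in\mathcal{BL}^\infty(\nu,C_w,\gamma_w)$ means $w$ is an entire function with $|w^{(n)}(x)|\le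 C_w\gamma_w^n\nu^{-n}e^{-\operatorname{dist}(x,\partial I)/\nu}$ for all $x\in I$, $n\in\mathbb N_0$. Bounds are componentwise for vector-valued functions. *)

(* Defs.v *)
From HB Require Import structures.
From mathcomp Require Import all_boot all_order all_algebra.
From mathcomp Require Import all_classical all_reals all_analysis.

Set Implicit Arguments.
Unset Strict Implicit.
Unset Printing Implicit Defensive.
Import Order.TTheory GRing.Theory Num.Theory.
Import numFieldNormedType.Exports.
Local Open Scope ring_scope.
Local Open Scope classical_set_scope.

Definition unitI (R : realType) : set R := `]0, 1[%classic.

(* [f \_ D] extends the restriction of [f] to [D] by 0, so these are the norms
   of [L^oo(I)] and [L^2(I)]; values outside [I] are irrelevant. *)
Definition normLoo (R : realType) (f : R -> R) : \bar R :=
  ('N[lebesgue_measure]_+oo [EFin \o (f \_ (@unitI R))])%E.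

Definition normL2 (R : realType) (f : R -> R) : \bar R :=
  ('N[lebesgue_measure]_(2%:E) [EFin \o (f \_ (@unitI R))])%E.

Definition in_L2 (R : realType) (f : R -> R) : Prop :=
  f \_ (@unitI R) \in Lfun (@lebesgue_measure R) 2%:E.

Definition component (R : realType) (U : R -> 'cV[R]_2) (i : 'I_2) : R -> R :=
  fun x => U x i 0.

(* [derive1n] returns a junk value where the derivative does not exist, hence
   the explicit differentiability; continuity on the closed interval makes the
   boundary values those of the continuous extension. *)
Definition smooth_on_I (R : realType) (w : R -> R) : Prop :=
  {within `[0, 1]%classic, continuous w} /\
  forall (n : nat) (x : R), unitI x -> derivable (w^`(n)) x 1.

Definition analytic_data (R : realType) (C gamma : R) (f : R -> R) : Prop :=
  smooth_on_I f /\
  forall n : nat, (normLoo (f^`(n)) <= (C * gamma ^+ n * n`!%:R)%:E)%E.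

Definition classA (R : realType) (nu C gamma : R) (w : R -> R) : Prop :=
  smooth_on_I w /\
  forall n : nat,
    (normLoo (w^`(n)) <= (C * gamma ^+ n * Num.max n%:R nu^-1 ^+ n)%:E)%E.

(* Real-valued entire functions, seen on the real line: the sum of a power
   series with infinite radius of convergence. *)
Definition entire (R : realType) (w : R -> R) : Prop :=
  exists a : nat -> R, forall x : R, pseries a x @ \oo --> w x.

Definition dist_bd (R : realType) (x : R) : R := Num.min `|x - 0| `|x - 1|.

Definition classBL (R : realType) (nu C gamma : R) (w : R -> R) : Prop :=
  entire w /\
  forall (n : nat) (x : R), unitI x ->
    `|w^`(n) x| <= C * gamma ^+ n * nu ^- n * expR (- (dist_bd x / nu)).

Definition diag_sq (R : realType) (eps mu : R) : 'M[R]_2 :=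
  diag_mx (\row_(i < 2) if i == 0 then eps ^+ 2 else mu ^+ 2).

Definition opL (R : realType) (eps mu : R) (A : R -> 'M[R]_2)
    (U : R -> 'cV[R]_2) (x : R) : 'cV[R]_2 :=
  - (diag_sq eps mu *m \col_(i < 2) derive1n 2 (component U i) x) + A x *m U x.

Definition test_function (R : realType) (phi : R -> R) : Prop :=
  [/\ forall x : R, derivable phi x 1,
      continuous (phi^`() : R -> R) &
      exists a b : R, [/\ 0 < a, b < 1 &
        forall x : R, ~~ (a <= x <= b) -> phi x = 0] ].

Definition weak_derivative (R : realType) (u du : R -> R) : Prop :=
  forall phi : R -> R, test_function phi ->
    (\int[lebesgue_measure]_(x in @unitI R) (u x * derive1 phi x) =
     - \int[lebesgue_measure]_(x in @unitI R) (du x * phi x)).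

(* [u] is the continuous representative of an element of [H^1_0(I)] and [du] a
   representative of its weak derivative. *)
Definition in_H10 (R : realType) (u du : R -> R) : Prop :=
  [/\ {within `[0, 1]%classic, continuous u}, u 0 = 0 & u 1 = 0] /\
  [/\ in_L2 u, in_L2 du & weak_derivative u du].

Definition in_H10_vec (R : realType) (U dU : R -> 'cV[R]_2) : Prop :=
  forall i : 'I_2, in_H10 (component U i) (component dU i).

Definition is_solution (R : realType) (eps mu : R) (A : R -> 'M[R]_2)
    (F U : R -> 'cV[R]_2) : Prop :=
  exists2 dU : R -> 'cV[R]_2, in_H10_vec U dU &
  forall V dV : R -> 'cV[R]_2, in_H10_vec V dV ->
    (\int[lebesgue_measure]_(x in @unitI R)
       ((dV x)^T *m diag_sq eps mu *m dU x + (V x)^T *m A x *m U x) 0 0 =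
     \int[lebesgue_measure]_(x in @unitI R) ((V x)^T *m F x) 0 0).

(* The regularity under which [opL] and [normE] of [U] are meaningful. *)
Definition classical_regular (R : realType) (U : R -> 'cV[R]_2) : Prop :=
  forall i : 'I_2,
    {within `[0, 1]%classic, continuous (component U i)} /\
    forall x : R, unitI x ->
      derivable (component U i) x 1 /\ derivable ((component U i)^`()) x 1.

Definition normE (R : realType) (eps mu alpha : R) (U : R -> 'cV[R]_2)
    : \bar R :=
  let u := component U 0 in let v := component U 1 in
  sqrte ((eps ^+ 2)%:E * normL2 (u^`()) ^+ 2 +
         (mu ^+ 2)%:E * normL2 (v^`()) ^+ 2 +
         (alpha ^+ 2)%:E * (normL2 u ^+ 2 + normL2 v ^+ 2))%E.

(* For matrices, [`| _ |] is the maximum of the absolute values of the entries. *)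
Definition normLoo_vec (R : realType) (U : R -> 'cV[R]_2) : \bar R :=
  normLoo (fun x => `|U x|).

Definition norm_bd (R : realType) (U : R -> 'cV[R]_2) : R :=
  Num.max `|U 0| `|U 1|.

(* Main.v *)
Require Import Defs.
From HB Require Import structures.
From mathcomp Require Import all_boot all_order all_algebra.
From mathcomp Require Import all_classical all_reals all_analysis.
From mathcomp Require Import measurable_realfun ess_sup_inf ring lra.
Set Implicit Arguments.
Unset Strict Implicit.
Unset Printing Implicit Defensive.
Import Order.TTheory GRing.Theory Num.Theory.
Import numFieldNormedType.Exports.
Local Open Scope ring_scope.
Local Open Scope classical_set_scope.

(** Let D = diag(eps^2, mu^2), so that L U = - D U'' + A U.

If mu is bounded below, or if eps/mu is bounded below, then
e^{-b/mu} + e^{-b mu/eps} is bounded below as well and one may take R = U: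
L R = F is bounded and R vanishes at the endpoints.  The other regime is mu
and eps/mu both small, and there every part of the decomposition is a formal
expansion cut at an order N of size c/mu: analyticity makes its N-th term at
most geometric in N, so that cutting costs 2^{-N}, which is e^{-b/mu}
([pow_half_le]).

The outer part is W = sum_{k <= N} T^k A^{-1} F with T = A^{-1} D d^2/dx^2.
The sum telescopes to L W = F - D (T^N A^{-1} F)''.  Applying T costs two
derivatives, hence at most a factor mu^2 (K N)^2, which is small for
N = c/mu ([outer_expansion]).

W violates the boundary conditions.  At x = 0 two approximate solutions of
L Z = 0 correct this, a slow one in t = x/mu and a fast one in t = x/eps, both
of the form e^{-kappa t} q(t) with q a polynomial of degree at most N; this is
entire, and the right endpoint is reached by x -> 1 - x.  The slow rate is
kappa^2 = det A(0) / a11(0), the fast rate kappa^2 = a11(0).  With these rates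
one of the two equations for q loses its zero order term and determines q', the
other can be solved for the second component; what is left is small: a
multiple of s^2 = (eps/mu)^2, further derivatives of q, or the variation
A(nu t) - A(0) of the coefficients, nu being mu or eps.  Smallness is measured
by sup_j |q_j| j! / beta^j with beta small.  In this norm d/dt has size beta,
integration has size 1/beta, and multiplication by (nu t)^m, restricted to
degree at most N, has size (N nu / beta)^m.  So the equations for q are a fixed
point problem for a contraction ([iter_step_norm]); N iterations and the
truncation leave an error 2^{-N} e^{3 beta t}, which e^{-kappa t} absorbs
([layer_functions], [end_layers]).  For s small the boundary values of the two
layers are linearly independent, which gives the coefficients
([matched_layers]); the second component of the fast layer carries s^2 from the
start.

What remains, R, has small boundary values and small L R, and the energy
estimate [energy_bound] concludes.  It needs R to be classical.  The weak
solution U is: testing with phi such that phi'' = omega (w - l), where w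
is U_i minus a second antiderivative of the expected U_i'', l is affine and
omega is a bump, shows that w is affine ([affine_of_orthogonal],
[solution_C2]). *)

(** * Functions of class C1 up to the boundary of the unit interval *)

Section Calculus.
Context {R : realType}.
Implicit Types (f g p P w : R -> R) (x y a b c : R).

Lemma unitIE x : unitI x <-> 0 < x < 1.
Proof. by rewrite /unitI /= in_itv. Qed.

Lemma der_cst c x : is_derive x 1 (fun _ : R => c) 0.
Proof. exact: is_derive_cst. Qed.

Lemma der_id x : is_derive x 1 (fun y : R => y) 1.
Proof. exact: is_derive_id. Qed.

Lemma derD f g x df dg : is_derive x 1 f df -> is_derive x 1 g dg ->
  is_derive x 1 (fun y => f y + g y) (df + dg).
Proof. by move=> hf hg; exact: is_deriveD. Qed.

Lemma derN f x df : is_derive x 1 f df -> is_derive x 1 (fun y => - f y) (- df).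
Proof. by move=> hf; exact: is_deriveN. Qed.

Lemma derB f g x df dg : is_derive x 1 f df -> is_derive x 1 g dg ->
  is_derive x 1 (fun y => f y - g y) (df - dg).
Proof. by move=> hf hg; exact: is_deriveB. Qed.

Lemma derM f g x df dg : is_derive x 1 f df -> is_derive x 1 g dg ->
  is_derive x 1 (fun y => f y * g y) (df * g x + f x * dg).
Proof.
move=> hf hg; apply: (@is_derive_eq _ _ _ (f * g)%R) => /=.
by rewrite /GRing.scale /= addrC (mulrC (g x)).
Qed.

Lemma derZ c f x df : is_derive x 1 f df -> is_derive x 1 (fun y => c * f y) (c * df).
Proof. by move=> hf; have := derM (der_cst c x) hf; rewrite mul0r add0r. Qed.

Lemma der_comp f g x df dg : is_derive (g x) 1 f df -> is_derive x 1 g dg ->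
  is_derive x 1 (fun y => f (g y)) (df * dg).
Proof.
move=> hf hg; have := @is_derive1_comp _ f g x df dg hf hg.
by rewrite mulrC.
Qed.

Lemma der_sum n (h : nat -> R -> R) x (dh : nat -> R) :
  (forall i, (i < n)%N -> is_derive x 1 (h i) (dh i)) ->
  is_derive x 1 (fun y => \sum_(i < n) h i y) (\sum_(i < n) dh i).
Proof.
elim: n => [_|n IH hd].
  by rewrite big_ord0 (_ : (fun _ => _) = fun=> 0); [exact: der_cst|apply/funext => y; rewrite big_ord0].
rewrite big_ord_recr /= (_ : (fun y => _) = fun y => \sum_(i < n) h i y + h n y).
  by apply: derD; [apply: IH => i /ltnW; exact: hd|exact: hd].
by apply/funext => y; rewrite big_ord_recr.
Qed.

Lemma der_cont f x df : is_derive x 1 f df -> {for x, continuous f}.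
Proof. by case=> hf _; apply/differentiable_continuous/derivable1_diffP. Qed.

Lemma der_derive1 f x df : is_derive x 1 f df -> f^`() x = df.
Proof. by case=> hf <-; rewrite derive1E. Qed.

Lemma der_near f g x df : (\forall y \near x, f y = g y) ->
  is_derive x 1 f df -> is_derive x 1 g df.
Proof.
by move=> fg; exact: near_eq_is_derive.
Qed.

Lemma near_itvoo a b x : a < x -> x < b -> \forall y \near x, a < y < b.
Proof.
move=> ax xb.
have : x \in `]a, b[%R by rewrite in_itv /= ax xb.
move=> /near_in_itvoo; apply: filterS => y; by rewrite in_itv.
Qed.

Lemma der_eqI f g x df : (forall y, unitI y -> f y = g y) -> unitI x ->
  is_derive x 1 f df -> is_derive x 1 g df.
Proof.
move=> fg /unitIE/andP[x0 x1]; apply: der_near.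
by near=> y; apply: fg; apply/unitIE; near: y; exact: near_itvoo.
Unshelve. all: by end_near. Qed.

Definition cont01 f := {within `[0, 1]%classic, continuous f}.

Lemma cont01_cont f : continuous f -> cont01 f.
Proof. exact: continuous_subspaceT. Qed.

Lemma cont01_cst c : cont01 (fun=> c).
Proof. by apply: cont01_cont => x; exact: cvg_cst. Qed.

Lemma cont01_id : cont01 (fun x => x).
Proof. by apply: cont01_cont => x; exact: cvg_id. Qed.

Lemma cont01D f g : cont01 f -> cont01 g -> cont01 (fun x => f x + g x).
Proof. by move=> cf cg x; exact: cvgD (cf x) (cg x). Qed.

Lemma cont01B f g : cont01 f -> cont01 g -> cont01 (fun x => f x - g x).
Proof. by move=> cf cg x; exact: cvgB (cf x) (cg x). Qed.

Lemma cont01M f g : cont01 f -> cont01 g -> cont01 (fun x => f x * g x).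
Proof. by move=> cf cg x; exact: cvgM (cf x) (cg x). Qed.

Lemma cont01Z c f : cont01 f -> cont01 (fun x => c * f x).
Proof. by move=> cf; apply: cont01M => //; exact: cont01_cst. Qed.

Lemma cont01_sum n (h : nat -> R -> R) : (forall i, (i < n)%N -> cont01 (h i)) ->
  cont01 (fun y => \sum_(i < n) h i y).
Proof.
elim: n => [_|n IH hd].
  by rewrite (_ : (fun _ => _) = fun=> 0); [exact: cont01_cst|apply/funext => y; rewrite big_ord0].
rewrite (_ : (fun y => _) = fun y => \sum_(i < n) h i y + h n y).
  by apply: cont01D; [apply: IH => i /ltnW; exact: hd|exact: hd].
by apply/funext => y; rewrite big_ord_recr.
Qed.

Lemma cont01_eq f g : (forall x, 0 <= x <= 1 -> f x = g x) -> cont01 f -> cont01 g.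
Proof.
move=> fg; apply: subspace_eq_continuous => x; rewrite inE /= in_itv /=.
by move=> /fg.
Qed.

Lemma cont01_interior f x : cont01 f -> unitI x -> {for x, continuous f}.
Proof.
move=> cf Ix; have [cf' _ _] := (continuous_within_itvP f (@ltr01 R)).1 cf.
by apply: cf'; move: Ix; rewrite /unitI.
Qed.

(** [p] is the derivative of [P] inside, and both are continuous up to the
    boundary, so that the fundamental theorem of calculus holds on [0, 1]. *)
Definition C1on P p := [/\ cont01 P, cont01 p & forall x, unitI x -> is_derive x 1 P (p x)].

Lemma C1on_mono_sub P p a b : C1on P p -> 0 <= a -> a <= b -> b <= 1 ->
  (forall x, unitI x -> a < x < b -> 0 <= p x) -> P a <= P b.
Proof.
move=> [cP cp dP] a0 ab b1 p0.
have H x : x \in `]a, b[%R -> unitI x.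
  by rewrite in_itv /= => /andP[ax xb]; apply/unitIE/andP; split; lra.
apply: (@ger0_derive1_le_cc _ P a b); rewrite ?in_itv /= ?lexx ?ab //.
- by move=> x /H /dP [].
- by move=> x xab; rewrite (der_derive1 (dP _ (H _ xab))); apply: p0; [exact: H|by move: xab; rewrite in_itv].
- apply: continuous_subspaceW cP; apply: subset_itv; rewrite bnd_simp //.
Qed.

Lemma C1on_mono P p : C1on P p -> (forall x, unitI x -> 0 <= p x) -> P 0 <= P 1.
Proof. by move=> h p0; apply: (C1on_mono_sub h) => // x Ix _; exact: p0. Qed.

Lemma C1onD P p Q q : C1on P p -> C1on Q q -> C1on (fun x => P x + Q x) (fun x => p x + q x).
Proof.
move=> [a b c] [d e f]; split; [exact: cont01D|exact: cont01D|] => x Ix.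
by apply: derD; auto.
Qed.

Lemma C1onB P p Q q : C1on P p -> C1on Q q -> C1on (fun x => P x - Q x) (fun x => p x - q x).
Proof.
move=> [a b c] [d e f]; split; [exact: cont01B|exact: cont01B|] => x Ix.
by apply: derB; auto.
Qed.

Lemma C1onZ c P p : C1on P p -> C1on (fun x => c * P x) (fun x => c * p x).
Proof.
move=> [a b d]; split; [exact: cont01Z|exact: cont01Z|] => x Ix.
by apply: derZ; auto.
Qed.

Lemma C1onM P p Q q : C1on P p -> C1on Q q ->
  C1on (fun x => P x * Q x) (fun x => p x * Q x + P x * q x).
Proof.
move=> [a b c] [d e f]; split; [exact: cont01M|by apply: cont01D; apply: cont01M|] => x Ix.
by apply: derM; auto.
Qed.

Lemma C1on_cst c : C1on (fun=> c) (fun=> 0).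
Proof. by split; [exact: cont01_cst|exact: cont01_cst|move=> x _; exact: der_cst]. Qed.

Lemma C1on_id : C1on (fun x => x) (fun=> 1).
Proof. by split; [exact: cont01_id|exact: cont01_cst|move=> x _; exact: der_id]. Qed.

Lemma C1on_eqr P p q : (forall x, 0 <= x <= 1 -> p x = q x) -> C1on P p -> C1on P q.
Proof.
move=> pq [a b c]; split => //; first exact: cont01_eq b.
by move=> x Ix; rewrite -pq; [exact: c|case/unitIE/andP: Ix => *; apply/andP; split; lra].
Qed.

Lemma C1on_eql P Q p : (forall x, 0 <= x <= 1 -> P x = Q x) -> C1on P p -> C1on Q p.
Proof.
move=> PQ [a b c]; split => //; first exact: cont01_eq a.
move=> x Ix; apply: (der_eqI (f := P)) => // [y|]; last exact: c.
by case/unitIE/andP => *; apply: PQ; apply/andP; split; lra.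
Qed.

(** [P] is monotone with equal end values, hence constant. *)
Lemma C1on_cst_eq P p : C1on P p -> (forall x, unitI x -> 0 <= p x) -> P 0 = P 1 ->
  forall x, unitI x -> p x = 0.
Proof.
move=> h p0 P01 x Ix.
have Pc y : unitI y -> P y = P 0.
  move=> /unitIE/andP[y0 y1]; apply/eqP; rewrite eq_le; apply/andP; split.
    by rewrite P01; apply: (C1on_mono_sub h) => // [||z Iz _]; [lra|lra|exact: p0].
  by apply: (C1on_mono_sub h) => // [||z Iz _]; [lra|lra|exact: p0].
have [_ _ dP] := h.
have d0 := der_eqI (fun y Iy => esym (Pc y Iy)) Ix (der_cst (P 0) x).
by rewrite -(der_derive1 (dP _ Ix)) (der_derive1 d0).
Qed.

Notation mu := (@lebesgue_measure R).
Definition int01 f := (\int[mu]_(x in @unitI R) f x)%R.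

Lemma measI : measurable (@unitI R).
Proof. exact: measurable_itv. Qed.

Lemma cont01_integrable_cc f : cont01 f -> mu.-integrable `[0, 1]%classic (EFin \o f).
Proof. by move=> cf; apply: continuous_compact_integrable cf; exact: segment_compact. Qed.

Lemma cont01_integrable f : cont01 f -> mu.-integrable (@unitI R) (EFin \o f).
Proof.
move=> /cont01_integrable_cc; apply: integrableS; [exact: measurable_itv|exact: measI|].
by apply: subset_itv_oo_cc.
Qed.

Lemma C1on_LR P p : C1on P p -> derivable_oo_LRcontinuous P 0 1.
Proof.
move=> [cP _ dP]; have [_ P0 P1] := (continuous_within_itvP P (@ltr01 R)).1 cP.
by split => // x xI; have [] : is_derive x 1 P (p x) by apply: dP; move: xI; rewrite /unitI.
Qed.

Lemma FTC P p : C1on P p -> int01 p = P 1 - P 0.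
Proof.
move=> h; have [_ cp dP] := h; have ip := cont01_integrable cp.
rewrite /int01 /unitI Rintegral_itv_obnd_cbnd // Rintegral_itv_bndo_bndc; last first.
  apply: integrableS (cont01_integrable_cc cp) => //.
  by apply: subset_itvl; rewrite bnd_simp.
rewrite /Rintegral (@continuous_FTC2 _ p P) //; first exact: (C1on_LR h).
by move=> x xI; apply: der_derive1; apply: dP; move: xI; rewrite /unitI.
Qed.
End Calculus.
Arguments cont01Z {R} c [f].
Arguments C1onZ {R} c [P p].
Arguments derZ {R} c [f x df].
Arguments cont01_cst {R} c.

(** * Lebesgue integrals and norms of continuous functions *)

Section Lebesgue.
Context {R : realType}.
Implicit Types (f g p P w : R -> R) (x y a b c : R).
Notation mu := (@lebesgue_measure R).

Lemma eq_int01 f g : (forall x, unitI x -> f x = g x) -> int01 f = int01 g.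
Proof. by move=> fg; apply: eq_Rintegral => x; rewrite inE => /fg. Qed.

Lemma int01D f g : mu.-integrable (@unitI R) (EFin \o f) ->
  mu.-integrable (@unitI R) (EFin \o g) ->
  int01 (fun x => f x + g x) = int01 f + int01 g.
Proof. by move=> hf hg; apply: RintegralD => //; exact: measI. Qed.

Lemma int01B f g : cont01 f -> cont01 g ->
  int01 (fun x => f x - g x) = int01 f - int01 g.
Proof. by move=> hf hg; apply: RintegralB; [exact: measI|exact: cont01_integrable..]. Qed.

Lemma int01Z c f : mu.-integrable (@unitI R) (EFin \o f) ->
  int01 (fun x => c * f x) = c * int01 f.
Proof. by move=> hf; apply: RintegralZl => //; exact: measI. Qed.

Lemma cont01_antiderivative p : cont01 p -> exists P, C1on P p /\ P 0 = 0.
Proof.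
move=> cp; have ip := cont01_integrable_cc cp.
exists (fun x => parameterized_integral mu 0 x p); split; last first.
  by rewrite /parameterized_integral set_itv1 Rintegral_set1.
split=> //; first exact: parameterized_integral_continuous.
move=> x /[dup] Ix /unitIE/andP[x0 x1].
have [|d1 d2] := @continuous_FTC1_closed _ p 0 x 1 x1 ip x0.
  exact: cont01_interior.
by rewrite -d2 derive1E; apply: derivableP.
Qed.

Lemma measurable_restrict_cont01 p : cont01 p ->
  measurable_fun [set: R] (p \_ (@unitI R)).
Proof.
move=> /cont01_integrable /integrableP[/measurable_EFinP mp _].
by apply/(measurable_restrictT _ measI).
Qed.

Lemma cont01_L2 f : cont01 f -> in_L2 f.
Proof.
move=> cf; rewrite /in_L2 inE; apply/andP; split; rewrite inE /=.
  exact: measurable_restrict_cont01.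
rewrite /finite_norm unlock /=.
have h := cont01_integrable (cont01M cf cf).
apply: poweR_lty.
rewrite (_ : (\int[_]_x _)%E = (\int[mu]_(x in @unitI R) (f x * f x)%:E)%E).
  have /integrable_fin_num := h => /(_ measI); rewrite ge0_fin_numE //.
  by apply: integral_ge0 => x _ /=; rewrite lee_fin -expr2 sqr_ge0.
rewrite [RHS]integral_mkcond; apply: eq_integral => x _.
rewrite /patch; case: ifP => _ /=.
  by rewrite powR_mulrn // -normrX expr2 ger0_norm // -expr2 sqr_ge0.
by rewrite normr0 powR0.
Qed.

Lemma in_L2_mulI f g : in_L2 f -> in_L2 g ->
  mu.-integrable (@unitI R) (EFin \o (fun x => f x * g x)).
Proof.
move=> hf hg; have /Lfun1_integrable H := Lfun2_mul_Lfun1 hf hg.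
have : mu.-integrable (@unitI R) (EFin \o ((f \_ (@unitI R)) \* (g \_ (@unitI R)))).
  by apply: integrableS H => //; exact: measI.
apply: eq_integrable; first exact: measI.
by move=> x xI /=; rewrite /patch xI.
Qed.

Lemma normL2_sqr f g P : (forall x, unitI x -> f x = g x) ->
  cont01 g -> C1on P (fun x => g x ^+ 2) -> (normL2 f ^+ 2 = (P 1 - P 0)%:E)%E.
Proof.
move=> fg cg hP.
have -> : normL2 f = normL2 g.
  apply: eq_Lnorm => x /=; congr EFin; rewrite /patch; case: ifP => //.
  by rewrite inE => /fg.
rewrite /normL2.
have -> : ('N[mu]_2%:E[EFin \o g \_ (@unitI R)] ^+ 2 = 'N[mu]_2%:E[EFin \o g \_ (@unitI R)] `^ 2)%E.
  have := @Lnorm_ge0 _ _ _ mu 2%:E (EFin \o g \_ (@unitI R)).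
  case: ('N[mu]_2%:E[EFin \o g \_ (@unitI R)])%E => [r|_|//].
    by rewrite lee_fin => r0; rewrite poweR_EFin powR_mulrn.
  by rewrite poweRyr // expe2 mulyy.
rewrite powR_Lnorm //.
rewrite (_ : (\int[_]_x _)%E = (\int[mu]_(x in @unitI R) (g x ^+ 2)%:E)%E).
  have h := cont01_integrable (cont01M cg cg).
  rewrite -(FTC hP) /int01 /Rintegral fineK //.
  by move: h => /integrable_fin_num; apply; exact: measI.
rewrite [RHS]integral_mkcond; apply: eq_integral => x _; rewrite /patch /=.
case: (boolP (x \in @unitI R)) => [xI|/negbTE xI].
  by rewrite powR_mulrn // real_normK ?num_real.
by rewrite normr0 powR0.
Qed.

Lemma mu_T_gt0 : (0 < mu [set: R])%E.
Proof.
have := @lebesgue_measure_itv R `]-oo, +oo[%R.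
rewrite set_itvNyy /= => ->; exact: ltry.
Qed.

Lemma normLoo_le f M : 0 <= M -> (forall x, unitI x -> `|f x| <= M) ->
  (normLoo f <= M%:E)%E.
Proof.
move=> M0 fM; rewrite /normLoo unlock mu_T_gt0.
apply/ess_supP; apply: nearW => x /=; rewrite lee_fin /patch; case: ifP.
  by rewrite inE => /fM.
by rewrite normr0.
Qed.

(** A continuous function exceeding [M] at a point does so on a ball, which has
    positive measure: the essential supremum bounds every value. *)
Lemma normLoo_ge f M : (forall x, unitI x -> {for x, continuous f}) ->
  (normLoo f <= M%:E)%E -> forall x, unitI x -> `|f x| <= M.
Proof.
move=> cf; rewrite /normLoo unlock mu_T_gt0 => /ess_supP [N [mN N0 hN]] x Ix.
rewrite leNgt; apply/negP => fx.
have : \forall y \near x, M < `|f y| /\ unitI y.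
  apply: filterI.
    have H : `|f y| @[y --> x] --> `|f x| by apply: cvg_norm; exact: cf.
    exact: cvgr_gt H _ fx.
  by move/unitIE/andP: (Ix) => [x0 x1]; apply: filterS (near_itvoo x0 x1) => y; move/unitIE.
case/nbhs_ballP => e /= e0 he.
have : (mu (ball x e) <= mu N)%E.
  apply: le_measure; rewrite ?inE //; first exact: measurable_ball.
  move=> y /he[My Iy]; apply: hN => /=.
  rewrite lee_fin /patch ifT ?inE //; apply/negP; by rewrite -ltNge.
rewrite N0 lebesgue_measure_ball; last exact: ltW.
by apply/negP; rewrite -ltNge lte_fin pmulrn_lgt0.
Qed.
End Lebesgue.

(** * Weak solutions are classical solutions *)

Section Regularity.
Context {R : realType}.
Implicit Types (f g p P w : R -> R) (x y a b c : R).
Notation mu := (@lebesgue_measure R).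

Lemma C1on_const_sub P p a b : C1on P p -> 0 <= a -> a <= b -> b <= 1 ->
  (forall x, unitI x -> a < x < b -> p x = 0) -> P a = P b.
Proof.
move=> h a0 ab b1 p0; apply/eqP; rewrite eq_le; apply/andP; split.
  by apply: (C1on_mono_sub h) => // x Ix xab; rewrite p0.
have hN := C1onZ (-1) h.
have : -1 * P a <= -1 * P b.
  by apply: (C1on_mono_sub hN) => // x Ix xab; rewrite p0 // mulr0.
by rewrite !mulN1r lerN2.
Qed.

(** The boundary terms in the integration by parts against a test function
    vanish. *)
Lemma C1on_H10 P p : C1on P p -> P 0 = 0 -> P 1 = 0 -> in_H10 P p.
Proof.
move=> h P0 P1; have [cP cp dP] := h.
split; split => //; [exact: cont01_L2|exact: cont01_L2|].
move=> phi [dphi cphi [a [b [a0 b1 hab]]]].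
have c0phi : cont01 phi.
  by apply: cont01_cont => x; apply/differentiable_continuous/derivable1_diffP.
have c1phi : cont01 (phi^`()) by exact: cont01_cont.
have hphi : C1on phi (phi^`()).
  by split=> // x _; rewrite derive1E; apply: derivableP.
have := FTC (C1onM h hphi); rewrite P0 P1 !mul0r subr0.
rewrite int01D; last 2 first.
- exact: (cont01_integrable (cont01M cp c0phi)).
- exact: (cont01_integrable (cont01M cP c1phi)).
by move=> /eqP; rewrite addrC addr_eq0 => /eqP.
Qed.

Lemma in_H10_0 : in_H10 (fun=> 0 : R) (fun=> 0).
Proof. by apply: C1on_H10 => //; exact: C1on_cst. Qed.

Lemma int01_cont_gt0 p x : cont01 p -> (forall y, unitI y -> 0 <= p y) ->
  unitI x -> p x != 0 -> 0 < int01 p.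
Proof.
move=> cp p0 Ix px; have [P [hP P0]] := cont01_antiderivative cp.
have := C1on_mono hP p0; rewrite (FTC hP) P0 subr0 le_eqVlt => /predU1P[P1|//].
by move: px; rewrite (C1on_cst_eq hP p0) ?P0 ?eqxx.
Qed.

(** Gram-Schmidt on 1 and x for the weight [om]: [n] is the centre of gravity of
    the weight, so 1 and x - n are orthogonal. *)
Lemma affine_projection (om w : R -> R) : cont01 om -> cont01 w ->
  (forall x, unitI x -> 0 <= om x) ->
  (exists x y, [/\ unitI x, unitI y, x != y, om x != 0 & om y != 0]) ->
  exists c0 c1, int01 (fun x => om x * (w x - (c0 + c1 * x))) = 0 /\
    int01 (fun x => om x * (w x - (c0 + c1 * x)) * x) = 0.
Proof.
move=> cO cw om0 [x1 [x2 [I1 I2 x12 o1 o2]]].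
have cid := @cont01_id R.
have cx : cont01 (fun x => om x * x) by exact: cont01M.
have cow : cont01 (fun x => om x * w x) by exact: cont01M.
have J0 : 0 < int01 om by exact: int01_cont_gt0 I1 o1.
set m0 := int01 om; set n := int01 (fun x => om x * x) / m0.
have cl : cont01 (fun x => x - n) by apply: cont01B => //; exact: cont01_cst.
have col : cont01 (fun x => om x * (x - n)) by exact: cont01M.
have coll : cont01 (fun x => om x * (x - n) * (x - n)) by exact: cont01M.
have Jn : int01 (fun x => om x * (x - n)) = 0.
  rewrite (@eq_int01 _ _ (fun x => om x * x - n * om x)); last by move=> x _; ring.
  rewrite int01B //; last exact: cont01Z.
  rewrite int01Z; last exact: cont01_integrable.
  by rewrite /n -/m0 divfK ?subrr // gt_eqF.
have J2 : 0 < int01 (fun x => om x * (x - n) * (x - n)).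
  have h y : unitI y -> 0 <= om y * (y - n) * (y - n).
    by move=> Iy; rewrite -mulrA mulr_ge0 ?om0 // -expr2 sqr_ge0.
  have [e1|ne1] := eqVneq x1 n.
    apply: (int01_cont_gt0 (x := x2)) => //.
    by rewrite -e1 !mulf_neq0 // subr_eq0 eq_sym.
  by apply: (int01_cont_gt0 (x := x1)) => //; rewrite !mulf_neq0 // subr_eq0.
set m2 := int01 _ in J2.
pose d0 := int01 (fun x => om x * w x) / m0.
pose d1 := int01 (fun x => om x * (x - n) * w x) / m2.
have cl2 : cont01 (fun x => om x * (x - n) * w x) by exact: cont01M.
have K1 : int01 (fun x => om x * (w x - (d0 + d1 * (x - n)))) = 0.
  rewrite (@eq_int01 _ _ (fun x => (om x * w x - d0 * om x) - d1 * (om x * (x - n)))); last by move=> x _; ring.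
  rewrite int01B; [|by apply: cont01B => //; exact: cont01Z|exact: cont01Z].
  rewrite int01B //; last exact: cont01Z.
  rewrite !int01Z; [|exact: cont01_integrable..].
  by rewrite Jn /d0 -/m0 divfK ?gt_eqF // subrr mulr0 subr0.
have K2 : int01 (fun x => om x * (w x - (d0 + d1 * (x - n))) * (x - n)) = 0.
  rewrite (@eq_int01 _ _ (fun x => (om x * (x - n) * w x - d0 * (om x * (x - n))) - d1 * (om x * (x - n) * (x - n)))); last by move=> x _; ring.
  rewrite int01B; [|by apply: cont01B => //; exact: cont01Z|exact: cont01Z].
  rewrite int01B //; last exact: cont01Z.
  rewrite !int01Z; [|exact: cont01_integrable..].
  by rewrite Jn /d1 -/m2 divfK ?gt_eqF // mulr0 subr0 subrr.
exists (d0 - d1 * n), d1; split.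
  by rewrite -[RHS]K1; apply: eq_int01 => x _; ring.
have cK : cont01 (fun x => om x * (w x - (d0 + d1 * (x - n)))).
  apply: cont01M => //; apply: cont01B => //.
  by apply: cont01D; [exact: cont01_cst|exact: cont01Z].
have := int01D (cont01_integrable (cont01M cK cl)) (cont01_integrable (cont01Z n cK)).
rewrite int01Z; last exact: cont01_integrable.
rewrite K1 K2 mulr0 addr0 => <-.
by apply: eq_int01 => x _; ring.
Qed.

(** The test function is the second antiderivative of omega (w - l), with omega
    a bump on [a, b] and l the weighted affine projection of [w].  The two
    vanishing moments are what makes it and its derivative vanish beyond b.
    Orthogonality then gives that the integral of omega (w - l)^2 is 0. *)
Lemma affine_of_orthogonal_local w a b : cont01 w -> 0 < a -> a < b -> b < 1 ->
  (forall P0 P1 P2, C1on P0 P1 -> C1on P1 P2 -> P0 0 = 0 -> P0 1 = 0 ->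
    P1 0 = 0 -> P1 1 = 0 -> test_function P1 -> P1^`() = P2 ->
    int01 (fun x => w x * P2 x) = 0) ->
  exists c0 c1, forall x, a < x < b -> w x = c0 + c1 * x.
Proof.
move=> cw a0 ab b1 horth.
(* a weight rather than a characteristic function, because the second
   derivative of the test function has to be continuous *)
pose om x := Num.max 0 ((x - a) * (b - x)).
have cOm : continuous om.
  move=> x; apply: (@continuous_max _ _ (fun=> 0) (fun x => (x - a) * (b - x)) x).
    exact: cvg_cst.
  by apply: cvgM; apply: cvgB; [exact: cvg_id|exact: cvg_cst|exact: cvg_cst|exact: cvg_id].
have om0 x : 0 <= om x by rewrite /om le_max lexx.
have omp x : a < x < b -> 0 < om x.
  by move=> /andP[ax xb]; rewrite /om lt_max mulr_gt0 ?orbT // subr_gt0.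
have omz x : ~~ (a < x < b) -> om x = 0.
  rewrite negb_and -!leNgt => h; apply/max_idPl.
  case/orP: h => h; nra.
have cO := cont01_cont cOm.
have [c0 [c1 [m0 m1]]] : exists c0 c1, int01 (fun x => om x * (w x - (c0 + c1 * x))) = 0 /\
    int01 (fun x => om x * (w x - (c0 + c1 * x)) * x) = 0.
  apply: affine_projection => //; exists ((2 * a + b) / 3), ((a + 2 * b) / 3); split.
  - by apply/unitIE/andP; split; lra.
  - by apply/unitIE/andP; split; lra.
  - by apply/eqP => h; move: ab; rewrite lt_neqAle => /andP[/eqP + _]; apply; lra.
  - by rewrite gt_eqF // omp //; apply/andP; split; lra.
  - by rewrite gt_eqF // omp //; apply/andP; split; lra.
exists c0, c1.
pose l x := c0 + c1 * x; pose q x := om x * (w x - l x).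
have cl : cont01 l by apply: cont01D; [exact: cont01_cst|apply: cont01Z; exact: cont01_id].
have cq : cont01 q by apply: cont01M => //; exact: cont01B.
have qz x : ~~ (a < x < b) -> q x = 0 by move=> /omz e; rewrite /q e mul0r.
have [P [hP P0]] := cont01_antiderivative cq.
have P1 : P 1 = 0 by rewrite -[LHS]subr0 -{1}P0 -(FTC hP).
have Pa x : 0 <= x <= a -> P x = 0.
  move=> /andP[x0 xa]; rewrite -P0; symmetry; apply: (C1on_const_sub hP) => //; first lra.
  by move=> y _ /andP[y0 yx]; apply: qz; rewrite negb_and -!leNgt; apply/orP; left; lra.
have Pb x : b <= x <= 1 -> P x = 0.
  move=> /andP[xb x1]; rewrite -P1; apply: (C1on_const_sub hP) => //; first lra.
  by move=> y _ /andP[y0 yx]; apply: qz; rewrite negb_and -!leNgt; apply/orP; right; lra.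
(* a test function is differentiable on the whole line *)
pose psi x := if 0 <= x <= 1 then P x else 0.
have psiP x : 0 <= x <= 1 -> P x = psi x by rewrite /psi => ->.
have psiz x : ~~ (a <= x <= b) -> psi x = 0.
  rewrite negb_and -!ltNge /psi => h; case: ifP => // /andP[x0 x1].
  by case/orP: h => h; [apply: Pa|apply: Pb]; apply/andP; split; lra.
have hpsi : C1on psi q by exact: C1on_eql hP.
have dpsi x : is_derive x 1 psi (q x).
  have [Ix|nIx] := pselect (unitI x); first by have [_ _] := hpsi; exact.
  have nx : ~~ (a <= x <= b).
    by apply/negP => /andP[ax xb]; apply: nIx; apply/unitIE/andP; split; lra.
  rewrite qz; last by apply: contra nx => /andP[? ?]; apply/andP; split; lra.
  apply: der_near (der_cst 0 x).
  move: nx; rewrite negb_and -!ltNge => /orP[xa|xb].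
    near=> y; rewrite psiz // negb_and -!ltNge; apply/orP; left.
    by near: y; apply: lt_nbhsl.
  near=> y; rewrite psiz // negb_and -!ltNge; apply/orP; right.
  by near: y; apply: lt_nbhsr.
have cqR : continuous q.
  move=> x; have [Ix|nIx] := pselect (unitI x); first exact: cont01_interior.
  have nx : ~~ (a <= x <= b).
    by apply/negP => /andP[ax xb]; apply: nIx; apply/unitIE/andP; split; lra.
  apply: (@der_cont _ _ _ 0); apply: der_near (der_cst 0 x).
  move: nx; rewrite negb_and -!ltNge => /orP[xa|xb].
    near=> y; rewrite qz // negb_and -!leNgt; apply/orP; left; apply: ltW.
    by near: y; apply: lt_nbhsl.
  near=> y; rewrite qz // negb_and -!leNgt; apply/orP; right; apply: ltW.
  by near: y; apply: lt_nbhsr.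
have [_ cpsi _] := hpsi; have cpsi' : cont01 psi by case: hpsi.
have [Q [hQ Q0]] := cont01_antiderivative cpsi'.
have dq : psi^`() = q by apply/funext => x; apply: der_derive1.
have psi0 : psi 0 = 0 by rewrite -psiP ?P0 // lexx ler01.
have psi1 : psi 1 = 0 by rewrite -psiP ?P1 // lexx ler01.
have Q1 : Q 1 = 0.
  have := FTC (C1onM (@C1on_id R) hpsi); rewrite psi0 psi1 !mulr0 subrr.
  rewrite int01D; [|exact: cont01_integrable (cont01Z 1 cpsi')|].
    2: by apply: cont01_integrable; apply: cont01M => //; exact: cont01_id.
  rewrite (@eq_int01 _ (fun x => 1 * psi x) psi); last by move=> x _; rewrite mul1r.
  rewrite (@eq_int01 _ (fun x => x * q x) (fun x => q x * x)); last by move=> x _; rewrite mulrC.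
  by rewrite m1 addr0 (FTC hQ) Q0 subr0.
have tpsi : test_function psi.
  split; [by move=> x; have [] := dpsi x|by rewrite dq|exists a, b; split => //].
have w0 := horth _ _ _ hQ hpsi Q0 Q1 psi0 psi1 tpsi dq.
have clq : cont01 (fun x => q x * x) by apply: cont01M => //; exact: cont01_id.
have l0 : int01 (fun x => l x * q x) = 0.
  have := int01D (cont01_integrable (cont01Z c0 cq)) (cont01_integrable (cont01Z c1 clq)).
  rewrite !int01Z; [|exact: cont01_integrable..].
  rewrite m0 m1 !mulr0 addr0 => <-.
  by apply: eq_int01 => x _; rewrite /l; ring.
have s0 : int01 (fun x => (w x - l x) * q x) = 0.
  have := int01B (cont01M cw cq) (cont01M cl cq).
  by rewrite w0 l0 subrr => <-; apply: eq_int01 => x _; ring.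
move=> x xab; apply/eqP; rewrite -subr_eq0; apply/negPn/negP => nz.
have Ix : unitI x by move/andP: xab => [? ?]; apply/unitIE/andP; split; lra.
suff : 0 < int01 (fun x => (w x - l x) * q x) by rewrite s0 ltxx.
apply: (int01_cont_gt0 (x := x)) => //.
- by apply: cont01M => //; exact: cont01B.
- by move=> y _; rewrite /q mulrCA mulr_ge0 // -expr2 sqr_ge0.
- by rewrite /q !mulf_neq0 // gt_eqF // omp.
Unshelve. all: by end_near. Qed.
End Regularity.

Section Regularity2.
Context {R : realType}.
Implicit Types (f g p P w : R -> R) (x y a b c : R).
Notation mu := (@lebesgue_measure R).

(** The difference has derivative 0 inside and is continuous up to the boundary. *)
Lemma cont01_eqI f g : cont01 f -> cont01 g -> (forall x, unitI x -> f x = g x) ->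
  forall x, 0 <= x <= 1 -> f x = g x.
Proof.
move=> cf cg fg.
have h : C1on (fun x => f x - g x) (fun=> 0).
  split; [exact: cont01B|exact: cont01_cst|move=> x Ix].
  by apply: (der_eqI (f := fun=> 0)) (der_cst 0 x) => // y Iy; rewrite fg // subrr.
have h2 : f (2^-1) - g (2^-1) = 0 by rewrite fg ?subrr //; apply/unitIE/andP; split; lra.
move=> x /andP[x0 x1]; apply/eqP; rewrite -subr_eq0 -h2; apply/eqP.
have [xh|xh] := leP x 2^-1; first by apply: (C1on_const_sub h) => //; lra.
by symmetry; apply: (C1on_const_sub h) => //; lra.
Qed.

Lemma affine_of_orthogonal w : cont01 w ->
  (forall P0 P1 P2, C1on P0 P1 -> C1on P1 P2 -> P0 0 = 0 -> P0 1 = 0 ->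
    P1 0 = 0 -> P1 1 = 0 -> test_function P1 -> P1^`() = P2 ->
    int01 (fun x => w x * P2 x) = 0) ->
  exists c0 c1, forall x, 0 <= x <= 1 -> w x = c0 + c1 * x.
Proof.
move=> cw horth.
pose c1 := (w (3 / 4) - w (1 / 4)) * 2; pose c0 := w (1 / 4) - c1 / 4.
exists c0, c1; apply: cont01_eqI => //.
  by apply: cont01D; [exact: cont01_cst|apply: cont01Z; exact: cont01_id].
move=> x /unitIE/andP[x0 x1].
pose a := Num.min x (1 / 4) / 2; pose b := (1 + Num.max x (3 / 4)) / 2.
have : [/\ 0 < a, a < b, b < 1, a < x < b & a < 1 / 4 /\ 3 / 4 < b].
  rewrite /a /b; case: (ltP x (1/4)) => h1; case: (ltP x (3/4)) => h2; split; try (apply/andP; split); try lra; try (split; lra).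
case=> a0 ab b1 xab [a4 b4].
have [d0 [d1 hd]] := affine_of_orthogonal_local cw a0 ab b1 horth.
have e1 : w (1/4) = d0 + d1 * (1/4) by apply: hd; apply/andP; split; lra.
have e2 : w (3/4) = d0 + d1 * (3/4) by apply: hd; apply/andP; split; lra.
by rewrite hd // /c0 /c1 e1 e2; field.
Qed.

(** [K] is a second antiderivative of k / c; integrating the weak equation by
    parts twice shows that u - K is orthogonal to all second derivatives of
    test functions, so it is affine. *)
Lemma weak_C2 (u du k : R -> R) c : c != 0 -> in_H10 u du -> cont01 k ->
  (forall p q, C1on p q -> p 0 = 0 -> p 1 = 0 ->
    c * int01 (fun x => q x * du x) + int01 (fun x => p x * k x) = 0) ->
  exists2 u1, C1on u u1 & C1on u1 (fun x => k x / c).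
Proof.
move=> c0 [[cu u0 u1] [_ _ wu]] ck hweak.
have ck' : cont01 (fun x => k x / c).
  by apply: cont01_eq (cont01Z c^-1 ck) => x _; rewrite mulrC.
have [K1 [hK1 _]] := cont01_antiderivative ck'.
have cK1 : cont01 K1 by case: hK1.
have [K [hK _]] := cont01_antiderivative cK1.
have cK : cont01 K by case: hK.
have [|d0 [d1 hd]] := @affine_of_orthogonal (fun x => u x - K x) (cont01B cu cK).
  move=> P0 P1 P2 h0 h1 P00 P01 P10 P11 tP dP.
  have cP0 : cont01 P0 by case: h0.
  have cP1 : cont01 P1 by case: h0.
  have cP2 : cont01 P2 by case: h1.
  have H := hweak _ _ h0 P00 P01.
  have E1 : int01 (fun x => u x * P2 x) = - int01 (fun x => du x * P1 x).
    by have := wu _ tP; rewrite dP.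
  have E2 := FTC (C1onB (C1onM hK1 h0) (C1onM hK h1)).
  rewrite /= P00 P01 P10 P11 !mulr0 !subrr in E2.
  rewrite (@eq_int01 _ _ (fun x => c^-1 * (P0 x * k x) - K x * P2 x)) in E2; last by move=> x _; ring.
  rewrite int01B in E2; [|by apply: cont01Z; exact: cont01M|exact: cont01M].
  rewrite int01Z in E2; last by apply: cont01_integrable; exact: cont01M.
  rewrite (@eq_int01 _ _ (fun x => u x * P2 x - K x * P2 x)); last by move=> x _; ring.
  rewrite int01B; [|exact: cont01M..].
  have -> : int01 (fun x => K x * P2 x) = c^-1 * int01 (fun x => P0 x * k x) by lra.
  rewrite E1; have -> : int01 (fun x => P0 x * k x) = - c * int01 (fun x => P1 x * du x) by lra.
  rewrite (@eq_int01 _ (fun x => du x * P1 x) (fun x => P1 x * du x)); last by move=> x _; ring.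
  by field.
exists (fun x => K1 x + d1).
  apply: (@C1on_eql _ (fun x => K x + (d0 + d1 * x))).
    by move=> x /hd <-; ring.
  apply: C1on_eqr (C1onD hK (C1onD (C1on_cst d0) (C1onZ d1 (@C1on_id R)))) => x _.
  by rewrite add0r mulr1.
by apply: C1on_eqr (C1onD hK1 (C1on_cst d1)) => x _; rewrite addr0.
Qed.

Lemma row_mul2 (a b : 'cV[R]_2) : (a^T *m b) 0 0 = a 0 0 * b 0 0 + a 1 0 * b 1 0.
Proof. by rewrite !mxE !big_ord_recr big_ord0 /= add0r !mxE; congr (a _ _ * b _ _ + a _ _ * b _ _); apply/val_inj. Qed.

Lemma mulmx2E (M : 'M[R]_2) (b : 'cV[R]_2) i : (M *m b) i 0 = M i 0 * b 0 0 + M i 1 * b 1 0.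
Proof. by rewrite !mxE !big_ord_recr big_ord0 /= add0r; congr (M _ _ * b _ _ + M _ _ * b _ _); apply/val_inj. Qed.

(** The diagonal entries of the matrix D of the operator. *)
Definition diagc (eps mu : R) (i : 'I_2) : R := if i == 0 then eps ^+ 2 else mu ^+ 2.

Lemma diag_sqE eps mu' (b : 'cV[R]_2) i : (diag_sq eps mu' *m b) i 0 = diagc eps mu' i * b i 0.
Proof. by rewrite /diag_sq mul_diag_mx !mxE. Qed.

Lemma ord2P (P : 'I_2 -> Prop) : P 0 -> P 1 -> forall i, P i.
Proof. by move=> P0 P1 [[|[|//]] hi]; [move: P0|move: P1]; congr P; apply/val_inj. Qed.

Lemma solution_C2 eps mu' (A : R -> 'M[R]_2) (F U : R -> 'cV[R]_2) :
  0 < eps -> 0 < mu' ->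
  (forall i j, cont01 (fun x => A x i j)) -> (forall i, cont01 (fun x => F x i 0)) ->
  is_solution eps mu' A F U ->
  forall i, [/\ U 0 i 0 = 0, U 1 i 0 = 0 & exists2 u1, C1on (component U i) u1 &
    C1on u1 (fun x => ((A x *m U x) i 0 - F x i 0) / diagc eps mu' i)].
Proof.
move=> e0 m0 cA cF [dU hU hweak] i.
have [[cu u0 u1] [_ _ _]] := hU i; split => //.
have cU j : cont01 (fun x => U x j 0) by have [[]] := hU j.
have cAU j : cont01 (fun x => (A x *m U x) j 0).
  apply: (@cont01_eq _ (fun x => A x j 0 * U x 0 0 + A x j 1 * U x 1 0)).
    by move=> x _; rewrite mulmx2E.
  by apply: cont01D; apply: cont01M.
have d0 : diagc eps mu' i != 0 by rewrite /diagc; case: ifP => _; rewrite expf_neq0 // gt_eqF.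
have ck : cont01 (fun x => (A x *m U x) i 0 - F x i 0) by exact: cont01B.
apply: (weak_C2 d0 (hU i) ck) => p q hpq p0 p1.
pose V (r : R -> R) x : 'cV[R]_2 := \col_j (if j == i then r x else 0).
have VT (r : R -> R) x (b : 'cV[R]_2) : ((V r x)^T *m b) 0 0 = r x * b i 0.
  rewrite row_mul2 !mxE; move: {d0 hweak hU cU cAU ck cu u0 u1} i @V; apply: ord2P => /=.
    by rewrite mul0r addr0.
  by rewrite mul0r add0r.
have hV : in_H10_vec (V p) (V q).
  move=> j; rewrite (_ : component (V p) j = if j == i then p else fun=> 0); last first.
    by apply/funext => x; rewrite /component mxE; case: ifP.
  rewrite (_ : component (V q) j = if j == i then q else fun=> 0); last first.
    by apply/funext => x; rewrite /component mxE; case: ifP.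
  by case: ifP => _; [exact: C1on_H10|exact: in_H10_0].
have cp : cont01 p by case: hpq.
have cq : cont01 q by case: hpq.
have := hweak _ _ hV.
rewrite (_ : (\int[_]_(x in _) _) = int01 (fun x => (diagc eps mu' i * q x) * dU x i 0 + p x * (A x *m U x) i 0)); last first.
  apply: eq_int01 => x _; rewrite -!mulmxA mxE !VT diag_sqE; ring.
rewrite (_ : (\int[_]_(x in _) _) = int01 (fun x => p x * F x i 0)); last first.
  by apply: eq_int01 => x _; rewrite VT.
have [_ [_ l2 _]] := hU i.
have iq : mu.-integrable (@unitI R) (EFin \o (fun x => q x * dU x i 0)).
  by apply: in_L2_mulI l2; exact: cont01_L2.
have iZ : mu.-integrable (@unitI R) (EFin \o (fun x => (diagc eps mu' i * q x) * dU x i 0)).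
  by apply: in_L2_mulI l2; apply: cont01_L2; exact: cont01Z.
rewrite int01D //; last by apply: cont01_integrable; exact: cont01M.
rewrite (@eq_int01 _ (fun x => _ * q x * _) (fun x => diagc eps mu' i * (q x * dU x i 0))); last by move=> x _; ring.
rewrite int01Z // => H.
rewrite (@eq_int01 _ (fun x => p x * _) (fun x => p x * (A x *m U x) i 0 - p x * F x i 0)); last by move=> x _; ring.
rewrite int01B; [|exact: cont01M..].
by rewrite /component -H; ring.
Qed.
End Regularity2.

(** * The energy estimate *)

Section Energy.
Context {R : realType}.
Implicit Types (f g p P w : R -> R) (x y a b c : R).

Lemma le_of_eq (x y : R) : x = y -> x <= y.
Proof. by move=> ->. Qed.

(** With e = R - (linear lift of the boundary values), the right-hand side is 4
    times the derivative of eps^2 e0 e0' + mu^2 e1 e1' plus O(eta^2); the lift and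
    the residual [g0], [g1] are absorbed by Young's inequality into half of the
    coercivity. *)
Lemma energy_pointwise (al Ca eta e0 e1 d0 d1 l0 l1 dl0 dl1 g0 g1 a00 a01 a10 a11 ep m : R) :
  0 < al -> 0 <= Ca -> 0 <= eta -> 0 < ep <= 1 -> 0 < m <= 1 ->
  `|l0| <= eta -> `|l1| <= eta -> `|dl0| <= 2 * eta -> `|dl1| <= 2 * eta ->
  `|g0| <= eta -> `|g1| <= eta ->
  `|a00| <= Ca -> `|a01| <= Ca -> `|a10| <= Ca -> `|a11| <= Ca ->
  al ^+ 2 * (e0 ^+ 2 + e1 ^+ 2) <= e0 * (a00 * e0 + a01 * e1) + e1 * (a10 * e0 + a11 * e1) ->
  ep ^+ 2 * (d0 + dl0) ^+ 2 + m ^+ 2 * (d1 + dl1) ^+ 2 +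
    al ^+ 2 * ((e0 + l0) ^+ 2 + (e1 + l1) ^+ 2) <=
  4 * (ep ^+ 2 * d0 ^+ 2 + m ^+ 2 * d1 ^+ 2 +
    e0 * (a00 * (e0 + l0) + a01 * (e1 + l1) - g0) + e1 * (a10 * (e0 + l0) + a11 * (e1 + l1) - g1))
  + (4 * (2 * Ca + 1) ^+ 2 / al ^+ 2 + 16 + 4 * al ^+ 2) * eta ^+ 2.
Proof.
move=> al0 Ca0 eta0 /andP[ep0 ep1] /andP[m0 m1] hl0 hl1 hd0 hd1 hg0 hg1 h00 h01 h10 h11 hell.
have sqr_le (u v : R) : `|u| <= v -> u ^+ 2 <= v ^+ 2.
  by move=> h; rewrite -(real_normK (num_real u)); apply: lerXn2r => //; rewrite nnegrE ?(le_trans _ h).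
pose B := (2 * Ca + 1) * eta.
have B0 : 0 <= B by rewrite mulr_ge0 //; lra.
have hb (e u v g' a b' : R) : `|u| <= eta -> `|v| <= eta -> `|g'| <= eta -> `|a| <= Ca -> `|b'| <= Ca ->
   - (al ^+ 2 / 2 * e ^+ 2 + B ^+ 2 / (2 * al ^+ 2)) <= e * (a * u + b' * v - g').
  move=> hu hv hg ha hb.
  have hB : `|a * u + b' * v - g'| <= B.
    apply: le_trans (ler_normB _ _) _; rewrite /B mulrDl mul1r.
    apply: lerD => //; apply: le_trans (ler_normD _ _) _; rewrite !normrM.
    have -> : 2 * Ca * eta = Ca * eta + Ca * eta by ring.
    by apply: lerD; apply: ler_pM.
  set z := a * u + b' * v - g' in hB *.
  have z2 : z ^+ 2 <= B ^+ 2 by exact: sqr_le.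
  have h1 : 0 <= (al * e + z / al) ^+ 2 by exact: sqr_ge0.
  have h2 : (al * e + z / al) ^+ 2 = al ^+ 2 * e ^+ 2 + 2 * (e * z) + z ^+ 2 / al ^+ 2.
    by field; rewrite gt_eqF.
  have h3 : z ^+ 2 / al ^+ 2 <= B ^+ 2 / al ^+ 2.
    by rewrite ler_pM2r // invr_gt0 exprn_gt0.
  have -> : B ^+ 2 / (2 * al ^+ 2) = B ^+ 2 / al ^+ 2 / 2 by field; rewrite gt_eqF.
  lra.
have H0 := hb e0 l0 l1 g0 a00 a01 hl0 hl1 hg0 h00 h01.
have H1 := hb e1 l0 l1 g1 a10 a11 hl0 hl1 hg1 h10 h11.
have -> : 4 * (2 * Ca + 1) ^+ 2 / al ^+ 2 = 8 * ((2 * Ca + 1) ^+ 2 / (2 * al ^+ 2)) by field; rewrite gt_eqF.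
have EB : B ^+ 2 / (2 * al ^+ 2) = (2 * Ca + 1) ^+ 2 / (2 * al ^+ 2) * eta ^+ 2.
  by rewrite /B; field; rewrite gt_eqF.
rewrite EB in H0 H1; set K := _ / (2 * al ^+ 2) in H0 H1 *.
have sq2 (s t : R) : (s + t) ^+ 2 <= 2 * s ^+ 2 + 2 * t ^+ 2.
  by have := sqr_ge0 (s - t); lra.
have Pe (s d dl : R) : 0 < s -> s <= 1 -> `|dl| <= 2 * eta ->
    s ^+ 2 * (d + dl) ^+ 2 <= 2 * (s ^+ 2 * d ^+ 2) + 8 * eta ^+ 2.
  move=> s0 s1 hdl.
  have h1 := sq2 d dl; have h2 := sqr_le _ _ hdl.
  have s2 : s ^+ 2 <= 1 by rewrite exprn_ile1 // ltW.
  have s3 : 0 <= s ^+ 2 by exact: sqr_ge0.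
  apply: le_trans (_ : s ^+ 2 * (2 * d ^+ 2 + 2 * dl ^+ 2) <= _); first by apply: ler_wpM2l.
  have : s ^+ 2 * dl ^+ 2 <= 1 * (2 * eta) ^+ 2 by apply: ler_pM => //; exact: sqr_ge0.
  lra.
have D0 := Pe _ d0 _ ep0 ep1 hd0; have D1 := Pe _ d1 _ m0 m1 hd1.
have E0 : al ^+ 2 * (e0 + l0) ^+ 2 <= al ^+ 2 * (2 * e0 ^+ 2 + 2 * eta ^+ 2).
  by apply: ler_wpM2l; [exact: sqr_ge0|have := sq2 e0 l0; have := sqr_le _ _ hl0; lra].
have E1 : al ^+ 2 * (e1 + l1) ^+ 2 <= al ^+ 2 * (2 * e1 ^+ 2 + 2 * eta ^+ 2).
  by apply: ler_wpM2l; [exact: sqr_ge0|have := sq2 e1 l1; have := sqr_le _ _ hl1; lra].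
have G0 : 0 <= ep ^+ 2 * d0 ^+ 2 by rewrite mulr_ge0 ?sqr_ge0.
have G1 : 0 <= m ^+ 2 * d1 ^+ 2 by rewrite mulr_ge0 ?sqr_ge0.
rewrite !mulrDr in E0 E1 hell H0 H1 *.
lra.
Qed.

Definition energy_cst (al Ca : R) := 4 * (2 * Ca + 1) ^+ 2 / al ^+ 2 + 16 + 4 * al ^+ 2.

Lemma energy_cst_ge1 al Ca : 1 <= energy_cst al Ca.
Proof.
have h1 : 0 <= 4 * (2 * Ca + 1) ^+ 2 / al ^+ 2 by rewrite divr_ge0 ?sqr_ge0 // mulr_ge0 ?sqr_ge0.
have h2 : 0 <= 4 * al ^+ 2 by rewrite mulr_ge0 ?sqr_ge0.
rewrite /energy_cst; lra.
Qed.

(** Integrate [energy_pointwise]: the exact derivative contributes 0 because e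
    vanishes at both endpoints. *)
Lemma energy_bound (al Ca eta ep m : R) (A : R -> 'M[R]_2) (U : R -> 'cV[R]_2)
    (u1 u2 : 'I_2 -> R -> R) :
  0 < al -> 0 <= Ca -> 0 <= eta -> 0 < ep <= 1 -> 0 < m <= 1 ->
  (forall x i j, unitI x -> `|A x i j| <= Ca) ->
  (forall (x : R) (xi : 'cV[R]_2), 0 <= x <= 1 ->
     al ^+ 2 * (xi^T *m xi) 0 0 <= (xi^T *m A x *m xi) 0 0) ->
  (forall i, C1on (component U i) (u1 i)) -> (forall i, C1on (u1 i) (u2 i)) ->
  (forall i, `|U 0 i 0| <= eta) -> (forall i, `|U 1 i 0| <= eta) ->
  (forall x i, unitI x -> `|(A x *m U x) i 0 - diagc ep m i * u2 i x| <= eta) ->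
  (normE ep m al U <= (energy_cst al Ca * eta)%:E)%E.
Proof.
move=> al0 Ca0 eta0 hep hm hA hell h1 h2 b0 b1 hL.
pose r i x := U x i 0.
pose L i x := r i 0 * (1 - x) + r i 1 * x.
pose dL (i : 'I_2) := r i 1 - r i 0.
have hLC i : C1on (L i) (fun=> dL i).
  have h01 := C1onB (C1on_cst 1) (@C1on_id R).
  by apply: C1on_eqr (C1onD (C1onZ (r i 0) h01) (C1onZ (r i 1) (@C1on_id R))) => x _; rewrite /dL; ring.
have hE i : C1on (fun x => r i x - L i x) (fun x => u1 i x - dL i) by exact: C1onB (h1 i) (hLC i).
have hE1 i : C1on (fun x => u1 i x - dL i) (u2 i).
  by apply: C1on_eqr (C1onB (h2 i) (C1on_cst (dL i))) => x _; rewrite subr0.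
pose Q x := ep ^+ 2 * ((r 0 x - L 0 x) * (u1 0 x - dL 0)) + m ^+ 2 * ((r 1 x - L 1 x) * (u1 1 x - dL 1)).
have hQ := C1onD (C1onZ (ep ^+ 2) (C1onM (hE 0) (hE1 0))) (C1onZ (m ^+ 2) (C1onM (hE 1) (hE1 1))).
have cu1 i : cont01 (u1 i) by case: (h2 i).
have cr i : cont01 (r i) by case: (h1 i).
have ant f : cont01 f -> exists P, C1on P (fun x => f x ^+ 2).
  by move=> cf; have [P [hP _]] := cont01_antiderivative (cont01M cf cf); exists P; apply: C1on_eqr hP => x _; rewrite expr2.
have [P0 hP0] := ant _ (cu1 0); have [P1 hP1] := ant _ (cu1 1).
have [P2 hP2] := ant _ (cr 0); have [P3 hP3] := ant _ (cr 1).
have der i : forall x, unitI x -> (component U i)^`() x = u1 i x.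
  by move=> x Ix; apply: der_derive1; have [_ _] := h1 i; apply.
rewrite /normE (normL2_sqr (der 0) (cu1 0) hP0) (normL2_sqr (der 1) (cu1 1) hP1).
rewrite (normL2_sqr (fun _ _ => erefl) (cr 0) hP2) (normL2_sqr (fun _ _ => erefl) (cr 1) hP3).
rewrite -!(EFinM, EFinD) /= lee_fin.
have hN := C1onD (C1onD (C1onZ (ep ^+ 2) hP0) (C1onZ (m ^+ 2) hP1)) (C1onZ (al ^+ 2) (C1onD hP2 hP3)).
have hT := C1onB (C1onD (C1onZ 4 hQ) (C1onZ (energy_cst al Ca * eta ^+ 2) (@C1on_id R))) hN.
have /= := C1on_mono hT.
have -> : r 0 0 - L 0 0 = 0 by rewrite /L; ring.
have -> : r 0 1 - L 0 1 = 0 by rewrite /L; ring.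
have -> : r 1 0 - L 1 0 = 0 by rewrite /L; ring.
have -> : r 1 1 - L 1 1 = 0 by rewrite /L; ring.
move=> H.
have {}H : ep ^+ 2 * (P0 1 - P0 0) + m ^+ 2 * (P1 1 - P1 0) + al ^+ 2 * (P2 1 - P2 0 + (P3 1 - P3 0))
    <= energy_cst al Ca * eta ^+ 2.
  suff K : ltac:(match type of H with ?X -> _ => exact X end) by have := H K; lra.
  move=> x Ix; rewrite mulr1 subr_ge0.
  have xI : 0 <= x <= 1 by case/unitIE/andP: Ix => *; apply/andP; split; lra.
  have hl i : `|L i x| <= eta.
    move/andP: xI => [x0 x1].
    have -> : eta = eta * (1 - x) + eta * x by ring.
    rewrite /L; apply: le_trans (ler_normD _ _) _; rewrite !normrM.
    by rewrite (ger0_norm x0) (@ger0_norm _ (1 - x)) ?subr_ge0 //; apply: lerD; apply: ler_wpM2r; rewrite ?subr_ge0 //; [exact: b0|exact: b1].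
  have hdl i : `|dL i| <= 2 * eta.
    by rewrite /dL; apply: le_trans (ler_normB _ _) _; have := b0 i; have := b1 i; rewrite /r; lra.
  have hg i := hL x i Ix.
  have HH : al ^+ 2 * ((r 0 x - L 0 x) ^+ 2 + (r 1 x - L 1 x) ^+ 2) <=
     (r 0 x - L 0 x) * (A x 0 0 * (r 0 x - L 0 x) + A x 0 1 * (r 1 x - L 1 x)) +
     (r 1 x - L 1 x) * (A x 1 0 * (r 0 x - L 0 x) + A x 1 1 * (r 1 x - L 1 x)).
    have := hell x (\col_i (r i x - L i x)) xI.
    by rewrite -mulmxA !row_mul2 !mulmx2E !mxE !expr2.
  have := @energy_pointwise al Ca eta (r 0 x - L 0 x) (r 1 x - L 1 x) (u1 0 x - dL 0) (u1 1 x - dL 1) (L 0 x) (L 1 x) (dL 0) (dL 1) ((A x *m U x) 0 0 - diagc ep m 0 * u2 0 x) ((A x *m U x) 1 0 - diagc ep m 1 * u2 1 x) (A x 0 0) (A x 0 1) (A x 1 0) (A x 1 1) ep m al0 Ca0 eta0 hep hm (hl 0) (hl 1) (hdl 0) (hdl 1) (hg 0) (hg 1) (hA x 0 0 Ix) (hA x 0 1 Ix) (hA x 1 0 Ix) (hA x 1 1 Ix) HH.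
  rewrite !subrK => HP; apply: le_trans HP _; apply: le_of_eq.
  by rewrite !mulmx2E /diagc /= -/(r 0 x) -/(r 1 x) /energy_cst; ring.
have CE := energy_cst_ge1 al Ca.
rewrite -[leRHS]ger0_norm ?mulr_ge0 //; last lra.
rewrite -sqrtr_sqr ler_wsqrtr //.
have -> : ep ^+ 2 * (P0 1 - P0 0) + m ^+ 2 * (P1 1 - P1 0) + al ^+ 2 * ((P2 1 - P2 0) + (P3 1 - P3 0)) = ep ^+ 2 * (P0 1 - P0 0) + m ^+ 2 * (P1 1 - P1 0) + al ^+ 2 * (P2 1 - P2 0 + (P3 1 - P3 0)) by [].
apply: le_trans H _; rewrite exprMn; apply: ler_wpM2r; first exact: sqr_ge0.
by rewrite expr2 ler_peMr // (le_trans ler01).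
Qed.
End Energy.

(** * Analytic functions through their Taylor coefficients *)

Section Towers.
Context {R : realType}.
Implicit Types (f g p P w : R -> R) (x y a b c : R) (F G H : nat -> R -> R).

Lemma cont01_bound_closed f M : cont01 f -> (forall x, unitI x -> `|f x| <= M) ->
  forall x, 0 <= x <= 1 -> `|f x| <= M.
Proof.
move=> cf fM.
have cN (h : R -> R) : cont01 h -> cont01 (fun x => `|h x|).
  by move=> ch x; apply: cvg_norm; exact: ch.
have ch : cont01 (fun x => `|(`|f x| - M)| + (`|f x| - M)).
  by apply: cont01D; [apply: (cN (fun x => `|f x| - M))|]; apply: cont01B => //; (exact: cN || exact: cont01_cst).
move=> x xI; rewrite -subr_le0.
have h : `|(`|f x| - M)| + (`|f x| - M) = 0.
  by apply: (cont01_eqI ch (cont01_cst 0)) xI => y Iy; rewrite ler0_norm ?subr_le0 ?fM // addNr.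
by have := normr_ge0 (`|f x| - M); lra.
Qed.

(** f + M x is monotone and bounded, so it has one-sided limits at the endpoints. *)
Lemma continuous_extension (f f' : R -> R) M :
  (forall x, unitI x -> is_derive x 1 f (f' x)) ->
  (forall x, unitI x -> `|f x| <= M) -> (forall x, unitI x -> `|f' x| <= M) ->
  exists2 g, cont01 g & forall x, unitI x -> g x = f x.
Proof.
move=> df fM f'M.
pose h x := f x + M * x.
have dh x : unitI x -> is_derive x 1 h (f' x + M * 1).
  by move=> Ix; exact: derD (df _ Ix) (derZ M (der_id x)).
have inI x : x \in `]0, 1[%R -> unitI x by [].
have hm : {in `]0, 1[%R &, {homo h : x y / x <= y}}.
  have H1 x : x \in `]0, 1[%R -> derivable h x 1 by move=> xI; have [] := dh x (inI x xI).
  have H2 x : x \in `]0, 1[%R -> 0 <= h^`() x.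
    move=> /inI Ix; rewrite (der_derive1 (dh x Ix)) mulr1.
    by have := f'M x Ix; rewrite ler_norml => /andP[? _]; lra.
  apply: (ger0_derive1_le_oo H1 H2) => x; rewrite inE => Ix; exact: der_cont (dh x Ix).
have hb x : unitI x -> - M - `|M| <= h x <= M + `|M|.
  move=> Ix; have := fM x Ix; rewrite ler_norml => /andP[h1 h2].
  have : `|M * x| <= `|M|.
    by rewrite normrM ler_piMr // ger0_norm; case/unitIE/andP: Ix => *; lra.
  by rewrite ler_norml => /andP[h3 h4]; rewrite /h; apply/andP; split; lra.
have [l0 hl0] : exists l : R, h y @[y --> (0:R)^'+] --> l.
  apply/cvg_ex; apply: nondecreasing_at_right_is_cvgr.
    near=> b => x y; rewrite !in_itv /= => /andP[x0 xb] /andP[y0 yb] xy.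
    have b1 : b < 1 by near: b; exact: nbhs_right_lt.
    by apply: hm => //; rewrite in_itv /=; apply/andP; split; lra.
  near=> b; exists (- M - `|M|) => z /= [x]; rewrite in_itv /= => /andP[x0 xb] <-.
  have b1 : b < 1 by near: b; exact: nbhs_right_lt.
  have Ix : unitI x by apply/unitIE/andP; split; lra.
  by have /andP[] := hb x Ix.
have [l1 hl1] : exists l : R, h y @[y --> (1:R)^'-] --> l.
  apply/cvg_ex; apply: nondecreasing_at_left_is_cvgr.
    near=> b => x y; rewrite !in_itv /= => /andP[x0 xb] /andP[y0 yb] xy.
    have b1 : 0 < b by near: b; exact: nbhs_left_gt.
    by apply: hm => //; rewrite in_itv /=; apply/andP; split; lra.
  near=> b; exists (M + `|M|) => z /= [x]; rewrite in_itv /= => /andP[x0 xb] <-.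
  have b1 : 0 < b by near: b; exact: nbhs_left_gt.
  have Ix : unitI x by apply/unitIE/andP; split; lra.
  by have /andP[] := hb x Ix.
have fh : f = fun x => h x - M * x by apply/funext => x; rewrite /h; ring.
have hMc : continuous (fun x : R => M * x) by move=> x; apply: cvgM; [exact: cvg_cst|exact: cvg_id].
have hf0 : f y @[y --> 0^'+] --> l0 - M * 0.
  by rewrite fh; apply: cvgB hl0 _; apply: cvg_at_right_filter; exact: hMc.
have hf1 : f y @[y --> 1^'-] --> l1 - M * 1.
  by rewrite fh; apply: cvgB hl1 _; apply: cvg_at_left_filter; exact: hMc.
pose g x := if x <= 0 then l0 - M * 0 else if 1 <= x then l1 - M * 1 else f x.
have gf x : unitI x -> g x = f x.
  by move=> /unitIE/andP[x0 x1]; rewrite /g leNgt x0 /= leNgt x1.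
exists g => //; apply/continuous_within_itvP => //; split.
- move=> x /inI Ix; have Ix' := Ix; move: Ix => /unitIE/andP[x0 x1].
  by apply: der_cont (der_eqI (fun y Iy => esym (gf y Iy)) Ix' (df x Ix')).
- rewrite {2}/g lexx; apply: cvg_trans hf0; apply: near_eq_cvg.
  near=> y; symmetry; apply: gf; apply/unitIE/andP; split; near: y.
    exact: nbhs_right_gt.
  exact: nbhs_right_lt.
- rewrite {2}/g lexx ler10; apply: cvg_trans hf1; apply: near_eq_cvg.
  near=> y; symmetry; apply: gf; apply/unitIE/andP; split; near: y.
    exact: nbhs_left_gt.
  exact: nbhs_left_lt.
Unshelve. all: by end_near. Qed.

(** [F n] stands for the normalised derivative f^(n) / n!, extended continuously to
    the endpoints.  With this normalisation the Leibniz rule is a Cauchy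
    product, and the expansion at an endpoint uses the values there. *)
Definition tower F := forall n, cont01 (F n) /\
  forall x, unitI x -> is_derive x 1 (F n) (n.+1%:R * F n.+1 x).

Lemma tower_C1on F n : tower F -> C1on (F n) (fun x => n.+1%:R * F n.+1 x).
Proof. by move=> tF; split; [case: (tF n)|apply: cont01Z; case: (tF n.+1)|case: (tF n)]. Qed.

Definition tbound C ga F := forall n x, 0 <= x <= 1 -> `|F n x| <= C * ga ^+ n.

Lemma tower_derive1n F f n x : tower F -> (forall y, unitI y -> f y = F 0%N y) ->
  unitI x -> f^`(n) x = n`!%:R * F n x.
Proof.
move=> tF f0; elim: n x => [x Ix|n IH x Ix].
  by rewrite fact0 mul1r derive1n0 f0.
rewrite derive1nS.
have [_ /(_ x Ix) d] := tF n.
rewrite (der_derive1 (der_eqI (fun y Iy => esym (IH y Iy)) Ix (derZ n`!%:R d))).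
by rewrite factS natrM mulrA (mulrC n.+1%:R).
Qed.

Lemma tower_smooth F f : tower F -> (forall y, 0 <= y <= 1 -> f y = F 0%N y) -> smooth_on_I f.
Proof.
move=> tF f0; split; first by apply: cont01_eq (tF 0%N).1 => x xI; rewrite f0.
have f0' y : unitI y -> f y = F 0%N y.
  by case/unitIE/andP => *; apply: f0; apply/andP; split; lra.
move=> n x Ix; have [_ /(_ x Ix) d] := tF n.
have := der_eqI (fun y Iy => esym (tower_derive1n n tF f0' Iy)) Ix (derZ n`!%:R d).
by case.
Qed.

(** The L^oo bounds make each derivative Lipschitz, so it extends continuously
    to the closed interval with the same bound. *)
Lemma tower_of_data C ga f : 0 < C -> 0 < ga -> analytic_data C ga f ->
  exists F, [/\ tower F, tbound C ga F & forall x, 0 <= x <= 1 -> F 0%N x = f x].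
Proof.
move=> C0 ga0 [[cf df] hb].
have dn n x : unitI x -> is_derive x 1 (f^`(n)) (f^`(n.+1) x).
  by move=> Ix; rewrite derive1nS derive1E; apply: derivableP; exact: df.
have bn n x : unitI x -> `|f^`(n) x| <= C * ga ^+ n * n`!%:R.
  by apply: normLoo_ge => // y Iy; exact: der_cont (dn n y Iy).
have ex n : exists g, cont01 g /\ forall x, unitI x -> g x = f^`(n) x.
  have [x Ix|x Ix|g cg gE] := @continuous_extension (f^`(n)) (f^`(n.+1)) (Num.max (C * ga ^+ n * n`!%:R) (C * ga ^+ n.+1 * n.+1`!%:R)) (dn n).
  - by rewrite le_max bn.
  - by rewrite le_max (bn n.+1) // orbT.
  - by exists g.
have [G hG] := choice ex.
have fn0 n : n`!%:R != 0 :> R by rewrite pnatr_eq0 -lt0n fact_gt0.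
exists (fun n x => n`!%:R^-1 * G n x); split.
- move=> n; split; first by apply: cont01Z; case: (hG n).
  move=> x Ix; have [_ e] := hG n.
  have := derZ n`!%:R^-1 (der_eqI (fun y Iy => esym (e y Iy)) Ix (dn n x Ix)).
  have [_ /(_ x Ix) ->] := hG n.+1.
  suff -> : n.+1%:R * (n.+1`!%:R^-1 * derive1n n.+1 f x) = n`!%:R^-1 * derive1n n.+1 f x by [].
  by rewrite mulrA factS natrM invfM mulrA divff ?mul1r // pnatr_eq0.
- move=> n x xI; rewrite normrM ger0_norm ?invr_ge0 ?ler0n //.
  rewrite mulrC ler_pdivrMr ?ltr0n ?fact_gt0 //.
  have [cG e] := hG n.
  by apply: (cont01_bound_closed cG) xI => y Iy; rewrite e // bn.
- move=> x xI; rewrite fact0 invr1 mul1r.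
  by have [cG e] := hG 0%N; apply: (cont01_eqI cG cf) xI.
Qed.
End Towers.

(** * Products, inverses and Taylor expansions *)

Section TowerAlgebra.
Context {R : realType}.
Implicit Types (f g p P w : R -> R) (x y a b c : R) (F G H : nat -> R -> R).

Definition tadd F G n x := F n x + G n x.
Definition tscale c F n x := c * F n x.
Definition tmul F G n x := \sum_(i < n.+1) F i x * G (n - i)%N x.
Definition tD F n x := n.+1%:R * F n.+1 x.
(** The normalised derivatives of x |-> f (1 - x). *)
Definition trefl F n x := (-1) ^+ n * F n (1 - x).

Lemma tower_add F G : tower F -> tower G -> tower (tadd F G).
Proof.
move=> tF tG n; have [cF dF] := tF n; have [cG dG] := tG n.
by split; [exact: cont01D|move=> x Ix; rewrite mulrDr; exact: derD (dF x Ix) (dG x Ix)].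
Qed.

Lemma tower_scale c F : tower F -> tower (tscale c F).
Proof.
move=> tF n; have [cF dF] := tF n; split; first exact: cont01Z.
by move=> x Ix; rewrite /tscale mulrCA; exact: derZ (dF x Ix).
Qed.

Lemma tower_D F : tower F -> tower (tD F).
Proof.
move=> tF n; have [cF dF] := tF n.+1; split; first exact: cont01Z.
by move=> x Ix; exact: derZ (dF x Ix).
Qed.

(** The Leibniz rule for Cauchy products: write n + 1 = i + (n + 1 - i) in the
    sum on the right and shift the index of the first half. *)
Lemma cauchy_shift (a b : nat -> R) n :
  \sum_(i < n.+1) (i.+1%:R * a i.+1 * b (n - i)%N + a i * ((n - i).+1%:R * b (n - i).+1)) =
  n.+1%:R * \sum_(i < n.+2) a i * b (n.+1 - i)%N.
Proof.
have -> : n.+1%:R * \sum_(i < n.+2) a i * b (n.+1 - i)%N =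
   \sum_(i < n.+2) i%:R * a i * b (n.+1 - i)%N + \sum_(i < n.+2) a i * ((n.+1 - i)%:R * b (n.+1 - i)%N).
  rewrite mulr_sumr -big_split /=; apply: eq_bigr => i _.
  have -> : n.+1%:R = i%:R + (n.+1 - i)%:R :> R by rewrite -natrD subnKC // -ltnS.
  by ring.
rewrite big_split /= [X in _ = X + _]big_ord_recl [X in _ = _ + X]big_ord_recr /=.
rewrite !mul0r add0r subnn mul0r mulr0 addr0; congr (_ + _).
by apply: eq_bigr => i _; rewrite subSn // -ltnS.
Qed.

Lemma tower_mul F G : tower F -> tower G -> tower (tmul F G).
Proof.
move=> tF tG n; split.
  by apply: (@cont01_sum _ _ (fun i x => F i x * G (n - i)%N x)) => i _; apply: cont01M; [case: (tF i)|case: (tG (n - i)%N)].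
move=> x Ix; rewrite /tmul -(cauchy_shift (F^~ x) (G^~ x) n).
apply: (@der_sum _ _ (fun i x => F i x * G (n - i)%N x)
    _ (fun i => i.+1%:R * F i.+1 x * G (n - i)%N x + F i x * ((n - i).+1%:R * G (n - i).+1 x))) => i _.
have [_ dF] := tF i; have [_ dG] := tG (n - i)%N.
exact: derM (dF x Ix) (dG x Ix).
Qed.

Lemma cont01_refl f : cont01 f -> cont01 (fun x => f (1 - x)).
Proof.
move=> cf; apply/continuous_within_itvP => //.
have [c0 c1 c2] := (continuous_within_itvP f ltr01).1 cf.
have c1B : continuous (fun x : R => 1 - x).
  by move=> x; apply: cvgB; [exact: cvg_cst|exact: cvg_id].
split.
- move=> x; rewrite in_itv /= => /andP[x0 x1].
  apply: (@continuous_comp _ _ _ (fun x => 1 - x) f); first exact: c1B.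
  by apply: c0; rewrite in_itv /=; apply/andP; split; lra.
- rewrite subr0; apply/cvgrPdist_lt => e e0.
  have /cvgrPdist_lt/(_ e e0) := c2; rewrite /at_left near_withinE => h.
  rewrite /at_right near_withinE.
  have k : (fun x : R => 1 - x) @ (0 : R) --> (1 : R) by have := c1B 0; rewrite /continuous_at subr0.
  have kh : \forall y \near (0 : R), 1 - y < 1 -> `|f 1 - f (1 - y)| < e := k _ h.
  near=> y => y0 /=; have y1 : 1 - y < 1 by lra.
  by move: y1; near: y.
- rewrite subrr; apply/cvgrPdist_lt => e e0.
  have /cvgrPdist_lt/(_ e e0) := c1; rewrite /at_right near_withinE => h.
  rewrite /at_left near_withinE.
  have k : (fun x : R => 1 - x) @ (1 : R) --> (0 : R) by have := c1B 1; rewrite /continuous_at subrr.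
  have kh : \forall y \near (1 : R), 0 < 1 - y -> `|f 0 - f (1 - y)| < e := k _ h.
  near=> y => y0 /=; have y1 : 0 < 1 - y by lra.
  by move: y1; near: y.
Unshelve. all: by end_near.
Qed.

Lemma unitI_refl x : unitI x -> unitI (1 - x).
Proof. by move/unitIE/andP => [x0 x1]; apply/unitIE/andP; split; lra. Qed.

Lemma der_refl f x df : is_derive (1 - x) 1 f df -> is_derive x 1 (fun y => f (1 - y)) (- df).
Proof.
move=> h; have := der_comp (g := fun y => 1 - y) h (derB (der_cst 1 x) (der_id x)).
by rewrite sub0r mulrN1.
Qed.

Lemma tower_refl F : tower F -> tower (trefl F).
Proof.
move=> tF n; have [cF dF] := tF n; split; first exact: cont01Z (cont01_refl cF).
move=> x Ix; have := derZ ((-1) ^+ n) (der_refl (dF _ (unitI_refl Ix))).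
by rewrite /trefl exprS mulN1r !mulrN mulrCA mulNr mulrN.
Qed.

Lemma C1on_compare P p Q q : C1on P p -> C1on Q q -> P 0 = 0 -> Q 0 = 0 ->
  (forall x, unitI x -> `|p x| <= q x) -> forall x, 0 <= x <= 1 -> `|P x| <= Q x.
Proof.
move=> hP hQ P0 Q0 pq x /andP[x0 x1]; rewrite ler_norml.
have h1 := C1onB hQ hP; have h2 := C1onD hQ hP.
have := C1on_mono_sub h1 (lexx 0) x0 x1; have := C1on_mono_sub h2 (lexx 0) x0 x1.
rewrite /= P0 Q0 addr0 subr0 => H2 H1.
apply/andP; split.
  suff : 0 <= Q x + P x by lra.
  by apply: H2 => y Iy _; have := pq y Iy; rewrite ler_norml => /andP[]; lra.
suff : 0 <= Q x - P x by lra.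
by apply: H1 => y Iy _; have := pq y Iy; rewrite ler_norml => /andP[]; lra.
Qed.

Lemma der_pow n x : is_derive x 1 (fun y : R => y ^+ n.+1) (n.+1%:R * x ^+ n).
Proof.
elim: n => [|n IH].
  by have := der_id x; rewrite expr0 mulr1; congr (is_derive _ _ _ _); apply/funext => y; rewrite expr1.
have -> : (fun y : R => y ^+ n.+2) = fun y => y * y ^+ n.+1 by apply/funext => y; rewrite exprS.
have := derM (der_id x) IH; rewrite mul1r => h.
suff -> : n.+2%:R * x ^+ n.+1 = x ^+ n.+1 + x * (n.+1%:R * x ^+ n) by [].
by rewrite (mulrCA x) -exprS -[n.+2]add1n natrD mulrDl mul1r.
Qed.

Lemma C1on_pow n : C1on (fun y : R => y ^+ n.+1) (fun x => n.+1%:R * x ^+ n).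
Proof.
have cX m : cont01 (fun x : R => x ^+ m).
  by apply: cont01_cont => x; apply: exprn_continuous.
by split; [exact: cX|exact: cont01Z|move=> x _; exact: der_pow].
Qed.

Lemma C1on_sum n (P p : nat -> R -> R) : (forall i, (i < n)%N -> C1on (P i) (p i)) ->
  C1on (fun x => \sum_(i < n) P i x) (fun x => \sum_(i < n) p i x).
Proof.
move=> h; split.
- by apply: cont01_sum => i /h [].
- by apply: cont01_sum => i /h [].
- by move=> x Ix; apply: (@der_sum _ _ P _ (p^~ x)) => i /h [_ _]; apply.
Qed.

(** Induction on [M] over all towers: the derivative of the remainder is the
    remainder of order M of the derivative. *)
Lemma tower_taylor M F B : tower F -> (forall y, 0 <= y <= 1 -> `|F M y| <= B) ->
  forall x, 0 <= x <= 1 -> `|F 0%N x - \sum_(m < M) F m 0 * x ^+ m| <= B * x ^+ M.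
Proof.
elim: M F B => [|M IH] F B tF hB x xI.
  by rewrite big_ord0 subr0 expr0 mulr1; exact: hB.
have tDF := tower_D tF.
have hC : C1on (fun x => F 0%N x - \sum_(m < M.+1) F m 0 * x ^+ m)
   (fun x => tD F 0%N x - \sum_(m < M) tD F m 0 * x ^+ m).
  apply: (@C1on_eql _ (fun x => F 0%N x - (F 0%N 0 + \sum_(m < M) F m.+1 0 * x ^+ m.+1))).
    by move=> y _; rewrite big_ord_recl expr0 mulr1.
  apply: C1onB; first exact: tower_C1on.
  have h := @C1on_sum M (fun m x => F m.+1 0 * x ^+ m.+1) (fun m x => F m.+1 0 * (m.+1%:R * x ^+ m)) (fun m _ => C1onZ _ (C1on_pow m)).
  apply: C1on_eqr (C1onD (C1on_cst (F 0%N 0)) h) => y _.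
  by rewrite add0r; apply: eq_bigr => m _; rewrite /tD; ring.
apply: (C1on_compare hC (C1onZ B (C1on_pow M))) => //.
- by rewrite big_ord_recl expr0 mulr1 big1 ?addr0 ?subrr // => i _; rewrite exprS mul0r mulr0.
- by rewrite exprS mul0r mulr0.
- move=> y Iy; have yI : 0 <= y <= 1 by case/unitIE/andP: Iy => *; apply/andP; split; lra.
  rewrite mulrCA mulrA; apply: IH => // z zI.
  by rewrite /tD normrM normr_nat ler_wpM2l // hB.
Qed.

(** The product (n+1) ... (n+k), by which k derivatives enlarge the n-th
    normalised derivative of an analytic function. *)
Definition rising (n k : nat) : R := \prod_(j < k) (n + j).+1%:R.

Lemma rising_ge0 n k : 0 <= rising n k.
Proof. exact: prodr_ge0. Qed.

Lemma rising0 n : rising n 0 = 1.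
Proof. by rewrite /rising big_ord0. Qed.

Lemma rising_mono n m k : (n <= m)%N -> rising n k <= rising m k.
Proof.
move=> nm; apply: ler_prod => i _; rewrite ler0n ler_nat ltnS leq_add2r //.
Qed.

Lemma risingS2 n k : n.+2%:R * (n.+1%:R * rising n.+2 k) = rising n k.+2.
Proof.
rewrite /rising !big_ord_recl /= addn0 addn1 mulrCA; congr (_ * (_ * _)).
by apply: eq_bigr => i _; congr (_%:R); rewrite /bump /= !add1n !addnS !addSn.
Qed.

(** The product is at most (n + K)^k = K^k (1 + n/K)^k, and (1 + n/K)^k is at most
    e^{n k / K}. *)
Lemma rising_le n k K : (0 < K)%N -> (k <= K)%N -> rising n k <= K%:R ^+ k * expR 1 ^+ n.
Proof.
move=> K0 kK; have K0' : 0 < K%:R :> R by rewrite ltr0n.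
apply: le_trans (_ : (n + K)%:R ^+ k <= _).
  rewrite /rising -[k in X in _ <= X]card_ord -prodr_const; apply: ler_prod => i _.
  by rewrite ler0n ler_nat -addnS leq_add2l (leq_trans (ltn_ord i)).
have -> : (n + K)%:R = K%:R * (1 + n%:R / K%:R) :> R.
  by rewrite natrD mulrDr mulr1 mulrCA divff ?mulr1 1?addrC // gt_eqF.
rewrite exprMn ler_wpM2l ?exprn_ge0 //.
have h0 : 0 <= n%:R / K%:R :> R by rewrite divr_ge0.
apply: le_trans (_ : expR (n%:R / K%:R) ^+ k <= _).
  by apply: lerXn2r; rewrite ?nnegrE ?expR_ge0 ?expR_ge1Dx //; lra.
rewrite -!expRM_natl ler_expR mulr1.
by rewrite mulrA ler_pdivrMr // mulrC ler_wpM2l // ler_nat.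
Qed.

Definition tbound_rising M ga k F := forall n x, 0 <= x <= 1 -> `|F n x| <= M * ga ^+ n * rising n k.

Lemma tbound_rising0 M ga F : tbound_rising M ga 0 F <-> tbound M ga F.
Proof. by split => h n x xI; have := h n x xI; rewrite rising0 mulr1. Qed.

Lemma sum_geo_half n : \sum_(i < n) 2^-1 ^+ i <= 2 :> R.
Proof.
suff -> : \sum_(i < n) 2^-1 ^+ i = 2 - 2 * 2^-1 ^+ n :> R by rewrite gerBl mulr_ge0 // exprn_ge0 // invr_ge0.
elim: n => [|n IH]; first by rewrite big_ord0 expr0 mulr1 subrr.
by rewrite big_ord_recr /= IH exprS; field.
Qed.

Lemma sum_geo (r : R) n : 0 <= r <= 2^-1 -> \sum_(i < n) r ^+ i <= 2.
Proof.
move=> /andP[r0 r1]; apply: le_trans (sum_geo_half n); apply: ler_sum => i _.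
by apply: lerXn2r => //; rewrite nnegrE ?invr_ge0.
Qed.

(** A factor 2 in the rates turns the Cauchy product into a geometric sum. *)
Lemma tbound_rising_mul C ga M Ga k F G : 0 <= C -> 0 < ga -> 2 * ga <= Ga -> 0 <= M ->
  tbound C ga F -> tbound_rising M Ga k G -> tbound_rising (2 * C * M) Ga k (tmul F G).
Proof.
move=> C0 ga0 gaG M0 hF hG n x xI.
have Ga0 : 0 < Ga by lra.
apply: le_trans (ler_norm_sum _ _ _) _.
apply: le_trans (_ : \sum_(i < n.+1) C * M * Ga ^+ n * rising n k * (ga / Ga) ^+ i <= _).
  apply: ler_sum => i _; rewrite normrM.
  apply: le_trans (ler_pM (normr_ge0 _) (normr_ge0 _) (hF i x xI) (hG (n - i)%N x xI)) _.
  have -> : Ga ^+ n = Ga ^+ (n - i) * Ga ^+ i by rewrite -exprD subnK // -ltnS.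
  have -> : C * M * (Ga ^+ (n - i) * Ga ^+ i) * rising n k * (ga / Ga) ^+ i =
     C * ga ^+ i * (M * Ga ^+ (n - i) * rising n k).
    by rewrite expr_div_n; field; rewrite expf_neq0 // gt_eqF.
  apply: ler_wpM2l; first by rewrite mulr_ge0 ?exprn_ge0 // ltW.
  apply: ler_wpM2l; first by rewrite mulr_ge0 ?exprn_ge0 // ltW.
  by apply: rising_mono; rewrite leq_subr.
rewrite -mulr_sumr.
have -> : 2 * C * M * Ga ^+ n * rising n k = C * M * Ga ^+ n * rising n k * 2 by ring.
apply: ler_wpM2l; first by rewrite !mulr_ge0 ?exprn_ge0 ?rising_ge0 // ltW.
apply: sum_geo; rewrite divr_ge0 ?(ltW ga0) ?(ltW Ga0) //= ler_pdivrMr //; lra.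
Qed.

Lemma tbound_rising_add M1 M2 Ga k F G : tbound_rising M1 Ga k F -> tbound_rising M2 Ga k G -> tbound_rising (M1 + M2) Ga k (tadd F G).
Proof.
move=> hF hG n x xI; rewrite !mulrDl; apply: le_trans (ler_normD _ _) _.
by apply: lerD; [exact: hF|exact: hG].
Qed.

Lemma tbound_rising_scale M c Ga k F : tbound_rising M Ga k F -> tbound_rising (`|c| * M) Ga k (tscale c F).
Proof.
by move=> hF n x xI; rewrite normrM -!mulrA ler_wpM2l // mulrA; exact: hF.
Qed.

Lemma tbound_rising_D2 M Ga k F : tbound_rising M Ga k F -> tbound_rising (M * Ga ^+ 2) Ga k.+2 (tD (tD F)).
Proof.
move=> hF n x xI; rewrite /tD !normrM !normr_nat -risingS2.
have -> : M * Ga ^+ 2 * Ga ^+ n * (n.+2%:R * (n.+1%:R * rising n.+2 k)) = n.+1%:R * (n.+2%:R * (M * Ga ^+ n.+2 * rising n.+2 k)).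
  by rewrite !exprS; ring.
by rewrite !ler_wpM2l //; exact: hF.
Qed.

Lemma tbound_rising_widen M M' Ga Ga' k F : 0 <= M -> M <= M' -> 0 <= Ga -> Ga <= Ga' ->
  tbound_rising M Ga k F -> tbound_rising M' Ga' k F.
Proof.
move=> M0 MM Ga0 GG hF n x xI; apply: le_trans (hF n x xI) _.
apply: ler_wpM2r; first exact: rising_ge0.
by apply: ler_pM; rewrite ?exprn_ge0 // lerXn2r // nnegrE (le_trans Ga0).
Qed.

(** Fuelled recursion for the power series inverse: the first argument bounds
    the depth, and the k-th coefficient is final as soon as it exceeds k. *)
Fixpoint inv_upto (h : nat -> R) (n : nat) : nat -> R :=
  if n is n'.+1 then
    fun k => ((k == 0%N)%:R - \sum_(i < k) h i.+1 * inv_upto h n' (k - i.+1)%N) / h 0%N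
  else fun=> 0.

Definition tinv F n x := inv_upto (F^~ x) n.+1 n.

Lemma inv_upto_stable h k m m' : (k < m)%N -> (k < m')%N -> inv_upto h m k = inv_upto h m' k.
Proof.
elim: m m' k => // m IH [//|m'] k km km' /=.
congr ((_ - _) / _); apply: eq_bigr => i _; congr (_ * _); apply: IH.
  by rewrite -ltnS; apply: leq_trans km; rewrite ltnS ltn_subrL (leq_ltn_trans _ (ltn_ord i)).
by rewrite -ltnS; apply: leq_trans km'; rewrite ltnS ltn_subrL (leq_ltn_trans _ (ltn_ord i)).
Qed.

Lemma tinvE F n x : tinv F n x = ((n == 0%N)%:R - \sum_(i < n) F i.+1 x * tinv F (n - i.+1)%N x) / F 0%N x.
Proof.
rewrite {1}/tinv /=; congr ((_ - _) / _); apply: eq_bigr => i _; congr (_ * _).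
by apply: inv_upto_stable => //; rewrite ltn_subrL (leq_ltn_trans _ (ltn_ord i)).
Qed.

Lemma tmul_tinv F n x : F 0%N x != 0 -> tmul F (tinv F) n x = (n == 0%N)%:R.
Proof.
move=> F0; rewrite /tmul big_ord_recl /= subn0 tinvE mulrC divfK //.
by rewrite [X in _ + X](eq_bigr (fun i : 'I_n => F i.+1 x * tinv F (n - i.+1)%N x)) ?subrK.
Qed.

(** Induction on the order: differentiating the identity for the Cauchy product
    of F and its inverse leaves only the derivative of the last coefficient
    unknown, and [cauchy_shift] at order n + 1 identifies it. *)
Lemma tower_inv F : tower F -> (forall x, 0 <= x <= 1 -> F 0%N x != 0) -> tower (tinv F).
Proof.
move=> tF F0.
have cV : cont01 (fun x => (F 0%N x)^-1).
  have [cF _] := tF 0%N.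
  move/continuous_within_itvP : cF => /(_ ltr01)[c0 c1 c2].
  apply/continuous_within_itvP => //; split.
  - by move=> x xI; apply: cvgV; [apply: F0; move: xI; rewrite in_itv /= => /andP[*]; apply/andP; split; lra|exact: c0].
  - by apply: cvgV => //; apply: F0; rewrite lexx ler01.
  - by apply: cvgV => //; apply: F0; rewrite lexx ler01.
have inI x : unitI x -> 0 <= x <= 1 by case/unitIE/andP => *; apply/andP; split; lra.
have cT n : cont01 (tinv F n).
  elim/ltn_ind: n => n IH.
  apply: (@cont01_eq _ (fun x => ((n == 0%N)%:R - \sum_(i < n) F i.+1 x * tinv F (n - i.+1)%N x) * (F 0%N x)^-1)).
    by move=> x _; rewrite tinvE.
  apply: cont01M => //; apply: cont01B; first exact: cont01_cst.
  apply: (@cont01_sum _ _ (fun i x => F i.+1 x * tinv F (n - i.+1)%N x)) => i ni.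
  by apply: cont01M; [case: (tF i.+1)|apply: IH; rewrite -subSn // subSS leq_subr].
move=> n; split => // x Ix; elim/ltn_ind: n => n IH.
have F0x := F0 x (inI x Ix).
have cvF0 : {for x, continuous (F 0%N)} by apply: cont01_interior Ix; case: (tF 0%N).
have [S dS] : exists S, is_derive x 1 (fun y => (n == 0%N)%:R - \sum_(i < n) F i.+1 y * tinv F (n - i.+1)%N y) S.
  eexists; apply: derB (der_cst _ x) _.
  apply: (@der_sum _ _ (fun i y => F i.+1 y * tinv F (n - i.+1)%N y)
    _ (fun i => (i.+2%:R * F i.+2 x) * tinv F (n - i.+1)%N x + F i.+1 x * ((n - i.+1).+1%:R * tinv F (n - i.+1).+1 x))) => i ni.
  have [_ /(_ x Ix) d1] := tF i.+1.
  have d2 : is_derive x 1 (tinv F (n - i.+1)) ((n - i.+1).+1%:R * tinv F (n - i.+1).+1 x).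
    by apply: IH; rewrite -subSn // subSS leq_subr.
  exact: derM d1 d2.
have [_ /(_ x Ix) dF0] := tF 0%N.
have [V dV] : exists V, is_derive x 1 (fun y => (F 0%N y)^-1) V.
  by eexists; apply: is_deriveV.
have [T dT] : exists T, is_derive x 1 (tinv F n) T.
  eexists; rewrite (_ : tinv F n = fun y => ((n == 0%N)%:R - \sum_(i < n) F i.+1 y * tinv F (n - i.+1)%N y) * (F 0%N y)^-1).
    exact: derM dS dV.
  by apply/funext => y; rewrite tinvE.
pose dt i := if i == n then T else i.+1%:R * tinv F i.+1 x.
have ddt i : (i <= n)%N -> is_derive x 1 (tinv F i) (dt i).
  by rewrite leq_eqVlt /dt => /predU1P[->|ni]; [rewrite eqxx|rewrite ltn_eqF //; exact: IH].
have D1 : is_derive x 1 (tmul F (tinv F) n) (\sum_(i < n.+1) (i.+1%:R * F i.+1 x * tinv F (n - i)%N x + F i x * dt (n - i)%N)).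
  apply: (@der_sum _ _ (fun i y => F i y * tinv F (n - i)%N y)
    _ (fun i => i.+1%:R * F i.+1 x * tinv F (n - i)%N x + F i x * dt (n - i)%N)) => i ni.
  have [_ /(_ x Ix) d1] := tF i.
  by apply: derM d1 (ddt _ _); rewrite leq_subr.
have D0 : is_derive x 1 (tmul F (tinv F) n) 0.
  apply: (der_eqI (f := fun=> (n == 0%N)%:R)) (der_cst _ x) => // y Iy.
  by rewrite tmul_tinv //; apply: F0; exact: inI.
have E1 := cauchy_shift (F^~ x) ((tinv F)^~ x) n.
have E0 : \sum_(i < n.+2) F i x * tinv F (n.+1 - i)%N x = 0.
  by have := tmul_tinv n.+1 F0x; rewrite /tmul => ->.
have E2 := etrans (esym (der_derive1 D1)) (der_derive1 D0).
rewrite E0 mulr0 big_ord_recl /= subn0 in E1.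
rewrite big_ord_recl /= subn0 {1}/dt eqxx in E2.
have ET : \sum_(i < n) (i.+2%:R * F i.+2 x * tinv F (n - i.+1)%N x + F i.+1 x * dt (n - i.+1)%N) =
  \sum_(i < n) (i.+2%:R * F i.+2 x * tinv F (n - i.+1)%N x + F i.+1 x * ((n - i.+1).+1%:R * tinv F (n - i.+1).+1 x)).
  apply: eq_bigr => i _; rewrite /dt ltn_eqF // -subSn // subSS; exact: leq_subr.
suff -> : n.+1%:R * tinv F n.+1 x = T by [].
apply: (mulfI F0x); apply: (addrI (1 * F 1%N x * tinv F n x)); move: E1 E2.
rewrite (eq_bigr (fun i : 'I_n => i.+2%:R * F i.+2 x * tinv F (n - i.+1)%N x + F i.+1 x * ((n - i.+1).+1%:R * tinv F (n - i.+1).+1 x))) //.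
rewrite [X in _ -> _ + X = 0 -> _](eq_bigr (fun i : 'I_n => i.+2%:R * F i.+2 x * tinv F (n - i.+1)%N x + F i.+1 x * dt (n - i.+1)%N)) //.
by rewrite ET => /(canRL (addrK _)) -> /(canRL (addrK _)) ->.
Qed.

(** Solving F u = 1 for the n-th coefficient of u, the rate t = 2 + 2 C / c makes the
    geometric sum of the other terms at most 1. *)
Lemma tbound_rising_inv F C ga c : 0 < C -> 0 < ga -> 0 < c -> tbound C ga F ->
  (forall x, 0 <= x <= 1 -> c <= `|F 0%N x|) ->
  tbound_rising c^-1 (ga * (2 + 2 * C / c)) 0 (tinv F).
Proof.
move=> C0 ga0 c0 hF hc; apply/tbound_rising0 => n x xI; set t := 2 + 2 * C / c; elim/ltn_ind: n => n IH.
have t0 : 2 < t by rewrite /t ltrDl divr_gt0 // mulr_gt0.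
have F0 : 0 < `|F 0%N x| by apply: lt_le_trans (hc x xI).
have Ga0 : 0 < ga * t by rewrite mulr_gt0 //; lra.
rewrite tinvE normrM normfV ler_pdivrMr //.
apply: le_trans (_ : (ga * t) ^+ n <= _); last first.
  rewrite mulrAC -{1}[(ga * t) ^+ n]mul1r ler_wpM2r ?exprn_ge0 ?(ltW Ga0) //.
  by rewrite mulrC ler_pdivlMr // mul1r; exact: hc.
case: n IH => [|n] IH; first by rewrite big_ord0 subr0 expr0 normr1.
rewrite sub0r normrN; apply: le_trans (ler_norm_sum _ _ _) _.
apply: le_trans (_ : \sum_(i < n.+1) (C / c / t * (ga * t) ^+ n.+1) * t^-1 ^+ i <= _).
  apply: ler_sum => i _; rewrite normrM subSS.
  have hi := IH (n - i)%N (leq_subr i n).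
  apply: le_trans (ler_pM (normr_ge0 _) (normr_ge0 _) (hF i.+1 x xI) hi) _.
  apply: le_of_eq.
  have -> : (ga * t) ^+ n.+1 = (ga * t) ^+ (n - i) * (ga ^+ i.+1 * t ^+ i.+1).
    by rewrite -exprMn -exprD addnS subnK // -ltnS.
  rewrite exprVn (exprS t i).
  have T0 : t ^+ i != 0 by rewrite expf_neq0 // gt_eqF //; lra.
  have t1 : t != 0 by rewrite gt_eqF //; lra.
  have c1 : c != 0 by rewrite gt_eqF.
  move: T0; set T := t ^+ i; set P := (ga * t) ^+ (n - i); set Q := ga ^+ i.+1 => T0.
  clearbody T P Q t; field.
  by rewrite T0 t1 c1.
rewrite -mulr_sumr.
have h2 : \sum_(i < n.+1) t^-1 ^+ i <= 2.
  apply: sum_geo; rewrite invr_ge0 lef_pV2 ?posrE //; lra.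
have t0' : 0 < t by lra.
apply: le_trans (_ : C / c / t * (ga * t) ^+ n.+1 * 2 <= _).
  by rewrite ler_wpM2l // mulr_ge0 ?exprn_ge0 ?(ltW Ga0) // !divr_ge0 // ltW.
rewrite mulrAC -[leRHS]mul1r ler_wpM2r ?exprn_ge0 ?(ltW Ga0) //.
rewrite mulrAC ler_pdivrMr // mul1r /t.
have -> : 2 * C / c = C / c * 2 by ring.
lra.
Qed.
End TowerAlgebra.

Ltac nonneg := repeat (first [assumption | exact: ltW | apply: exprn_ge0 | apply: sqr_ge0 | apply: mulr_ge0 | rewrite invr_ge0 | done]).

(** * The outer expansion *)

Section Outer.
Context {R : realType}.
Implicit Types (F G H : nat -> R -> R).

Definition tsum (Phi : nat -> nat -> R -> R) N n (x : R) := \sum_(k < N) Phi k n x.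

Lemma tsumS Phi N n x : tsum Phi N.+1 n x = tsum Phi N n x + Phi N n x.
Proof. exact: big_ord_recr. Qed.

Lemma tower_sum Phi N : (forall k, tower (Phi k)) -> tower (tsum Phi N).
Proof.
move=> tP n; split; first by apply: (cont01_sum (h := fun k => Phi k n)) => k _; case: (tP k n).
move=> x Ix; rewrite mulr_sumr.
apply: (@der_sum _ _ (fun k => Phi k n) _ (fun k => n.+1%:R * Phi k n.+1 x)) => k _.
by have [_ /(_ x Ix)] := tP k n.
Qed.

Variables (TA : 'I_2 -> 'I_2 -> nat -> R -> R) (TF : 'I_2 -> nat -> R -> R).

Definition tdet := tadd (tmul (TA 0 0) (TA 1 1)) (tscale (-1) (tmul (TA 0 1) (TA 1 0))).
Definition tadj (i j : 'I_2) : nat -> R -> R :=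
  if i == j then (if i == 0 then TA 1 1 else TA 0 0) else tscale (-1) (TA i j).
Definition tAinv i j := tmul (tadj i j) (tinv tdet).
(** Multiplication by the inverse of the matrix function, through cofactors and
    the determinant. *)
Definition tsolve (v : 'I_2 -> nat -> R -> R) (i : 'I_2) :=
  tadd (tmul (tAinv i 0) (v 0)) (tmul (tAinv i 1) (v 1)).

(** The terms T^k A^{-1} F of the outer expansion, with d the diagonal of D. *)
Fixpoint outer_term (d : 'I_2 -> R) (k : nat) : 'I_2 -> nat -> R -> R :=
  if k is k'.+1 then tsolve (fun i => tscale (d i) (tD (tD (outer_term d k' i))))
  else tsolve TF.

Lemma tmul0 F G x : tmul F G 0 x = F 0%N x * G 0%N x.
Proof. by rewrite /tmul big_ord_recl big_ord0 addr0. Qed.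

Lemma tdet0 x : tdet 0 x = TA 0 0 0%N x * TA 1 1 0%N x - TA 0 1 0%N x * TA 1 0 0%N x.
Proof. by rewrite /tdet /tadd /tscale !tmul0 mulN1r. Qed.

Lemma tsolve_correct v x : tdet 0 x != 0 ->
  forall i, TA i 0 0%N x * tsolve v 0 0%N x + TA i 1 0%N x * tsolve v 1 0%N x = v i 0%N x.
Proof.
move=> d0; have h : tdet 0 x * tinv tdet 0 x = 1 by rewrite -tmul0 tmul_tinv.
have {}h : tinv tdet 0 x = (tdet 0 x)^-1 by apply: (mulfI d0); rewrite h divff.
apply: ord2P; rewrite /tsolve /tadd /tAinv !tmul0 h /tadj /= /tscale tdet0; field; by rewrite -tdet0.
Qed.

Variables (C ga c : R).
Hypotheses (C0 : 0 < C) (ga0 : 0 < ga) (c0 : 0 < c).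
Hypothesis (tTA : forall i j, tower (TA i j)) (tTF : forall i, tower (TF i)).
Hypothesis (bTA : forall i j, tbound C ga (TA i j)) (bTF : forall i, tbound C ga (TF i)).
Hypothesis (hdet : forall x, 0 <= x <= 1 -> c <= tdet 0 x).

Let Cd := 4 * C ^+ 2.
Let ga1 := 2 * ga * (2 + 2 * Cd / c).
Let CB := 2 * C * c^-1.
Let Ga := 2 * ga1.

Lemma tower_det : tower tdet.
Proof. by apply: tower_add; [|apply: tower_scale]; apply: tower_mul. Qed.

Lemma tower_solve v : (forall i, tower (v i)) -> forall i, tower (tsolve v i).
Proof.
have td : tower (tinv tdet).
  by apply: tower_inv tower_det _ => x /hdet h; rewrite gt_eqF // (lt_le_trans c0).
have tB i j : tower (tAinv i j).
  apply: tower_mul => //; rewrite /tadj; case: ifP => _; first by case: ifP.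
  exact: tower_scale.
by move=> tv i; apply: tower_add; apply: tower_mul.
Qed.

Let Cd0 : 0 < Cd. Proof. by rewrite mulr_gt0 // exprn_gt0. Qed.
Let q0 : 0 < 2 * Cd / c. Proof. by rewrite divr_gt0 // mulr_gt0. Qed.
Let ga10 : 0 < ga1. Proof. by rewrite /ga1 !mulr_gt0 //; have := q0; lra. Qed.
Let Ga0 : 0 < Ga. Proof. by rewrite mulr_gt0. Qed.
Let CB0 : 0 < CB. Proof. by rewrite !mulr_gt0 // invr_gt0. Qed.
Let ga_ga1 : 2 * ga <= ga1.
Proof. by rewrite /ga1; have q1 := q0; have g1 := ga0; apply: ler_peMr; lra. Qed.

Lemma tbound_det : tbound Cd (2 * ga) tdet.
Proof.
have h i j k l : tbound_rising (2 * C * C) (2 * ga) 0 (tmul (TA i j) (TA k l)).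
  apply: (@tbound_rising_mul _ C ga) => //; try exact: ltW.
  by apply: (@tbound_rising_widen _ C _ ga); rewrite ?(ltW C0) ?(ltW ga0) //; [have := ga0; lra|apply/tbound_rising0].
have h2 := tbound_rising_add (h 0 0 1 1) (tbound_rising_scale (-1) (h 0 1 1 0)).
apply/tbound_rising0; apply: (tbound_rising_widen _ _ _ _ h2) => //.
- by rewrite normrN1 mul1r; have := mulr_gt0 C0 C0 => h0; rewrite addr_ge0 // -mulrA mulr_ge0 // ltW.
- by rewrite normrN1 mul1r /Cd; apply: le_of_eq; ring.
- by have := ga0; lra.
Qed.

Lemma tbound_Ainv i j : tbound CB ga1 (tAinv i j).
Proof.
apply/tbound_rising0; apply: (@tbound_rising_mul _ C ga) => //; try exact: ltW.
- by rewrite invr_ge0 ltW.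
- rewrite /tadj; case: ifP => _; first by case: ifP.
  by move=> n x xI; rewrite /tscale normrM normrN1 mul1r; exact: bTA.
- apply: tbound_rising_inv => //; [have := ga0; lra|exact: tbound_det|].
  by move=> x /hdet h; apply: le_trans h (ler_norm _).
Qed.

Lemma tbound_rising_solve v M k : 0 <= M -> (forall i, tbound_rising M Ga k (v i)) ->
  forall i, tbound_rising (4 * CB * M) Ga k (tsolve v i).
Proof.
move=> M0 hv i.
have h j : tbound_rising (2 * CB * M) Ga k (tmul (tAinv i j) (v j)).
  apply: (@tbound_rising_mul _ CB ga1) => //; try exact: ltW.
  exact: tbound_Ainv.
have := tbound_rising_add (h 0) (h 1); rewrite /tsolve.
by have -> : 2 * CB * M + 2 * CB * M = 4 * CB * M by ring.
Qed.

Let M0 := 4 * CB * C.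

(** Each step costs two derivatives and one multiplication by the inverse
    matrix. *)
Lemma tbound_rising_outer (d : 'I_2 -> R) (mu' : R) k : (forall i, `|d i| <= mu' ^+ 2) ->
  forall i, tbound_rising (M0 * (4 * CB * Ga ^+ 2 * mu' ^+ 2) ^+ k) Ga k.*2 (outer_term d k i).
Proof.
move=> hd; set q := 4 * CB * Ga ^+ 2 * mu' ^+ 2.
have q00 : 0 <= q by apply: mulr_ge0 (sqr_ge0 _); apply: mulr_ge0 (sqr_ge0 _); apply: mulr_ge0 => //; exact: ltW.
have M00 : 0 <= M0 by apply: mulr_ge0; [apply: mulr_ge0 => //|]; exact: ltW.
elim: k => [|k IH] i.
  rewrite expr0 mulr1; apply: tbound_rising_solve; first exact: ltW.
  by move=> j; apply: (@tbound_rising_widen _ C _ ga); rewrite ?(ltW C0) ?(ltW ga0) //; [rewrite /Ga; have := ga_ga1; have := ga0; lra|apply/tbound_rising0].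
rewrite doubleS /=.
have -> : M0 * q ^+ k.+1 = 4 * CB * (mu' ^+ 2 * (M0 * q ^+ k * Ga ^+ 2)) by rewrite exprS /q; ring.
have M1 : 0 <= M0 * q ^+ k * Ga ^+ 2 by apply: mulr_ge0 (sqr_ge0 _); apply: mulr_ge0 => //; exact: exprn_ge0.
apply: tbound_rising_solve; first by rewrite mulr_ge0 ?sqr_ge0.
move=> j; apply: (tbound_rising_widen _ _ _ _ (tbound_rising_scale (d j) (tbound_rising_D2 (IH j)))) => //.
- by rewrite mulr_ge0.
- by rewrite ler_wpM2r.
- exact: ltW.
Qed.

Lemma tower_outer d k i : tower (outer_term d k i).
Proof.
elim: k i => [|k IH] i; apply: tower_solve => j; first exact: tTF.
exact: (tower_scale (d j) (tower_D (tower_D (IH j)))).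
Qed.

(** The residual of the partial sum telescopes to - D Phi_N''.  The bound of the
    k-th term contains (4 CB Ga^2 mu^2)^k K^(2k) with K = 2 (N + 1), a geometric
    sequence as soon as (N + 1) mu is small. *)
Lemma outer_expansion : exists CW gW kap Cr, [/\ 0 < CW, 0 < gW, 0 < kap & 0 < Cr] /\
  forall (d : 'I_2 -> R) (mu' : R) (N : nat), 0 < mu' -> (forall i, `|d i| <= mu' ^+ 2) ->
    N.+1%:R * mu' <= kap ->
  exists W : 'I_2 -> nat -> R -> R, [/\ forall i, tower (W i), forall i, tbound CW gW (W i) &
    forall x i, 0 <= x <= 1 ->
      `|TA i 0 0%N x * W 0 0%N x + TA i 1 0%N x * W 1 0%N x - d i * (2 * W i 2 x) - TF i 0%N x|
      <= Cr * 2^-1 ^+ N].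
Proof.
have M00 : 0 < M0 by apply: mulr_gt0 => //; exact: mulr_gt0.
pose X := 32 * CB * Ga ^+ 2; have X0 : 0 < X by apply: mulr_gt0; [apply: mulr_gt0|apply: exprn_gt0].
(* chosen so that q K^2, the ratio of the geometric sum below, is at most 1/2 *)
pose kap := (1 + X)^-1; have kap0 : 0 < kap by rewrite invr_gt0; lra.
have kapX : X * kap ^+ 2 <= 1.
  have k1 : kap <= 1 by rewrite invf_le1; lra.
  have k2 : X * kap <= 1 by rewrite ler_pdivrMr; lra.
  by rewrite expr2 mulrA; apply: mulr_ile1 => //; [apply: mulr_ge0|]; exact: ltW.
have M0n := ltW M00; have Gan := ltW Ga0; have e1n : 0 <= expR 1 :> R by exact: expR_ge0.
exists (2 * M0), (expR 1 * Ga), kap, (M0 * Ga ^+ 2 * 4); split.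
  by split => //; [apply: mulr_gt0|apply: mulr_gt0 (expR_gt0 _) _|apply: mulr_gt0 => //; apply: mulr_gt0 => //; exact: exprn_gt0].
move=> d mu' N mu0 hd hN.
set q := 4 * CB * Ga ^+ 2 * mu' ^+ 2.
have q00 : 0 <= q by apply: mulr_ge0 (sqr_ge0 _); apply: mulr_ge0 (sqr_ge0 _); apply: mulr_ge0 => //; exact: ltW.
pose K := N.+1.*2.
have KE : K%:R = 2 * N.+1%:R :> R by rewrite /K -muln2 natrM mulrC.
have hKmu : mu' * K%:R <= 2 * kap by rewrite KE; lra.
have hKmu0 : 0 <= mu' * K%:R by rewrite mulr_ge0 // ltW.
have kap1 : kap <= 1 by rewrite invf_le1; lra.
have hq : q * K%:R ^+ 2 <= 2^-1.
  have -> : q * K%:R ^+ 2 = X / 8 * (mu' * K%:R) ^+ 2 by rewrite /q /X exprMn; field.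
  apply: le_trans (_ : X / 8 * (2 * kap) ^+ 2 <= _).
    by rewrite ler_wpM2l ?divr_ge0 ?(ltW X0) // lerXn2r // nnegrE // mulr_ge0 // ltW.
  have -> : X / 8 * (2 * kap) ^+ 2 = X * kap ^+ 2 / 2 by field.
  lra.
have hq0 : 0 <= q * K%:R ^+ 2 by rewrite mulr_ge0 ?exprn_ge0.
exists (fun i => tsum (fun k => outer_term d k i) N.+1); split.
- by move=> i; apply: tower_sum => k; exact: tower_outer.
- move=> i n x xI; apply: le_trans (ler_norm_sum _ _ _) _.
  apply: le_trans (_ : \sum_(k < N.+1) M0 * (expR 1 * Ga) ^+ n * (q * K%:R ^+ 2) ^+ k <= _).
    apply: ler_sum => k _; apply: le_trans (tbound_rising_outer k hd i n xI) _.
    have h : rising (R:=R) n k.*2 <= K%:R ^+ k.*2 * expR 1 ^+ n.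
      by apply: rising_le => //; rewrite /K leq_double ltnW // ltn_ord.
    apply: le_trans (ler_wpM2l _ h) _.
      by nonneg.
    have -> : (q * K%:R ^+ 2) ^+ k = q ^+ k * K%:R ^+ k.*2 by rewrite (exprMn _ q) -exprM mul2n.
    by apply: le_of_eq; rewrite (exprMn _ (expR 1)) -/q; ring.
  rewrite -mulr_sumr; have -> : 2 * M0 * (expR 1 * Ga) ^+ n = M0 * (expR 1 * Ga) ^+ n * 2 by ring.
  rewrite ler_wpM2l //; last by apply: sum_geo; rewrite hq0 hq.
  by nonneg.
- move=> x i xI.
  have dx0 : tdet 0 x != 0 by rewrite gt_eqF // (lt_le_trans c0) // hdet.
  have E n : TA i 0 0%N x * tsum (fun k => outer_term d k 0) n.+1 0 x + TA i 1 0%N x * tsum (fun k => outer_term d k 1) n.+1 0 x - d i * (2 * tsum (fun k => outer_term d k i) n 2 x) - TF i 0%N x = 0.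
    elim: n => [|n IH].
      rewrite !tsumS /tsum !big_ord0 !add0r !mulr0 subr0.
      by rewrite (tsolve_correct TF dx0) subrr.
    have h : TA i 0 0%N x * outer_term d n.+1 0 0 x + TA i 1 0%N x * outer_term d n.+1 1 0 x = d i * (2 * outer_term d n i 2 x).
      by rewrite (tsolve_correct _ dx0) /tscale /tD mul1r.
    rewrite -[RHS]IH !(tsumS _ n.+1) (tsumS _ n 2%N).
    have {}h := congr1 (fun z => z - d i * (2 * outer_term d n i 2 x)) h.
    rewrite subrr in h; rewrite -[RHS]addr0 -h; ring.
  have -> : TA i 0 0%N x * tsum (fun k => outer_term d k 0) N.+1 0 x + TA i 1 0%N x * tsum (fun k => outer_term d k 1) N.+1 0 x - d i * (2 * tsum (fun k => outer_term d k i) N.+1 2 x) - TF i 0%N x = - (d i * (2 * outer_term d N i 2 x)).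
    have e := E N; rewrite (tsumS _ N 2%N) -[RHS]addr0 -e; ring.
  rewrite normrN normrM.
  have h2 := tbound_rising_D2 (tbound_rising_outer N hd i) 0%N xI; rewrite {1}/tD mul1r /tD in h2.
  apply: le_trans (ler_pM (normr_ge0 _) (normr_ge0 _) (hd i) h2) _.
  have h : rising (R:=R) 0 N.*2.+2 <= K%:R ^+ N.*2.+2 * expR 1 ^+ 0.
    by apply: rising_le => //; rewrite /K doubleS.
  rewrite expr0 !mulr1 -/q in h *.
  apply: le_trans (_ : M0 * Ga ^+ 2 * (mu' * K%:R) ^+ 2 * (q * K%:R ^+ 2) ^+ N <= _).
    apply: le_trans (_ : mu' ^+ 2 * (M0 * q ^+ N * Ga ^+ 2 * K%:R ^+ N.*2.+2) <= _).
      by apply: ler_wpM2l; [nonneg|apply: ler_wpM2l; [nonneg|exact: h]].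
    have -> : (q * K%:R ^+ 2) ^+ N = q ^+ N * K%:R ^+ N.*2 by rewrite (exprMn _ q) -exprM mul2n.
    by apply: le_of_eq; rewrite (exprMn _ mu') !exprS; ring.
  apply: ler_pM.
  + by nonneg.
  + exact: exprn_ge0.
  + apply: ler_wpM2l; first by nonneg.
    have -> : 4 = 2 ^+ 2 :> R by ring.
    by apply: lerXn2r; rewrite ?nnegrE //; lra.
  + by apply: lerXn2r; rewrite ?nnegrE // invr_ge0.
Qed.
End Outer.

(** * The layer equations for power series coefficients *)

Section LayerSequences.
Context {R : realType}.
Implicit Types (a b p r : nat -> R).

(** The power series coefficients of e^{be t}; a sequence bounded by M times this
    weight is a series bounded by M e^{be t}. *)
Definition expw (be : R) (l : nat) : R := be ^+ l / l`!%:R.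

Lemma expw_ge0 be l : 0 <= be -> 0 <= expw be l.
Proof. by move=> b0; rewrite divr_ge0 ?exprn_ge0. Qed.

Lemma expwS be l : l.+1%:R * expw be l.+1 = be * expw be l.
Proof.
rewrite /expw factS natrM exprS; field.
by rewrite nat1r !pnatr_eq0 /= -lt0n fact_gt0.
Qed.

(** Each step down costs a factor (j + 1) / be, at most D / be. *)
Lemma expw_le be (D l j : nat) : 0 < be -> (j <= l)%N -> (l <= D)%N ->
  expw be j <= expw be l * (D%:R / be) ^+ (l - j).
Proof.
move=> b0 + lD; elim: l lD => [|l IH] lD; first by rewrite leqn0 => /eqP ->; rewrite expr0 mulr1.
rewrite leq_eqVlt => /predU1P[->|]; first by rewrite subnn expr0 mulr1.
rewrite ltnS => jl; apply: le_trans (IH (ltnW lD) jl) _.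
rewrite subSn // exprS mulrA; apply: ler_wpM2r.
  by rewrite exprn_ge0 // divr_ge0 // ltW.
rewrite mulrA ler_pdivlMr // mulrC -expwS mulrC ler_wpM2l ?ler_nat //.
by rewrite expw_ge0 // ltW.
Qed.

(** Coefficients of the derivative of a power series. *)
Definition dcoef a : nat -> R := fun j => j.+1%:R * a j.+1.
(** Coefficients of B (nu t) a (t), for power series B and a. *)
Definition tconv (nu : R) (B a : nat -> R) : nat -> R :=
  fun l => \sum_(j < l.+1) a j * (B (l - j)%N * nu ^+ (l - j)).

Lemma dcoef_bound be M a : (forall l, `|a l| <= M * expw be l) ->
  forall l, `|dcoef a l| <= M * be * expw be l.
Proof.
move=> h l; rewrite /dcoef normrM normr_nat -mulrA -expwS mulrCA ler_wpM2l //; exact: h.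
Qed.

(** B vanishes at 0, so every term gains at least one factor of th. *)
Lemma tconv_bound be nu K ga M th (D : nat) B a : 0 < be -> 0 < nu -> 0 < ga -> 0 <= K -> 0 <= M ->
  th = D%:R * nu * ga / be -> th <= 2^-1 ->
  B 0%N = 0 -> (forall m, `|B m| <= K * ga ^+ m) ->
  (forall l, `|a l| <= M * expw be l) ->
  forall l, (l <= D)%N -> `|tconv nu B a l| <= 2 * th * K * M * expw be l.
Proof.
move=> be0 nu0 ga0 K0 M0 thE th1 B0 hB ha l lD.
have th0 : 0 <= th by rewrite thE; apply: divr_ge0 (ltW be0); nonneg.
rewrite /tconv big_ord_recr /= subnn B0 mul0r mulr0 addr0.
apply: le_trans (ler_norm_sum _ _ _) _.
apply: le_trans (_ : \sum_(j < l) (th * K * M * expw be l) * th ^+ (l - j.+1) <= _).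
  apply: ler_sum => j _; rewrite !normrM normrX (ger0_norm (ltW nu0)).
  apply: le_trans (_ : M * expw be j * (K * ga ^+ (l - j) * nu ^+ (l - j)) <= _).
    apply: ler_pM => //; first by nonneg; apply: normr_ge0.
    by apply: ler_wpM2r; [nonneg|exact: hB].
  apply: le_trans (_ : M * (expw be l * (D%:R / be) ^+ (l - j)) * (K * ga ^+ (l - j) * nu ^+ (l - j)) <= _).
    apply: ler_wpM2r; first by nonneg.
    by apply: ler_wpM2l => //; apply: expw_le => //; exact: ltnW.
  apply: le_of_eq.
  have -> : th * K * M * expw be l * th ^+ (l - j.+1) = K * M * expw be l * th ^+ (l - j).
    by rewrite -(subnSK (ltn_ord j)) exprS; ring.
  have -> : th = D%:R / be * (ga * nu) by rewrite thE; ring.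
  by rewrite (exprMn _ (D%:R / be)) (exprMn _ ga); ring.
rewrite -mulr_sumr.
have -> : 2 * th * K * M * expw be l = th * K * M * expw be l * 2 by ring.
apply: ler_wpM2l; first by have := expw_ge0 l (ltW be0); nonneg.
rewrite (reindex_inj rev_ord_inj) /=.
rewrite (eq_bigr (fun j : 'I_l => th ^+ j)); first by apply: sum_geo; rewrite th0.
by move=> j _; congr (_ ^+ _); rewrite /= subnSK // subKn // ltnW.
Qed.

Variables (D : nat) (nu kap s2 c d b2 b1 b0 h2 h1 h0 : R) (B B' E E' : nat -> R).

(** Coefficients of the equation that loses its zero order term for the chosen
    rate: - p'' + 2 kap p' plus terms that are small relative to it.  The pair y is
    (p, r). *)
Definition resonant_residual (y : (nat -> R) * (nat -> R)) l :=
  - dcoef (dcoef y.1) l + 2 * kap * dcoef y.1 l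
  + s2 * (b2 * dcoef (dcoef y.2) l + b1 * dcoef y.2 l + b0 * y.2 l) + tconv nu B y.1 l + tconv nu B' y.2 l.
(** Coefficients of the equation that is solved for r, through the term c r. *)
Definition slave_residual (y : (nat -> R) * (nat -> R)) l :=
  c * y.2 l + d * y.1 l + h2 * dcoef (dcoef y.2) l + h1 * dcoef y.2 l + s2 * h0 * y.2 l
  + tconv nu E y.1 l + tconv nu E' y.2 l.

(** The coefficient p_l is corrected by the residual of order l - 1, whose main
    part is 2 kap l p_l; the coefficient r_l by the residual of order l.  Everything
    beyond degree D is dropped. *)
Definition iter_step (y : (nat -> R) * (nat -> R)) : (nat -> R) * (nat -> R) :=
  (fun l => if l is l'.+1 then
     (if (l <= D)%N then y.1 l - (2 * kap * l%:R)^-1 * resonant_residual y l' else 0) else 0,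
   fun l => if (l <= D)%N then y.2 l - c^-1 * slave_residual y l else 0).

(** Each iterate adds the starting value to a step, which vanishes at p_0: all
    iterates have p_0 = 1. *)
Definition iter_init : (nat -> R) * (nat -> R) := (fun l => (l == 0%N)%:R, fun=> 0).
Definition ysub (y z : (nat -> R) * (nat -> R)) : (nat -> R) * (nat -> R) :=
  (fun l => y.1 l - z.1 l, fun l => y.2 l - z.2 l).
Fixpoint yiter n := if n is n'.+1 then
  (fun l => (iter_init).1 l + (iter_step (yiter n')).1 l, fun l => (iter_step (yiter n')).2 l) else iter_init.

Lemma tconv_sub B1 a b l : tconv nu B1 (fun l => a l - b l) l = tconv nu B1 a l - tconv nu B1 b l.
Proof. by rewrite /tconv -sumrB; apply: eq_bigr => j _; ring. Qed.

Lemma iter_step_sub y z : iter_step (ysub y z) = ysub (iter_step y) (iter_step z).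
Proof.
rewrite /iter_step /ysub /=; congr pair; apply/funext => l /=.
  case: l => [|l]; first by rewrite subrr.
  case: ifP => _; last by rewrite subrr.
  by rewrite /resonant_residual /= !tconv_sub /dcoef; ring.
case: ifP => _; last by rewrite subrr.
by rewrite /slave_residual /= !tconv_sub /dcoef; ring.
Qed.

Variables (be La K ga th : R).
Hypotheses (be0 : 0 < be) (nu0 : 0 < nu) (ga0 : 0 < ga) (K0 : 0 <= K) (La0 : 0 <= La)
  (kap0 : 0 < kap) (c0 : c != 0) (s20 : 0 <= s2)
  (thE : th = D%:R * nu * ga / be) (th1 : th <= 2^-1).
Hypotheses (hb2 : `|b2| <= K) (hb1 : `|b1| <= K) (hb0 : `|b0| <= K)
  (hh2 : `|h2| <= K) (hh1 : `|h1| <= K) (hh0 : `|h0| <= K) (hd : `|d| <= K).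
Hypotheses (B00 : B 0%N = 0) (B'00 : B' 0%N = 0) (E00 : E 0%N = 0) (E'00 : E' 0%N = 0).
Hypotheses (hB : forall m, `|B m| <= K * ga ^+ m) (hB' : forall m, `|B' m| <= K * ga ^+ m)
  (hE : forall m, `|E m| <= K * ga ^+ m) (hE' : forall m, `|E' m| <= K * ga ^+ m).
Hypothesis cond1 : be ^+ 2 + s2 * K * La * (be ^+ 2 + be + 1) + 2 * th * K * (1 + La) <= kap * be.
Hypothesis cond2 : K + K * La * (be ^+ 2 + be + s2) + 2 * th * K * (1 + La) <= `|c| * La / 2.

(** The weight [La] on the second component makes the undiminished term d p in the
    equation for r harmless. *)
Definition ynorm M (y : (nat -> R) * (nat -> R)) :=
  (forall l, `|y.1 l| <= M * expw be l) /\ (forall l, `|y.2 l| <= M * La * expw be l).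

Let lin_bound M x k z : `|x| <= M * z -> `|k| <= K -> 0 <= z -> 0 <= M -> `|k * x| <= K * M * z.
Proof. by move=> hx hk z0 M0; rewrite normrM -mulrA; apply: ler_pM. Qed.

Lemma resonant_bound M y l : 0 <= M -> ynorm M y -> (l <= D)%N ->
  `|resonant_residual y l - 2 * kap * dcoef y.1 l| <= M * (kap * be) * expw be l.
Proof.
move=> M0 [hp hr] lD; have w0 := expw_ge0 l (ltW be0).
have hp1 := dcoef_bound hp; have hp2 := dcoef_bound hp1.
have hr1 := dcoef_bound hr; have hr2 := dcoef_bound hr1.
have ML : 0 <= M * La by nonneg.
have bp := ltW be0.
have MLb : 0 <= M * La * be by nonneg.
have MLbb : 0 <= M * La * be * be by nonneg.
have t1 := tconv_bound be0 nu0 ga0 K0 M0 thE th1 B00 hB hp lD.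
have t2 := tconv_bound be0 nu0 ga0 K0 ML thE th1 B'00 hB' hr lD.
have l2 := lin_bound (hr2 l) hb2 w0 MLbb.
have l1 := lin_bound (hr1 l) hb1 w0 MLb.
have l0 := lin_bound (hr l) hb0 w0 ML.
apply: le_trans (_ : M * (be ^+ 2 + s2 * K * La * (be ^+ 2 + be + 1) + 2 * th * K * (1 + La)) * expw be l <= _); last first.
  by apply: ler_wpM2r => //; apply: ler_wpM2l.
rewrite /resonant_residual.
set X := b2 * _ in l2 *; set Y := b1 * _ in l1 *; set Z := b0 * _ in l0 *.
have -> : - dcoef (dcoef y.1) l + 2 * kap * dcoef y.1 l + s2 * (X + Y + Z) + tconv nu B y.1 l + tconv nu B' y.2 l - 2 * kap * dcoef y.1 l
  = - dcoef (dcoef y.1) l + s2 * (X + Y + Z) + tconv nu B y.1 l + tconv nu B' y.2 l by ring.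
apply: le_trans (ler_normD _ _) _; apply: le_trans (lerD (ler_normD _ _) (lexx _)) _.
apply: le_trans (lerD (lerD (ler_normD _ _) (lexx _)) (lexx _)) _.
rewrite normrN (normrM s2) (ger0_norm s20).
have hS : `|X + Y + Z| <= K * La * M * (be ^+ 2 + be + 1) * expw be l.
  apply: le_trans (ler_normD _ _) _; apply: le_trans (lerD (ler_normD _ _) (lexx _)) _.
  apply: le_trans (lerD (lerD l2 l1) l0) _; apply: le_of_eq; ring.
have hS2 := ler_wpM2l s20 hS.
apply: le_trans (lerD (lerD (lerD (hp2 l) hS2) t1) t2) _.
by apply: le_of_eq; ring.
Qed.

Lemma slave_bound M y l : 0 <= M -> ynorm M y -> (l <= D)%N ->
  `|slave_residual y l - c * y.2 l| <= M * (`|c| * La / 2) * expw be l.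
Proof.
move=> M0 [hp hr] lD; have w0 := expw_ge0 l (ltW be0).
have hr1 := dcoef_bound hr; have hr2 := dcoef_bound hr1.
have ML : 0 <= M * La by nonneg.
have bp := ltW be0.
have MLb : 0 <= M * La * be by nonneg.
have MLbb : 0 <= M * La * be * be by nonneg.
have t1 := tconv_bound be0 nu0 ga0 K0 M0 thE th1 E00 hE hp lD.
have t2 := tconv_bound be0 nu0 ga0 K0 ML thE th1 E'00 hE' hr lD.
have l2 := lin_bound (hr2 l) hh2 w0 MLbb.
have l1 := lin_bound (hr1 l) hh1 w0 MLb.
have l0 := lin_bound (hr l) hh0 w0 ML.
have ld := lin_bound (hp l) hd w0 M0.
apply: le_trans (_ : M * (K + K * La * (be ^+ 2 + be + s2) + 2 * th * K * (1 + La)) * expw be l <= _); last first.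
  by apply: ler_wpM2r => //; apply: ler_wpM2l.
rewrite /slave_residual.
set X := h2 * _ in l2 *; set Y := h1 * _ in l1 *; set W := d * _ in ld *.
have -> : c * y.2 l + W + X + Y + s2 * h0 * y.2 l + tconv nu E y.1 l + tconv nu E' y.2 l - c * y.2 l
  = W + X + Y + s2 * (h0 * y.2 l) + tconv nu E y.1 l + tconv nu E' y.2 l by ring.
set Z := h0 * _ in l0 *.
apply: le_trans (ler_normD _ _) _; apply: le_trans (lerD (ler_normD _ _) (lexx _)) _.
apply: le_trans (lerD (lerD (ler_normD _ _) (lexx _)) (lexx _)) _.
apply: le_trans (lerD (lerD (lerD (ler_normD _ _) (lexx _)) (lexx _)) (lexx _)) _.
apply: le_trans (lerD (lerD (lerD (lerD (ler_normD _ _) (lexx _)) (lexx _)) (lexx _)) (lexx _)) _.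
rewrite (normrM s2) (ger0_norm s20).
have l0' := ler_wpM2l s20 l0.
apply: le_trans (lerD (lerD (lerD (lerD (lerD ld l2) l1) l0') t1) t2) _.
by apply: le_of_eq; ring.
Qed.

(** [cond1] and [cond2] say that all terms but the main ones, in the weighted
    norm, are at most half of the main ones. *)
Lemma iter_step_norm M y : 0 <= M -> ynorm M y -> ynorm (M / 2) (iter_step y).
Proof.
move=> M0 hy; split => l /=.
  case: l => [|l]; first by rewrite /= normr0; have w0 := expw_ge0 0 (ltW be0); nonneg.
  case: ifP => lD; last by rewrite /= normr0; have w0 := expw_ge0 l.+1 (ltW be0); nonneg.
  have := resonant_bound M0 hy (ltnW lD).
  have k2 : 0 < 2 * kap * l.+1%:R by rewrite !mulr_gt0.
  have -> : y.1 l.+1 - (2 * kap * l.+1%:R)^-1 * resonant_residual y l =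
     - ((2 * kap * l.+1%:R)^-1 * (resonant_residual y l - 2 * kap * dcoef y.1 l)).
    rewrite /dcoef; field; rewrite (gt_eqF kap0) nat1r pnatr_eq0 //.
  rewrite normrN normrM normfV (gtr0_norm k2) => h.
  rewrite mulrC ler_pdivrMr //; apply: le_trans h _; apply: le_of_eq.
  have -> : M / 2 * expw be l.+1 * (2 * kap * l.+1%:R) = M * kap * (l.+1%:R * expw be l.+1) by field.
  by rewrite expwS; ring.
case: ifP => lD; last by rewrite /= normr0; have w0 := expw_ge0 l (ltW be0); nonneg.
have := slave_bound M0 hy lD.
have -> : y.2 l - c^-1 * slave_residual y l = - (c^-1 * (slave_residual y l - c * y.2 l)) by field.
rewrite normrN normrM normfV => h.
rewrite mulrC ler_pdivrMr ?normr_gt0 //; apply: le_trans h _; by apply: le_of_eq; field.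
Qed.

Lemma iter_init_norm : ynorm 1 iter_init.
Proof.
split => l /=; last by rewrite /= normr0; have w0 := expw_ge0 l (ltW be0); nonneg.
by case: l => [|l] /=; rewrite ?normr0 ?normr1 mul1r ?expw_ge0 ?(ltW be0) // /expw expr0 fact0 divr1.
Qed.

Lemma yiter_norm n : ynorm 2 (yiter n).
Proof.
elim: n => [|n IH].
  have [h1' h2'] := iter_init_norm; split => l.
    by apply: le_trans (h1' l) _; apply: ler_wpM2r; [rewrite expw_ge0 // ltW|lra].
  by rewrite /= normr0; have w0 := expw_ge0 l (ltW be0); nonneg.
have [h1' h2'] := iter_init_norm; have [g1 g2] := iter_step_norm (ler0n R 2) IH.
have -> : 2 = 1 + 1 :> R by ring.
split => l.
  rewrite mulrDl; apply: le_trans (ler_normD _ _) _; apply: lerD; first exact: h1'.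
  by apply: le_trans (g1 l) _; apply: ler_wpM2r; [rewrite expw_ge0 // ltW|lra].
apply: le_trans (g2 l) _; apply: ler_wpM2r; first by rewrite expw_ge0 // ltW.
by apply: ler_wpM2r => //; lra.
Qed.

Lemma yiter_diff n : ynorm (2^-1 ^+ n.+1) (ysub (yiter n.+1) (yiter n)).
Proof.
elim: n => [|n IH].
  have [g1 g2] := iter_step_norm (@ler01 R) iter_init_norm.
  by split => l; rewrite expr1 /=; [have := g1 l|have := g2 l]; rewrite /= ?mul1r ?subr0 // addrAC subrr add0r.
have -> : ysub (yiter n.+2) (yiter n.+1) = iter_step (ysub (yiter n.+1) (yiter n)).
  rewrite iter_step_sub; congr pair; apply/funext => l; rewrite /ysub /=; ring.
have h : 0 <= 2^-1 ^+ n.+1 :> R by rewrite exprn_ge0 // invr_ge0.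
by have := iter_step_norm h IH; rewrite [_ ^+ n.+2]exprS mulrC.
Qed.

Lemma yiter_supp n l : (D < l)%N -> (yiter n).1 l = 0 /\ (yiter n).2 l = 0.
Proof.
case: n => [|n] Dl /=; first by rewrite gtn_eqF // (leq_trans _ Dl).
by case: l Dl => // l Dl; rewrite [(l.+1 <= D)%N]leqNgt Dl /= addr0.
Qed.

Lemma yiter_0 n : (yiter n).1 0%N = 1.
Proof. by case: n => [|n] /=; rewrite ?addr0. Qed.

(** The residual is, up to the main factor, the difference of two iterates. *)
Lemma yiter_resonant n l : (l < D)%N ->
  `|resonant_residual (yiter n) l| <= kap * be * 2^-1 ^+ n * expw be l.
Proof.
move=> lD; have [h _] := yiter_diff n; have := h l.+1; rewrite /ysub /= lD add0r.
have k2 : 0 < 2 * kap * l.+1%:R by rewrite !mulr_gt0.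
rewrite addrAC subrr add0r normrN normrM normfV (gtr0_norm k2) mulrC ler_pdivrMr // => h'.
apply: le_trans h' _; apply: le_of_eq.
have -> : 2^-1 ^+ n.+1 * expw be l.+1 * (2 * kap * l.+1%:R) = 2 * 2^-1 ^+ n.+1 * kap * (l.+1%:R * expw be l.+1) by ring.
by rewrite expwS exprS; field.
Qed.

Lemma yiter_slave n l : (l <= D)%N ->
  `|slave_residual (yiter n) l| <= `|c| * La * 2^-1 ^+ n * expw be l.
Proof.
move=> lD; have [_ h] := yiter_diff n; have := h l; rewrite /ysub /= lD.
rewrite addrAC subrr add0r normrN normrM normfV mulrC ler_pdivrMr ?normr_gt0 // => h'.
apply: le_trans h' _; rewrite exprS.
have n0 : 0 <= 2^-1 ^+ n :> R by rewrite exprn_ge0 // invr_ge0.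
have w0 := expw_ge0 l (ltW be0).
rewrite mulrC -!mulrA ler_wpM2l //.
have -> : 2^-1 * (2^-1 ^+ n * (La * expw be l)) = La * (2^-1 ^+ n * expw be l) * 2^-1 by ring.
by apply: ler_piMr; [nonneg|lra].
Qed.

(** The residual of order D is not corrected, because p has no coefficient of
    order D + 1; it is only bounded, and the smallness comes from the weight
    be^D / D!. *)
Lemma yiter_resonantD n : `|resonant_residual (yiter n) D| <= 2 * (kap * be) * expw be D.
Proof.
have := resonant_bound (ler0n R 2) (yiter_norm n) (leqnn D).
have [e _] := yiter_supp n (ltnSn D).
by rewrite /dcoef e !mulr0 subr0.
Qed.
End LayerSequences.

(** * The layer equations for polynomials *)

Section LayerFunctions.
Context {R : realType}.
Implicit Types (a b p r : nat -> R) (f : R -> R) (t : R).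

Definition pol (D : nat) a (t : R) := \sum_(j < D.+1) a j * t ^+ j.

Lemma sum_expw_le n (x : R) : 0 <= x -> \sum_(j < n) expw x j <= expR x.
Proof.
move=> x0; have cv := is_cvg_series_exp_coeff x.
have := nondecreasing_cvgn_le _ cv n; rewrite -/(expR x) => h.
rewrite /expR; apply: le_trans (h _).
  by rewrite /series /= big_mkord; apply: ler_sum => j _; rewrite /exp_coeff /expw.
apply: nondecreasing_series => i _ _; exact: exp_coeff_ge0.
Qed.

Lemma expw_le_exp n (x : R) : 0 <= x -> expw x n <= expR x.
Proof.
move=> x0; apply: le_trans (sum_expw_le n.+1 x0); rewrite big_ord_recr /= lerDr.
by apply: sumr_ge0 => j _; exact: expw_ge0.
Qed.

Lemma expwM (be t : R) j : expw be j * t ^+ j = expw (be * t) j.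
Proof. by rewrite /expw exprMn mulrAC. Qed.

(** Halving the argument gains 2^{-n}: this is how high powers of t become
    exponentially small at the expense of a larger exponent. *)
Lemma expw_half n (x : R) : expw x n = 2^-1 ^+ n * expw (2 * x) n.
Proof.
rewrite /expw exprMn !mulrA -exprMn; have -> : 2^-1 * 2 = 1 :> R by field.
by rewrite expr1n mul1r.
Qed.

Lemma sum_bound_exp n be M a t : 0 <= be -> 0 <= t -> 0 <= M ->
  (forall l, (l < n)%N -> `|a l| <= M * expw be l) ->
  `|\sum_(j < n) a j * t ^+ j| <= M * expR (be * t).
Proof.
move=> be0 t0 M0 h; apply: le_trans (ler_norm_sum _ _ _) _.
apply: le_trans (_ : \sum_(j < n) M * expw (be * t) j <= _).
  apply: ler_sum => j _; rewrite normrM normrX (ger0_norm t0) -expwM mulrA.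
  by apply: ler_wpM2r; [exact: exprn_ge0|exact: h].
by rewrite -mulr_sumr ler_wpM2l // sum_expw_le // mulr_ge0.
Qed.

Lemma pol_bound D be M a t : 0 <= be -> 0 <= t -> 0 <= M ->
  (forall l, `|a l| <= M * expw be l) -> `|pol D a t| <= M * expR (be * t).
Proof. by move=> be0 t0 M0 h; apply: sum_bound_exp. Qed.

Lemma pol_der D a t : (forall l, (D < l)%N -> a l = 0) ->
  is_derive t 1 (pol D a) (pol D (dcoef a) t).
Proof.
move=> aD; rewrite /pol [X in is_derive _ _ _ X](_ : _ = \sum_(j < D) dcoef a j * t ^+ j); last first.
  by rewrite big_ord_recr /= /dcoef aD // mulr0 mul0r addr0.
rewrite (_ : (fun t => _) = fun t => a 0%N + \sum_(j < D) a j.+1 * t ^+ j.+1); last first.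
  by apply/funext => s; rewrite big_ord_recl expr0 mulr1.
have hs : is_derive t 1 (fun t => \sum_(j < D) a j.+1 * t ^+ j.+1) (\sum_(j < D) dcoef a j * t ^+ j); last first.
  by have := derD (der_cst (a 0%N) t) hs; rewrite add0r.
apply: (@der_sum _ _ (fun j t => a j.+1 * t ^+ j.+1) _ (fun j => dcoef a j * t ^+ j)) => j _.
have := derZ (a j.+1) (der_pow j t).
by have -> : a j.+1 * (j.+1%:R * t ^+ j) = dcoef a j * t ^+ j by rewrite /dcoef; ring.
Qed.

Definition taylor_at0 K ga f b := (forall m, `|b m| <= K * ga ^+ m) /\
  forall (M : nat) (x : R), 0 <= x <= 1 ->
    `|f x - \sum_(m < M) b m * x ^+ m| <= K * (ga * x) ^+ M.

Lemma triangular_sum (g : nat -> nat -> R) D :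
  \sum_(l < D) \sum_(j < l.+1) g j (l - j)%N = \sum_(j < D) \sum_(m < D - j) g j m.
Proof.
elim: D => [|D IH]; first by rewrite !big_ord0.
rewrite big_ord_recr /= IH.
rewrite [RHS](eq_bigr (fun j : 'I_D.+1 => \sum_(m < D - j) g j m + g j (D - j)%N)); last first.
  by move=> j _; rewrite subSn; [rewrite big_ord_recr|rewrite -ltnS].
rewrite big_split /=; congr (_ + _).
by rewrite big_ord_recr /= subnn big_ord0 addr0.
Qed.

(** In the product only the powers up to D are kept; the coefficient of t^j in a
    is thus paired with the Taylor polynomial of f of degree D - j. *)
Lemma pol_prod D nu f b a t :
  f (nu * t) * pol D a t - pol D (tconv nu b a) t =
  \sum_(j < D.+1) a j * t ^+ j * (f (nu * t) - \sum_(m < D.+1 - j) b m * (nu * t) ^+ m).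
Proof.
have -> : pol D (tconv nu b a) t = \sum_(j < D.+1) \sum_(m < D.+1 - j) a j * t ^+ j * (b m * (nu * t) ^+ m).
  rewrite -(triangular_sum (fun j m => a j * t ^+ j * (b m * (nu * t) ^+ m))).
  apply: eq_bigr => l _; rewrite /tconv mulr_suml; apply: eq_bigr => j _.
  have -> : t ^+ l = t ^+ j * t ^+ (l - j) by rewrite -exprD subnKC // -ltnS.
  by rewrite exprMn; ring.
rewrite /pol mulr_sumr -sumrB; apply: eq_bigr => j _.
by rewrite -mulr_sumr; ring.
Qed.

Lemma fact_le_exp n : n`!%:R <= n%:R ^+ n :> R.
Proof.
rewrite -natrX ler_nat; elim: n => // n IH.
by rewrite factS expnS leq_mul // (leq_trans IH) //; case: n {IH} => // n; rewrite leq_exp2r.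
Qed.

(** The j-th term of [pol_prod] is at most (be t)^j / j! (ga nu t)^n with n = D + 1 - j.
    As (D + 1) nu ga / be is at most 1/2, the second factor is at most
    2^{-n} (be t)^n / n!, and the first is 2^{-j} (2 be t)^j / j!. *)
Lemma pol_prod_bound K ga D nu be M f b a t : 0 <= K -> 0 < ga -> 0 < nu -> 0 < be -> 0 <= M ->
  D.+1%:R * nu * ga / be <= 2^-1 -> 0 <= t -> nu * t <= 1 ->
  taylor_at0 K ga f b -> (forall l, `|a l| <= M * expw be l) ->
  `|f (nu * t) * pol D a t - pol D (tconv nu b a) t| <= M * K * 2^-1 ^+ D.+1 * expR (3 * be * t).
Proof.
move=> K0 ga0 nu0 be0 M0 hD t0 t1 [_ hT] ha; rewrite pol_prod.
have nt : 0 <= nu * t <= 1 by rewrite mulr_ge0 // ltW.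
have bt : 0 <= be * t by rewrite mulr_ge0 // ltW.
apply: le_trans (ler_norm_sum _ _ _) _.
apply: le_trans (_ : \sum_(j < D.+1) M * K * 2^-1 ^+ D.+1 * expR (be * t) * expw (2 * (be * t)) j <= _).
  apply: ler_sum => j _; rewrite !normrM normrX (ger0_norm t0).
  have jD : (j <= D)%N by rewrite -ltnS.
  apply: le_trans (_ : M * expw be j * t ^+ j * (K * (ga * (nu * t)) ^+ (D.+1 - j)) <= _).
    apply: ler_pM => //; first by rewrite mulr_ge0 ?exprn_ge0.
      by apply: ler_wpM2r; [exact: exprn_ge0|exact: ha].
    exact: hT.
  set n := (D.+1 - j)%N.
  have hn : (ga * (nu * t)) ^+ n <= 2^-1 ^+ n * expR (be * t).
    apply: le_trans (_ : 2^-1 ^+ n * expw (be * t) n <= _); last first.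
      by rewrite ler_wpM2l ?expw_le_exp // exprn_ge0 // invr_ge0.
    have fn0 : 0 < n`!%:R :> R by rewrite ltr0n fact_gt0.
    have -> : 2^-1 ^+ n * expw (be * t) n = (2^-1 * (be * t)) ^+ n / n`!%:R by rewrite (exprMn _ 2^-1) /expw mulrA.
    rewrite ler_pdivlMr //.
    apply: le_trans (_ : (ga * (nu * t)) ^+ n * n%:R ^+ n <= _).
      by rewrite ler_wpM2l ?fact_le_exp // exprn_ge0 // mulr_ge0 ?(ltW ga0) //; case/andP: nt.
    rewrite -exprMn; apply: lerXn2r; rewrite ?nnegrE.
    - by rewrite !mulr_ge0 ?(ltW ga0) ?(ltW nu0).
    - by rewrite mulr_ge0 // invr_ge0.
    - have h1 : n%:R * nu * ga <= D.+1%:R * nu * ga.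
        by rewrite !ler_wpM2r ?(ltW ga0) ?(ltW nu0) // ler_nat leq_subr.
      have h2 : n%:R * nu * ga <= 2^-1 * be by rewrite (le_trans h1) // -ler_pdivrMr.
      have -> : ga * (nu * t) * n%:R = n%:R * nu * ga * t by ring.
      by rewrite mulrA ler_wpM2r.
  apply: le_trans (_ : M * expw be j * t ^+ j * (K * (2^-1 ^+ n * expR (be * t))) <= _).
    apply: ler_wpM2l; last by apply: ler_wpM2l.
    by rewrite mulr_ge0 ?exprn_ge0 // mulr_ge0 // expw_ge0 // ltW.
  have -> : M * expw be j * t ^+ j = M * (2^-1 ^+ j * expw (2 * (be * t)) j).
    by rewrite -(expw_half j (be * t)) -(expwM be t j); ring.
  have -> : 2^-1 ^+ D.+1 = 2^-1 ^+ j * 2^-1 ^+ n :> R.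
    by rewrite -exprD subnKC // ltnW // ltnS.
  by apply: le_of_eq; ring.
rewrite -mulr_sumr.
have -> : 3 * be * t = be * t + 2 * (be * t) by ring.
rewrite expRD [leRHS]mulrA; apply: ler_wpM2l; last by apply: sum_expw_le; rewrite mulr_ge0.
by rewrite !mulr_ge0 ?expR_ge0 ?exprn_ge0 ?invr_ge0.
Qed.

Lemma polD D a b t : pol D (fun l => a l + b l) t = pol D a t + pol D b t.
Proof. by rewrite /pol -big_split; apply: eq_bigr => j _; rewrite mulrDl. Qed.
Lemma polN D a t : pol D (fun l => - a l) t = - pol D a t.
Proof. by rewrite /pol -sumrN; apply: eq_bigr => j _; rewrite mulNr. Qed.
Lemma polZ D c a t : pol D (fun l => c * a l) t = c * pol D a t.
Proof. by rewrite /pol mulr_sumr; apply: eq_bigr => j _; rewrite mulrA. Qed.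

(** The two equations that a layer e^{-kap t} (p, r) has to satisfy, up to an error
    2^{-D} e^{3 be t}: [yiter] solves them for the coefficients up to degree D, and
    [pol_prod_bound] controls the variable coefficients beyond. *)
Lemma layer_functions (K k0 ga : R) : 1 <= K -> 0 < k0 -> k0 <= 1 -> 0 < ga ->
  exists be s0 tau0 La Cr : R, [/\ 0 < be, 6 * be <= k0 & 0 < s0] /\
   [/\ s0 <= 1, 0 < tau0, 1 <= La & 0 < Cr] /\
  forall (D : nat) (nu kap s2 c d b2 b1 b0 h2 h1 h0 : R) (fB fB' fE fE' : R -> R) (B B' E E' : nat -> R),
   0 < nu -> D.+1%:R * nu <= tau0 -> k0 <= kap -> kap <= K -> k0 <= `|c| -> `|c| <= K ->
   0 <= s2 -> s2 <= s0 ->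
   [/\ `|b2| <= K, `|b1| <= K & `|b0| <= K] -> [/\ `|h2| <= K, `|h1| <= K, `|h0| <= K & `|d| <= K] ->
   [/\ B 0%N = 0, B' 0%N = 0, E 0%N = 0 & E' 0%N = 0] ->
   [/\ taylor_at0 K ga fB B, taylor_at0 K ga fB' B', taylor_at0 K ga fE E & taylor_at0 K ga fE' E'] ->
  exists p r : nat -> R,
   [/\ p 0%N = 1, forall l, `|p l| <= 2 * expw be l, forall l, `|r l| <= 2 * La * expw be l,
     forall l, (D < l)%N -> p l = 0 & forall l, (D < l)%N -> r l = 0] /\
   forall t, 0 <= t -> nu * t <= 1 ->
    `| - pol D (dcoef (dcoef p)) t + 2 * kap * pol D (dcoef p) t
      + s2 * (b2 * pol D (dcoef (dcoef r)) t + b1 * pol D (dcoef r) t + b0 * pol D r t)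
      + fB (nu * t) * pol D p t + fB' (nu * t) * pol D r t| <= Cr * 2^-1 ^+ D * expR (3 * be * t) /\
    `| c * pol D r t + d * pol D p t + h2 * pol D (dcoef (dcoef r)) t + h1 * pol D (dcoef r) t
      + s2 * h0 * pol D r t
      + fE (nu * t) * pol D p t + fE' (nu * t) * pol D r t| <= Cr * 2^-1 ^+ D * expR (3 * be * t).
Proof.
move=> K1 k00 k01 ga0.
have K0 : 0 < K by lra.
(* La first absorbs K / k0, the size of d / c; then be, s0 and th0 are small
   enough for [cond1] and [cond2], and 6 be <= k0 lets the decay win *)
pose La := 8 * K / k0; pose be := k0 / (16 * K).
have La8 : 8 <= La by rewrite /La ler_pdivlMr //; nra.
have LaE : La * k0 = 8 * K by rewrite /La; field; rewrite gt_eqF.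
have La0 : 0 < La by lra.
have be0 : 0 < be by rewrite divr_gt0 // mulr_gt0.
have beE : be * K = k0 / 16 by rewrite /be; field; rewrite gt_eqF.
have be16 : be <= k0 / 16 by rewrite -beE; nra.
pose s0 := k0 * be / (12 * K * La).
have KL : 0 < K * La by rewrite mulr_gt0.
have s0E : s0 * (K * La) = k0 * be / 12 by rewrite /s0; field; rewrite !gt_eqF.
have s00 : 0 < s0 by apply: divr_gt0; [exact: mulr_gt0|nra].
pose th0 := k0 * be / (8 * K * (1 + La)).
have La1 : 0 < 1 + La by lra.
have th00 : 0 < th0 by apply: divr_gt0; [exact: mulr_gt0|nra].
have th0E : th0 * (K * (1 + La)) = k0 * be / 8 by rewrite /th0; field; rewrite !gt_eqF.
have kb : k0 * be <= be by nra.
have th01 : th0 <= 2^-1.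
  have h1 : 1 <= K * (1 + La) by apply: mulr_ege1 => //; lra.
  have : th0 <= th0 * (K * (1 + La)) by rewrite ler_peMr ?(ltW th00).
  lra.
have s0sm : s0 * K <= k0 / 16.
  have : s0 * K <= s0 * (K * La) by rewrite [leRHS]mulrA; apply: ler_peMr; [apply: mulr_ge0; exact: ltW|lra].
  nra.
clearbody s0 th0; clearbody be La.
exists be, s0, (th0 * be / ga), La, (4 * K + 3 * K * La).
split; first by split => //; lra.
split.
  split; first nra.
  - by rewrite divr_gt0 // mulr_gt0.
  - lra.
  - nra.
move=> D nu kap s2 c d b2 b1 b0 h2 h1 h0 fB fB' fE fE' B B' E E' nu0 hD kk kK ck cK s20 s2s
  [hb2 hb1 hb0] [hh2 hh1 hh0 hd] [B00 B'00 E00 E'00] [tB tB' tE tE'].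
have hth : D.+1%:R * nu * ga / be <= th0.
  by rewrite ler_pdivrMr // -ler_pdivlMr.
have hth2 : D.+1%:R * nu * ga / be <= 2^-1 by exact: le_trans hth th01.
pose th := D%:R * nu * ga / be.
have hth3 : th <= th0.
  apply: le_trans hth; rewrite /th !ler_wpM2r ?invr_ge0 ?(ltW be0) ?(ltW ga0) ?(ltW nu0) // ler_nat //.
have th1 : th <= 2^-1 by exact: le_trans hth3 th01.
have thp : 0 <= th by rewrite /th; nonneg.
have thK : 2 * th * K * (1 + La) <= k0 * be / 4.
  have : th * (K * (1 + La)) <= k0 * be / 8 by rewrite -th0E ler_wpM2r // ltW // mulr_gt0.
  lra.
have sK : s2 * K * La <= k0 * be / 12.
  by rewrite -s0E -mulrA ler_wpM2r // ltW.
have sK0 : 0 <= s2 * K * La by rewrite !mulr_ge0 ?(ltW K0) ?(ltW La0).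
have be1 : be <= 1 by clear - be16 k01; lra.
have bb : be ^+ 2 <= be by rewrite expr2; apply: ler_piMl => //; exact: ltW.
have cond1 : be ^+ 2 + s2 * K * La * (be ^+ 2 + be + 1) + 2 * th * K * (1 + La) <= kap * be.
  have h3 : s2 * K * La * (be ^+ 2 + be + 1) <= k0 * be / 12 * 3.
    have be2 : 0 <= be ^+ 2 by exact: sqr_ge0.
    by apply: ler_pM => //; clear - be0 be1 bb be2; lra.
  have h4 : be ^+ 2 <= k0 * be / 16 by rewrite expr2 mulrAC; apply: ler_wpM2r => //; exact: ltW.
  have h5 : k0 * be <= kap * be by rewrite ler_wpM2r // ltW.
  have h6 : 0 <= k0 * be by rewrite mulr_ge0 // ltW.
  by clear - h3 h4 h5 h6 thK; lra.
have s2K : s2 * K <= k0 / 16.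
  by apply: le_trans s0sm; rewrite ler_wpM2r // ltW.
have cond2 : K + K * La * (be ^+ 2 + be + s2) + 2 * th * K * (1 + La) <= `|c| * La / 2.
  have h3 : K * La * (be ^+ 2 + be + s2) <= (k0 / 16 + k0 / 16 + k0 / 16) * La.
    have -> : K * La * (be ^+ 2 + be + s2) = (be ^+ 2 * K + be * K + s2 * K) * La by ring.
    apply: ler_wpM2r; first exact: ltW.
    have : be ^+ 2 * K <= be * K by rewrite ler_wpM2r // ltW.
    lra.
  have h4 : k0 * La <= `|c| * La by rewrite ler_wpM2r // ltW.
  have h5 : k0 * be <= K / 4 by clear - kb be16 k01 K1; lra.
  by clear - h3 h4 h5 LaE thK La8 K0 ck K1; lra.
pose y := yiter D nu kap s2 c d b2 b1 b0 h2 h1 h0 B B' E E' D.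
have kap0 : 0 < kap by exact: lt_le_trans k00 kk.
have cn0 : c != 0 by rewrite -normr_gt0; exact: lt_le_trans k00 ck.
have Kn := ltW K0; have Lan := ltW La0; have ben := ltW be0.
have hN := yiter_norm be0 nu0 ga0 Kn Lan kap0 cn0 s20 erefl th1 hb2 hb1 hb0 hh2 hh1 hh0 hd B00 B'00 E00 E'00 tB.1 tB'.1 tE.1 tE'.1 cond1 cond2 D.
have hS := yiter_resonant be0 nu0 ga0 Kn Lan kap0 cn0 s20 erefl th1 hb2 hb1 hb0 hh2 hh1 hh0 hd B00 B'00 E00 E'00 tB.1 tB'.1 tE.1 tE'.1 cond1 cond2 D.
have hR := yiter_slave be0 nu0 ga0 Kn Lan kap0 cn0 s20 erefl th1 hb2 hb1 hb0 hh2 hh1 hh0 hd B00 B'00 E00 E'00 tB.1 tB'.1 tE.1 tE'.1 cond1 cond2 D.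
have hSD := yiter_resonantD be0 nu0 ga0 Kn Lan kap0 cn0 s20 erefl th1 hb2 hb1 hb0 hh2 hh1 hh0 hd B00 B'00 E00 E'00 tB.1 tB'.1 tE.1 tE'.1 cond1 cond2 D.
have hsupp := @yiter_supp R D nu kap s2 c d b2 b1 b0 h2 h1 h0 B B' E E' D.
have [hp hr] := hN.
exists y.1, y.2; split.
  split => //.
  - exact: yiter_0.
  - by move=> l /hsupp [].
  - by move=> l /hsupp [].
move=> t t0 t1.
have q0 : 0 <= 2^-1 ^+ D :> R by rewrite exprn_ge0 // invr_ge0.
have bt : 0 <= be * t by rewrite mulr_ge0.
have e1 : expR (be * t) <= expR (3 * be * t) by rewrite ler_expR; clear - bt; lra.
have e2 : expR (2 * (be * t)) <= expR (3 * be * t) by rewrite ler_expR; clear - bt; lra.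
have ML : 0 <= 2 * La by exact: mulr_ge0.
have P1 := pol_prod_bound Kn ga0 nu0 be0 (ler0n R 2) hth2 t0 t1 tB hp.
have P2 := pol_prod_bound Kn ga0 nu0 be0 ML hth2 t0 t1 tB' hr.
have P3 := pol_prod_bound Kn ga0 nu0 be0 (ler0n R 2) hth2 t0 t1 tE hp.
have P4 := pol_prod_bound Kn ga0 nu0 be0 ML hth2 t0 t1 tE' hr.
have E0 := expR_ge0 (3 * be * t).
rewrite exprS in P1 P2 P3 P4.
set ex := expR (3 * be * t) in P1 P2 P3 P4 e1 e2 E0 *.
set q := 2^-1 ^+ D in P1 P2 P3 P4 q0 hS hR *.
have qe : 0 <= q * ex by rewrite mulr_ge0.
split.
- have -> : - pol D (dcoef (dcoef y.1)) t + 2 * kap * pol D (dcoef y.1) t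
      + s2 * (b2 * pol D (dcoef (dcoef y.2)) t + b1 * pol D (dcoef y.2) t + b0 * pol D y.2 t)
      + fB (nu * t) * pol D y.1 t + fB' (nu * t) * pol D y.2 t =
    pol D (resonant_residual nu kap s2 b2 b1 b0 B B' y) t
      + (fB (nu * t) * pol D y.1 t - pol D (tconv nu B y.1) t)
      + (fB' (nu * t) * pol D y.2 t - pol D (tconv nu B' y.2) t).
    by rewrite /resonant_residual !(polD, polZ, polN); ring.
  have S1 : `|pol D (resonant_residual nu kap s2 b2 b1 b0 B B' y) t| <= 3 * (kap * be) * (q * ex).
    rewrite /pol big_ord_recr /=; apply: le_trans (ler_normD _ _) _.
    have kb0 : 0 <= kap * be by rewrite mulr_ge0 // ltW.
    have A1 : `|\sum_(i < D) resonant_residual nu kap s2 b2 b1 b0 B B' y i * t ^+ i| <= kap * be * (q * ex).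
      apply: le_trans (sum_bound_exp (M := kap * be * q) ben t0 _ _) _.
      - by rewrite mulr_ge0.
      - by move=> l lD; exact: hS.
      - by have := ler_wpM2l kb0 (ler_wpM2l q0 e1); rewrite [leLHS]mulrA.
    have A2 : `|resonant_residual nu kap s2 b2 b1 b0 B B' y D * t ^+ D| <= 2 * (kap * be) * (q * ex).
      rewrite normrM normrX (ger0_norm t0).
      apply: le_trans (ler_wpM2r (exprn_ge0 D t0) hSD) _.
      have -> : 2 * (kap * be) * expw be D * t ^+ D = 2 * (kap * be) * (q * expw (2 * (be * t)) D).
        by rewrite -(expw_half D (be * t)) -(expwM be t D); ring.
      apply: ler_wpM2l; first by rewrite mulr_ge0.
      apply: ler_wpM2l => //; apply: le_trans e2; apply: expw_le_exp; exact: mulr_ge0.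
    by clear - A1 A2; lra.
  apply: le_trans (ler_normD _ _) _; apply: le_trans (lerD (ler_normD _ _) (lexx _)) _.
  apply: le_trans (lerD (lerD S1 P1) P2) _.
  have kbK : kap * be <= K * 1 by apply: ler_pM => //; exact: ltW.
  have kbq := ler_wpM2r qe kbK; have Kq := mulr_ge0 (mulr_ge0 Kn Lan) qe.
  by clear - kbq Kq; lra.
- have -> : c * pol D y.2 t + d * pol D y.1 t + h2 * pol D (dcoef (dcoef y.2)) t + h1 * pol D (dcoef y.2) t
      + s2 * h0 * pol D y.2 t + fE (nu * t) * pol D y.1 t + fE' (nu * t) * pol D y.2 t =
    pol D (slave_residual nu s2 c d h2 h1 h0 E E' y) t
      + (fE (nu * t) * pol D y.1 t - pol D (tconv nu E y.1) t)
      + (fE' (nu * t) * pol D y.2 t - pol D (tconv nu E' y.2) t).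
    by rewrite /slave_residual !(polD, polZ, polN); ring.
  have S1 : `|pol D (slave_residual nu s2 c d h2 h1 h0 E E' y) t| <= `|c| * La * (q * ex).
    apply: le_trans (sum_bound_exp (M := `|c| * La * q) ben t0 _ _) _.
    - by rewrite !mulr_ge0.
    - by move=> l lD; exact: hR.
    - by have := ler_wpM2l (mulr_ge0 (normr_ge0 c) Lan) (ler_wpM2l q0 e1); rewrite [leLHS]mulrA.
  apply: le_trans (ler_normD _ _) _; apply: le_trans (lerD (ler_normD _ _) (lexx _)) _.
  apply: le_trans (lerD (lerD S1 P3) P4) _.
  have cLK : `|c| * La <= K * La by rewrite ler_wpM2r.
  have cLq := ler_wpM2r qe cLK; have Kq := mulr_ge0 Kn qe.
  have KLq := mulr_ge0 (mulr_ge0 Kn Lan) qe.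
  by clear - cLq Kq KLq; lra.
Qed.
End LayerFunctions.

(** * Layer functions: derivatives, decay, entireness *)

Section LayerCalculus.
Context {R : realType}.
Implicit Types (a b p r : nat -> R) (f w : R -> R) (t x kap nu : R).

Lemma entire_eq w w' : w =1 w' -> entire w -> entire w'.
Proof. by move=> /funext ->. Qed.

Lemma entire_exp (la : R) : entire (fun x => expR (la * x)).
Proof.
exists (fun k => la ^+ k / k`!%:R) => x.
have -> : pseries (fun k => la ^+ k / k`!%:R) x = series (exp_coeff (la * x)).
  by rewrite /pseries; congr series; apply/funext => k; rewrite /exp_coeff /= exprMn mulrAC.
exact: is_cvg_series_exp_coeff.
Qed.

Lemma entireD w w' : entire w -> entire w' -> entire (fun x => w x + w' x).
Proof.
move=> [a ha] [b hb]; exists (fun k => a k + b k) => x.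
have -> : pseries (fun k => a k + b k) x = (fun n => pseries a x n + pseries b x n).
  apply/funext => n; rewrite /pseries /series /= -big_split; apply: eq_bigr => k _ /=; ring.
exact: cvgD (ha x) (hb x).
Qed.

Lemma entireZ c w : entire w -> entire (fun x => c * w x).
Proof.
move=> [a ha]; exists (fun k => c * a k) => x.
have -> : pseries (fun k => c * a k) x = (fun n => c * pseries a x n).
  apply/funext => n; rewrite /pseries /series /= mulr_sumr; apply: eq_bigr => k _ /=; ring.
by apply: cvgM (ha x); exact: cvg_cst.
Qed.

Lemma entireX w : entire w -> entire (fun x => x * w x).
Proof.
move=> [a ha]; exists (fun k => if k is k'.+1 then a k' else 0) => x.
rewrite -cvg_shiftS.
have -> : [sequence pseries (fun k => if k is k'.+1 then a k' else 0) x n.+1]_n = (fun n => x * pseries a x n).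
  apply/funext => n; rewrite /pseries /series /= big_nat_recl // mul0r add0r mulr_sumr.
  by apply: eq_bigr => k _ /=; rewrite exprS; ring.
by apply: cvgM (ha x); exact: cvg_cst.
Qed.

Lemma entire_affine_pow (u v : R) w j : entire w -> entire (fun x => (u + v * x) ^+ j * w x).
Proof.
move=> hw; elim: j => [|j IH].
  by apply: entire_eq hw => x; rewrite expr0 mul1r.
apply: entire_eq (entireD (entireZ u IH) (entireZ v (entireX IH))) => x.
by rewrite exprS; ring.
Qed.

Lemma entire_sum n (h : nat -> R -> R) : (forall i, entire (h i)) ->
  entire (fun x => \sum_(i < n) h i x).
Proof.
move=> hh; elim: n => [|n IH].
  have h0 := entireZ 0 (hh 0%N); apply: entire_eq h0 => x; rewrite big_ord0 mul0r //.
by apply: entire_eq (entireD IH (hh n)) => x; rewrite big_ord_recr.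
Qed.

(** In x, the function e^{-kap t} a(t) with t = x / nu. *)
Definition layer D a kap nu x := pol D a (x / nu) * expR (- (kap * (x / nu))).

Lemma entire_layer_affine D a kap nu (u v : R) : entire (fun x => layer D a kap nu (u + v * x)).
Proof.
pose c := expR (- (kap * (u / nu))).
apply: entire_eq (entireZ c (entire_sum D.+1 (fun j => entireZ (a j) (entire_affine_pow (u / nu) (v / nu) j (entire_exp (- (kap * (v / nu)))))))) => x.
rewrite /layer /pol mulr_suml mulr_sumr; apply: eq_bigr => j _.
have -> : (u + v * x) / nu = u / nu + v / nu * x by rewrite mulrDl mulrAC.
have -> : - (kap * (u / nu + v / nu * x)) = - (kap * (u / nu)) + - (kap * (v / nu)) * x by ring.
by rewrite expRD -/c; ring.
Qed.

(** Coefficients of (d/dt - kap) a. *)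
Definition layer_dcoef kap a : nat -> R := fun l => dcoef a l - kap * a l.

Lemma layer_dcoef_supp D kap a : (forall l, (D < l)%N -> a l = 0) ->
  forall l, (D < l)%N -> layer_dcoef kap a l = 0.
Proof. by move=> h l Dl; rewrite /layer_dcoef /dcoef !h ?mulr0 ?subr0 // ltnW. Qed.

Lemma layer_dcoef_bound be M kap a : 0 <= kap -> (forall l, `|a l| <= M * expw be l) ->
  forall l, `|layer_dcoef kap a l| <= M * (be + kap) * expw be l.
Proof.
move=> k0 h l; rewrite /layer_dcoef; apply: le_trans (ler_normB _ _) _.
have := dcoef_bound h l => h1.
have h2 : `|kap * a l| <= kap * (M * expw be l).
  by rewrite normrM (ger0_norm k0) ler_wpM2l.
lra.
Qed.

Lemma layer_dcoef2 kap a l : layer_dcoef kap (layer_dcoef kap a) l = dcoef (dcoef a) l - 2 * kap * dcoef a l + kap ^+ 2 * a l.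
Proof. by rewrite /layer_dcoef /dcoef; ring. Qed.

Lemma pol_layer_dcoef D kap a t : pol D (layer_dcoef kap a) t = pol D (dcoef a) t - kap * pol D a t.
Proof. by rewrite /layer_dcoef polD polN polZ. Qed.

Lemma pol_layer_dcoef2 D kap a t : pol D (layer_dcoef kap (layer_dcoef kap a)) t =
  pol D (dcoef (dcoef a)) t - 2 * kap * pol D (dcoef a) t + kap ^+ 2 * pol D a t.
Proof.
rewrite -!polZ -polN -!polD; apply: eq_bigr => j _; congr (_ * _).
by rewrite layer_dcoef2.
Qed.

Lemma layer_der D a kap nu x : (forall l, (D < l)%N -> a l = 0) ->
  is_derive x 1 (layer D a kap nu) (nu^-1 * layer D (layer_dcoef kap a) kap nu x).
Proof.
move=> aD.
have d1 : is_derive x 1 (fun y : R => y / nu) nu^-1.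
  have := derM (der_id x) (der_cst nu^-1 x); by rewrite mul1r mulr0 addr0.
have d2 := der_comp (g := fun y => y / nu) (pol_der (x / nu) aD) d1.
have d3 : is_derive x 1 (fun y : R => - (kap * (y / nu))) (- (kap * nu^-1)) by exact: derN (derZ kap d1).
have d4 := der_comp (g := fun y => - (kap * (y / nu))) (is_derive_expR _) d3.
have := derM d2 d4.
suff -> : nu^-1 * layer D (layer_dcoef kap a) kap nu x = pol D (dcoef a) (x / nu) / nu * expR (- (kap * (x / nu))) + pol D a (x / nu) * (expR (- (kap * (x / nu))) * - (kap / nu)) by [].
by rewrite /layer pol_layer_dcoef; ring.
Qed.

Lemma layer_bound D a kap nu be M x : 0 <= be -> 0 < nu -> 0 <= x -> 0 <= M ->
  (forall l, `|a l| <= M * expw be l) -> `|layer D a kap nu x| <= M * expR (- ((kap - be) * (x / nu))).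
Proof.
move=> be0 nu0 x0 M0 ha; rewrite /layer normrM (ger0_norm (expR_ge0 _)).
have t0 : 0 <= x / nu by rewrite divr_ge0 // ltW.
apply: le_trans (ler_wpM2r (expR_ge0 _) (pol_bound D be0 t0 M0 ha)) _.
by rewrite -mulrA -expRD; apply: le_of_eq; congr (_ * expR _); ring.
Qed.

Lemma rtower_derive1n (F : nat -> R -> R) : (forall n x, is_derive x 1 (F n) (F n.+1 x)) ->
  forall n, derive1n n (F 0%N) = F n.
Proof.
move=> h; elim=> [//|n IH]; rewrite derive1nS IH; apply/funext => x.
exact: der_derive1 (h n x).
Qed.

(** The n-th derivative of the sum of a layer at 0 and a reflected layer at 1. *)
Definition two_sided D a kap b kap' nu n x :=
  nu ^- n * layer D (iter n (layer_dcoef kap) a) kap nu x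
  + (- nu^-1) ^+ n * layer D (iter n (layer_dcoef kap') b) kap' nu (1 - x).

Lemma iter_layer_dcoef_supp D kap a n : (forall l, (D < l)%N -> a l = 0) ->
  forall l, (D < l)%N -> iter n (layer_dcoef kap) a l = 0.
Proof. by move=> h; elim: n => [//|n IH]; exact: layer_dcoef_supp. Qed.

Lemma iter_layer_dcoef_bound be M kap a n : 0 <= kap -> (forall l, `|a l| <= M * expw be l) ->
  forall l, `|iter n (layer_dcoef kap) a l| <= M * (be + kap) ^+ n * expw be l.
Proof.
move=> k0 h; elim: n => [|n IH] l; first by rewrite expr0 mulr1; exact: h.
by apply: le_trans (layer_dcoef_bound k0 IH l) _; rewrite exprSr mulrA.
Qed.

Lemma two_sided_der D a kap b kap' nu n x :
  (forall l, (D < l)%N -> a l = 0) -> (forall l, (D < l)%N -> b l = 0) ->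
  is_derive x 1 (two_sided D a kap b kap' nu n) (two_sided D a kap b kap' nu n.+1 x).
Proof.
move=> aD bD.
have d1 := derZ (nu ^- n) (layer_der kap nu x (iter_layer_dcoef_supp kap n aD)).
have d2 := derZ ((- nu^-1) ^+ n) (der_refl (layer_der kap' nu (1 - x) (iter_layer_dcoef_supp kap' n bD))).
have := derD d1 d2.
suff -> : two_sided D a kap b kap' nu n.+1 x =
  nu ^- n * (nu^-1 * layer D (layer_dcoef kap (iter n (layer_dcoef kap) a)) kap nu x) +
  (- nu^-1) ^+ n * - (nu^-1 * layer D (layer_dcoef kap' (iter n (layer_dcoef kap') b)) kap' nu (1 - x)) by [].
by rewrite /two_sided /= -!exprVn !exprS; ring.
Qed.

(** The rate exceeds k0 / 2 after subtracting the growth be of the polynomial, and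
    the distance to the boundary is at most the distance to either endpoint. *)
Lemma two_sided_BL D a kap b kap' nu be K k0 M : 0 < be -> 6 * be <= k0 ->
  k0 <= kap -> kap <= K -> k0 <= kap' -> kap' <= K -> 0 < nu -> 0 <= M ->
  (forall l, (D < l)%N -> a l = 0) -> (forall l, (D < l)%N -> b l = 0) ->
  (forall l, `|a l| <= M * expw be l) -> (forall l, `|b l| <= M * expw be l) ->
  classBL (2 / k0 * nu) (2 * M) (2 / k0 * (be + K)) (two_sided D a kap b kap' nu 0).
Proof.
move=> be0 bk kk kK kk' kK' nu0 M0 aD bD ha hb.
have k00 : 0 < k0 by lra.
split.
  apply: entire_eq (entireD (entire_layer_affine D a kap nu 0 1) (entire_layer_affine D b kap' nu 1 (-1))) => x.
  by rewrite /two_sided !expr0 invr1 !mul1r add0r mulN1r.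
move=> n x /unitIE/andP[x0 x1].
rewrite (rtower_derive1n (fun n x => two_sided_der kap kap' nu n x aD bD)).
have -> : 2 * M * (2 / k0 * (be + K)) ^+ n * (2 / k0 * nu) ^- n = 2 * (M * (be + K) ^+ n * nu ^- n).
  have h : (2 / k0) ^+ n != 0 by rewrite expf_neq0 // gt_eqF // divr_gt0.
  rewrite !exprMn -exprMn; move: h; set X := (2 / k0) ^+ n => h.
  have hn : nu ^+ n != 0 by rewrite expf_neq0 // gt_eqF.
  by field; rewrite h hn.
have main (c : nat -> R) k y : k0 <= k -> k <= K -> 0 < y -> dist_bd x <= y -> (forall l, `|c l| <= M * expw be l) ->
   nu ^- n * `|layer D (iter n (layer_dcoef k) c) k nu y| <= M * (be + K) ^+ n * nu ^- n * expR (- (dist_bd x / (2 / k0 * nu))).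
  move=> kk0 kkK y0 dy hc.
  have kp : 0 <= k by lra.
  have bK : 0 <= be + k by lra.
  have M1 : 0 <= M * (be + k) ^+ n by rewrite mulr_ge0 // exprn_ge0.
  have h := layer_bound D k (ltW be0) nu0 (ltW y0) M1 (iter_layer_dcoef_bound n kp hc).
  have h2 : expR (- ((k - be) * (y / nu))) <= expR (- (dist_bd x / (2 / k0 * nu))).
    rewrite ler_expR lerN2.
    have -> : dist_bd x / (2 / k0 * nu) = k0 / 2 * (dist_bd x / nu) by field; rewrite !gt_eqF.
    have d1 : dist_bd x / nu <= y / nu by rewrite ler_wpM2r // invr_ge0 ltW.
    have d2 : 0 <= y / nu by rewrite divr_ge0 // ltW.
    apply: le_trans (_ : k0 / 2 * (y / nu) <= _); first by rewrite ler_wpM2l // divr_ge0 // ltW.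
    by rewrite ler_wpM2r //; lra.
  have nn : 0 <= nu ^- n by rewrite invr_ge0 exprn_ge0 // ltW.
  have hK : (be + k) ^+ n <= (be + K) ^+ n by apply: lerXn2r; rewrite ?nnegrE; lra.
  have -> : M * (be + K) ^+ n * nu ^- n * expR (- (dist_bd x / (2 / k0 * nu))) = nu ^- n * (M * (be + K) ^+ n * expR (- (dist_bd x / (2 / k0 * nu)))) by ring.
  apply: ler_wpM2l => //; apply: le_trans h _.
  apply: ler_pM; [exact: M1|exact: expR_ge0|exact: ler_wpM2l|exact: h2].
have dx : dist_bd x <= x by rewrite /dist_bd subr0 (gtr0_norm x0) ge_min lexx.
have dx1 : dist_bd x <= 1 - x.
  by rewrite /dist_bd (ltr0_norm (x := x - 1)) ?subr_lt0 // opprB ge_min lexx orbT.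
have m1 := main a kap x kk kK x0 dx ha.
have y0 : 0 < 1 - x by lra.
have m2 := main b kap' (1 - x) kk' kK' y0 dx1 hb.
rewrite /two_sided; apply: le_trans (ler_normD _ _) _.
rewrite (normrM (nu ^- n)) (normrM ((- nu^-1) ^+ n)).
have nn : 0 <= nu ^- n by rewrite invr_ge0 exprn_ge0 // ltW.
rewrite (ger0_norm nn) normrX normrN (gtr0_norm (x := nu^-1)) ?invr_gt0 // exprVn.
have -> : 2 * (M * (be + K) ^+ n * nu ^- n) * expR (- (dist_bd x / (2 / k0 * nu))) =
  M * (be + K) ^+ n * nu ^- n * expR (- (dist_bd x / (2 / k0 * nu))) + M * (be + K) ^+ n * nu ^- n * expR (- (dist_bd x / (2 / k0 * nu))) by ring.
exact: lerD.
Qed.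
End LayerCalculus.

(** * The slow and the fast layer at an endpoint *)

Section EndLayers.
Context {R : realType}.
Implicit Types (a b p r : nat -> R) (f w : R -> R) (t x kap nu : R).

Lemma tower_taylor_at0 C ga (F : nat -> R -> R) : 0 <= C -> 0 < ga -> tower F -> tbound C ga F ->
  taylor_at0 C ga (F 0%N) (fun m => F m 0).
Proof.
move=> C0 ga0 tF hF; split; first by move=> m; apply: hF; rewrite lexx ler01.
move=> M x xI; rewrite exprMn mulrA; apply: tower_taylor => // y yI; exact: hF.
Qed.

Lemma taylor_at0D K1 K2 ga f1 f2 b1 b2 : taylor_at0 K1 ga f1 b1 -> taylor_at0 K2 ga f2 b2 ->
  taylor_at0 (K1 + K2) ga (fun x => f1 x + f2 x) (fun m => b1 m + b2 m).
Proof.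
move=> [h1 t1] [h2 t2]; split=> [m|M x xI].
  by rewrite mulrDl; apply: le_trans (ler_normD _ _) _; apply: lerD.
rewrite (_ : _ - _ = (f1 x - \sum_(m < M) b1 m * x ^+ m) + (f2 x - \sum_(m < M) b2 m * x ^+ m)); last first.
  under eq_bigr do rewrite mulrDl.
  by rewrite big_split /=; ring.
by rewrite mulrDl; apply: le_trans (ler_normD _ _) _; apply: lerD; [exact: t1|exact: t2].
Qed.

Lemma taylor_at0Z K ga c f b : taylor_at0 K ga f b -> taylor_at0 (`|c| * K) ga (fun x => c * f x) (fun m => c * b m).
Proof.
move=> [h t]; split=> [m|M x xI]; first by rewrite normrM -mulrA ler_wpM2l.
rewrite (_ : _ - _ = c * (f x - \sum_(m < M) b m * x ^+ m)); last first.
  by rewrite mulrBr mulr_sumr; congr (_ - _); apply: eq_bigr => m _; ring.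
by rewrite normrM -mulrA ler_wpM2l //; exact: t.
Qed.

Lemma taylor_at0W K K' ga f b : 0 < ga -> K <= K' -> taylor_at0 K ga f b -> taylor_at0 K' ga f b.
Proof.
move=> ga0 KK [h t]; split=> [m|M x xI].
  by apply: le_trans (h m) _; rewrite ler_wpM2r // exprn_ge0 // ltW.
apply: le_trans (t M x xI) _; rewrite ler_wpM2r // exprn_ge0 // mulr_ge0 ?(ltW ga0) //.
by case/andP: xI.
Qed.

(** Taylor coefficients after subtracting the value at 0. *)
Definition drop0 b : nat -> R := fun m => if m is m'.+1 then b m else 0.

Lemma taylor_at0_drop0 K ga f b : 0 < ga -> taylor_at0 K ga f b -> taylor_at0 (2 * K) ga (fun x => f x - b 0%N) (drop0 b).
Proof.
move=> ga0 [h t].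
have K0 : 0 <= K by apply: le_trans (normr_ge0 (b 0%N)) _; have := h 0%N; rewrite expr0 mulr1.
have KK : K <= 2 * K by lra.
have w (v : R) : 0 <= v -> K * v <= 2 * K * v by move=> v0; rewrite ler_wpM2r.
split=> [[|m]|[|M] x xI].
- by rewrite /= normr0 expr0 mulr1; lra.
- by apply: le_trans (h m.+1) (w _ _); rewrite exprn_ge0 // ltW.
- rewrite big_ord0 subr0 expr0 mulr1; apply: le_trans (ler_normB _ _) _.
  by have := t 0%N x xI; have := h 0%N; rewrite big_ord0 subr0 !expr0 !mulr1; lra.
- rewrite (_ : _ - _ = f x - \sum_(m < M.+1) b m * x ^+ m); last first.
    rewrite !big_ord_recl /= expr0 mul0r mulr1 add0r.
    by rewrite opprD addrA.
  apply: le_trans (t M.+1 x xI) (w _ _); rewrite exprn_ge0 // mulr_ge0 ?(ltW ga0) //.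
  by case/andP: xI.
Qed.

Lemma sqrt_ge_min (v k : R) : 0 < k -> k <= 1 -> k <= v -> k <= Num.sqrt v.
Proof.
move=> k0 k1 kv; have v0 : 0 <= v by lra.
rewrite -(ger0_norm (ltW k0)) -sqrtr_sqr ler_wsqrtr // expr2.
by apply: le_trans kv; rewrite ler_piMr // ltW.
Qed.

Lemma sqrt_le_1D (v : R) : 0 <= v -> Num.sqrt v <= 1 + v.
Proof.
move=> v0; have v1 : 0 <= 1 + v by lra.
rewrite -(ger0_norm v1) -sqrtr_sqr ler_wsqrtr //.
have := sqr_ge0 v; rewrite !expr2; lra.
Qed.

(** Bounds for a21 / a11, for the squared rates and for all coefficients of the layer
    equations, and a lower bound for the rates. *)
Definition slopeB (Ca al : R) := Ca / al.
Definition rateB (Ca al : R) := 2 * Ca ^+ 2 / al.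
Definition coefB (Ca al : R) := 4 * (1 + rateB Ca al) ^+ 2 * slopeB Ca al * Ca.
Definition rate_min (Ca al : R) := al / (2 * Ca).

Lemma layer_constants (Ca al : R) : 1 <= Ca -> 0 < al -> al <= 1 ->
  let Q := slopeB Ca al in let V := rateB Ca al in let K := coefB Ca al in let k0 := rate_min Ca al in
  [/\ 1 <= Q, Ca <= V, 1 <= K & 4 * V * Q <= K] /\
  [/\ 4 * (1 + V) * Q <= K, 4 * (Q * Ca) <= K & 4 * (1 + V) <= K] /\
  [/\ 0 < k0, k0 <= 1, k0 <= al & al = k0 * (2 * Ca)].
Proof.
move=> Ca1 al0 al1 Q V K k0.
have Ca0 : 0 < Ca by lra.
have Q1 : 1 <= Q by rewrite /Q /slopeB ler_pdivlMr //; lra.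
have Ca2 : Ca <= Ca ^+ 2 by rewrite expr2 ler_peMr // ltW.
have Cal : Ca * al <= Ca by rewrite ler_piMr // ltW.
have V1 : Ca <= V by rewrite /V /rateB ler_pdivlMr //; lra.
have KE : K = 4 * (1 + V) ^+ 2 * Q * Ca by [].
have k0E : al = k0 * (2 * Ca) by rewrite /k0 /rate_min; field; rewrite gt_eqF.
have k00 : 0 < k0 by rewrite divr_gt0 // mulr_gt0.
clearbody Q V K k0.
have VQ : 1 + V <= (1 + V) ^+ 2 by rewrite expr2 ler_peMr; lra.
have VV : V <= (1 + V) ^+ 2 by lra.
have QC : Q <= Q * Ca by rewrite ler_peMr; lra.
have K3 : 4 * (1 + V) * Q <= K.
  have h : (1 + V) * Q <= (1 + V) ^+ 2 * (Q * Ca) by apply: ler_pM; lra.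
  by rewrite KE; lra.
have K2 : 4 * V * Q <= K by lra.
have K4 : 4 * (Q * Ca) <= K.
  have h : 1 * (Q * Ca) <= (1 + V) ^+ 2 * (Q * Ca) by apply: ler_wpM2r; lra.
  by rewrite KE; lra.
have K5 : 4 * (1 + V) <= K.
  have h : (1 + V) * 1 <= (1 + V) * Q by apply: ler_wpM2l; lra.
  lra.
have k0Ca : k0 * 1 <= k0 * Ca by apply: ler_wpM2l; lra.
by do !split => //; lra.
Qed.

Lemma sqrt_rate (Ca al v : R) : 1 <= Ca -> 0 < al -> al <= 1 ->
  rate_min Ca al <= v -> v <= rateB Ca al ->
  [/\ Num.sqrt v ^+ 2 = v, rate_min Ca al <= Num.sqrt v, Num.sqrt v <= 1 + rateB Ca al & Num.sqrt v <= coefB Ca al].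
Proof.
move=> Ca1 al0 al1 hv hV.
have [[_ _ _ _] [[_ _ h] [k00 k01 _ _]]] := layer_constants Ca1 al0 al1.
have v0 : 0 <= v by lra.
have h2 := sqrt_le_1D v0.
split; [by rewrite sqr_sqrtr|exact: sqrt_ge_min|lra|lra].
Qed.

Lemma slow_coefficients (Ca al k q s2 : R) : 1 <= Ca -> 0 < al -> al <= 1 ->
  0 < k -> k <= 1 + rateB Ca al -> k ^+ 2 <= rateB Ca al -> `|q| <= slopeB Ca al -> 0 <= s2 -> s2 <= 1 ->
  [/\ `|q| <= coefB Ca al, `|- (2 * k) * q| <= coefB Ca al & `|q * k ^+ 2| <= coefB Ca al] /\
  [/\ `|- s2| <= coefB Ca al, `|2 * k * s2| <= coefB Ca al, `|- k ^+ 2| <= coefB Ca al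
    & 2 * Ca + `|- q| * (2 * Ca) <= coefB Ca al].
Proof.
move=> Ca1 al0 al1 k0 kV k2 qQ s20 s21.
have [[Q1 V1 K1 K2] [[K3 K4 K5] _]] := layer_constants Ca1 al0 al1.
have k20 : 0 <= k ^+ 2 by exact: sqr_ge0.
rewrite !normrN (ger0_norm s20) (ger0_norm k20).
set Q := slopeB Ca al in Q1 K2 K3 K4 qQ; set V := rateB Ca al in V1 K2 K3 K5 kV k2.
set K := coefB Ca al in K1 K2 K3 K4 K5 *; clearbody Q V K.
have q0 := normr_ge0 q.
have h1 : 2 * k * `|q| <= 2 * (1 + V) * Q by apply: ler_pM => //; lra.
have h2 : `|q| * k ^+ 2 <= Q * V by apply: ler_pM.
have h3 : 2 * k * s2 <= 2 * (1 + V) * 1 by apply: ler_pM => //; lra.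
have h4 : `|q| * Ca <= Q * Ca by apply: ler_wpM2r; lra.
have h5 : 1 * Q <= (1 + V) * Q by apply: ler_wpM2r; lra.
have h6 : Ca <= Q * Ca by rewrite ler_peMl; lra.
have h7 : 0 <= V * Q by apply: mulr_ge0; lra.
split; split.
- lra.
- by rewrite normrM normrN (ger0_norm (x := 2 * k)); lra.
- by rewrite normrM (ger0_norm k20); lra.
- lra.
- by rewrite ger0_norm; [lra|apply: mulr_ge0; lra].
- lra.
- lra.
Qed.

(** The rate exceeds 3 be, so the exponential factor absorbs the growth of the
    error. *)
Lemma layer_decay (be k nu x S C : R) : 0 <= C -> 0 < be -> 6 * be <= k -> 0 < nu -> 0 <= x ->
  `|S| <= C * expR (3 * be * (x / nu)) -> `|expR (- (k * (x / nu))) * S| <= C.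
Proof.
move=> C0 be0 kk nu0 x0 hS; rewrite normrM (ger0_norm (expR_ge0 _)).
apply: le_trans (ler_wpM2l (expR_ge0 _) hS) _.
rewrite mulrCA -expRD ler_piMr // expR_le1.
have t0 : 0 <= x / nu by rewrite divr_ge0 // ltW.
have : 0 <= (k - 3 * be) * (x / nu) by rewrite mulr_ge0 //; lra.
lra.
Qed.

(** In the slow layer z = e^{-ks t} (rs, ps), t = x / mu, the first equation is
    singularly perturbed and determines rs from ps; subtracting q = a21 / a11 times
    it from the second makes the zero order coefficient of ps equal to
    det / a11 - ks^2 = 0 at x = 0.  In the fast layer z = e^{-kf t} (pf, s2 rf),
    t = x / eps, the first equation has zero order coefficient a11 - kf^2 = 0 at
    x = 0; after division by s2 the second determines rf through - kf^2 rf. *)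
Lemma end_layers (Ca ga al : R) : 1 <= Ca -> 0 < ga -> 0 < al -> al <= 1 ->
  exists be k0 K s0 tau0 M Cr : R, [/\ 0 < be, 6 * be <= k0, 0 < s0 & 0 < tau0] /\
   [/\ 0 < M, 0 < Cr & 0 < K] /\
  forall (A : 'I_2 -> 'I_2 -> R -> R) (TA : 'I_2 -> 'I_2 -> nat -> R),
   (forall i j, taylor_at0 Ca ga (A i j) (TA i j)) -> al <= TA 0 0 0%N ->
   al <= TA 0 0 0%N * TA 1 1 0%N - TA 0 1 0%N * TA 1 0 0%N ->
  forall (D : nat) (eps mu : R), 0 < eps -> eps <= mu -> (eps / mu) ^+ 2 <= s0 -> D.+1%:R * mu <= tau0 ->
  exists (ks kf : R) (zs zf : 'I_2 -> nat -> R),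
   [/\ k0 <= ks, ks <= K, k0 <= kf & kf <= K] /\
   [/\ forall i l, (D < l)%N -> zs i l = 0, forall i l, (D < l)%N -> zf i l = 0,
     forall i l, `|zs i l| <= M * expw be l, forall i l, `|zf i l| <= M * expw be l &
     forall l, `|zf 1 l| <= M * (eps / mu) ^+ 2 * expw be l] /\
   [/\ zs 1 0%N = 1, zf 0 0%N = 1,
     forall x i, 0 <= x <= 1 ->
       `|A i 0 x * layer D (zs 0) ks mu x + A i 1 x * layer D (zs 1) ks mu x
        - diagc eps mu i * (mu ^- 2 * layer D (layer_dcoef ks (layer_dcoef ks (zs i))) ks mu x)| <= Cr * 2^-1 ^+ D &
     forall x i, 0 <= x <= 1 ->
       `|A i 0 x * layer D (zf 0) kf eps x + A i 1 x * layer D (zf 1) kf eps x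
        - diagc eps mu i * (eps ^- 2 * layer D (layer_dcoef kf (layer_dcoef kf (zf i))) kf eps x)| <= Cr * 2^-1 ^+ D].
Proof.
move=> Ca1 ga0 al0 al1.
have [[Q1 V1 K1 KVQ] [[K3 K4 K5] [k00 k01 k0al k0E]]] := layer_constants Ca1 al0 al1.
set Q := slopeB Ca al in Q1 KVQ K3 K4; set V := rateB Ca al in V1 KVQ K3 K5.
set K := coefB Ca al in K1 KVQ K3 K4 K5; set k0 := rate_min Ca al in k00 k01 k0al k0E.
have Ca0 : 0 < Ca by lra.
have CK : 2 * Ca <= K by have : 1 * Ca <= Q * Ca := (ler_wpM2r (ltW Ca0) Q1); lra.
have CK1 : Ca <= K by lra.
have V0 : 0 < V by lra.
have Q0 : 0 < Q by lra.
have K0 : 0 < K by lra.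
have [be [s0 [tau0 [La [Cr [[be0 bek s00] [[s01 tau00 La1 Cr0] main]]]]]]] := layer_functions K1 k00 k01 ga0.
have Cr1 : 0 < (1 + Q) * Cr by apply: mulr_gt0 => //; rewrite addr_gt0.
have La0 : 0 < La := lt_le_trans ltr01 La1.
exists be, k0, K, s0, tau0, (2 * La), ((1 + Q) * Cr).
split; first by split.
split; first by split => //; exact: mulr_gt0.
move=> A TA tA a11 adet D eps mu eps0 epsmu hs0 hD.
have mu0 : 0 < mu := lt_le_trans eps0 epsmu.
pose s2 := (eps / mu) ^+ 2; rewrite -/s2 in hs0 *.
have s20 : 0 <= s2 by exact: sqr_ge0.
have s21 : s2 <= 1 := le_trans hs0 s01.
have TAb i j : `|TA i j 0%N| <= Ca by have [h _] := tA i j; have := h 0%N; rewrite expr0 mulr1.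
set a := TA 0 0 0%N in a11 adet *; set b := TA 0 1 0%N in adet *.
set c := TA 1 0 0%N in adet *; set d := TA 1 1 0%N in adet *.
have ha : `|a| <= Ca := TAb 0 0; have hb : `|b| <= Ca := TAb 0 1.
have hc : `|c| <= Ca := TAb 1 0; have hd : `|d| <= Ca := TAb 1 1.
have a0 : 0 < a := lt_le_trans al0 a11.
have aN : `|a| = a := gtr0_norm a0.
have aC : a <= Ca by rewrite -aN.
have detC : a * d - b * c <= 2 * Ca ^+ 2.
  apply: le_trans (ler_norm _) _; apply: le_trans (ler_normB _ _) _; rewrite !normrM.
  have -> : 2 * Ca ^+ 2 = Ca * Ca + Ca * Ca by ring.
  by apply: lerD; apply: ler_pM.
pose F (i j : 'I_2) x := A i j x - TA i j 0%N.
have tF i j : taylor_at0 K ga (F i j) (drop0 (TA i j)).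
  by apply: (taylor_at0W (K := 2 * Ca)) => //; exact: taylor_at0_drop0.
have tF2 i j : taylor_at0 (2 * Ca) ga (F i j) (drop0 (TA i j)) by exact: taylor_at0_drop0.
have [kf2 kf0 kfV kfK] := sqrt_rate Ca1 al0 al1 (le_trans k0al a11) (le_trans aC V1).
set kf := Num.sqrt a in kf2 kf0 kfV kfK.
have kfp : 0 < kf := lt_le_trans k00 kf0.
pose lam := (a * d - b * c) / a.
have lamV : lam <= V.
  by rewrite /lam /V; apply: ler_pM => //; [exact: le_trans (ltW al0) adet|rewrite invr_ge0 ltW|rewrite lef_pV2 ?posrE].
have lamk : k0 <= lam.
  rewrite /lam ler_pdivlMr //; apply: le_trans adet; rewrite [leRHS]k0E.
  by apply: ler_wpM2l; [exact: ltW|apply: le_trans aC _; rewrite ler_peMl ?ler1n // ltW].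
have [ks2 ks0 ksV ksK] := sqrt_rate Ca1 al0 al1 lamk lamV.
set ks := Num.sqrt lam in ks2 ks0 ksV ksK.
have ksp : 0 < ks := lt_le_trans k00 ks0.
pose q := c / a.
have qQ : `|q| <= Q.
  by rewrite normrM normfV aN /Q /slopeB; apply: ler_pM => //; rewrite ?invr_ge0 ?lef_pV2 ?posrE // ltW.
have drop00 (u : nat -> R) : drop0 u 0%N = 0 by [].
have ks2V : ks ^+ 2 <= V by rewrite ks2.
have kf2V : kf ^+ 2 <= V by rewrite kf2 (le_trans aC).
have [[cs1 cs2 cs3] [cs4 cs5 cs6 cs7]] := slow_coefficients Ca1 al0 al1 ksp ksV ks2V qQ s20 s21.
have q00 : `|0 : R| <= slopeB Ca al by rewrite normr0 ltW.
have [_ [_ cf5 _ _]] := slow_coefficients Ca1 al0 al1 kfp kfV kf2V q00 ler01 (lexx 1).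
have n1K : `|- 1 : R| <= K by rewrite normrN1.
have n0K : `|0 : R| <= K by rewrite normr0 ltW.
have aK : `|- a| <= K by rewrite normrN (le_trans ha).
have ak : k0 <= `|- a| by rewrite normrN aN (le_trans k0al).
have aK' : `|a| <= K by exact: le_trans ha CK1.
have ak' : k0 <= `|a| by rewrite aN (le_trans k0al).
have bK : `|b| <= K by exact: le_trans hb CK1.
have cK : `|c| <= K by exact: le_trans hc CK1.
have dK : `|d| <= K by exact: le_trans hd CK1.
have hDe : D.+1%:R * eps <= tau0 by apply: le_trans hD; rewrite ler_wpM2l.
have tq i j k l : taylor_at0 K ga (fun x => F i j x + (- q) * F k l x) (fun m => drop0 (TA i j) m + (- q) * drop0 (TA k l) m).
  by apply: (taylor_at0W ga0 cs7); apply: taylor_at0D; [|apply: taylor_at0Z].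
have ts i j : taylor_at0 K ga (fun x => s2 * F i j x) (fun m => s2 * drop0 (TA i j) m).
  have hq : `|s2| * K <= K by rewrite (ger0_norm s20) ler_piMl // ltW.
  by apply: (taylor_at0W ga0 hq); apply: taylor_at0Z.
have [ps [rs [[ps0 hps hrs psD rsD] hslow]]] := @main D mu ks s2 a b q (- (2 * ks) * q) (q * ks ^+ 2) (- s2) (2 * ks * s2) (- ks ^+ 2)
   (fun x => F 1 1 x + (- q) * F 0 1 x) (fun x => F 1 0 x + (- q) * F 0 0 x) (F 0 1) (F 0 0)
   (fun m => drop0 (TA 1 1) m + (- q) * drop0 (TA 0 1) m) (fun m => drop0 (TA 1 0) m + (- q) * drop0 (TA 0 0) m)
   (drop0 (TA 0 1)) (drop0 (TA 0 0)) mu0 hD ks0 ksK ak' aK' s20 hs0 (And3 cs1 cs2 cs3) (And4 cs4 cs5 cs6 bK)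
   (ltac:(by rewrite !drop00 mulr0 addr0)) (And4 (tq 1 1 0 1) (tq 1 0 0 0) (tF 0 1) (tF 0 0)).
rewrite mulr1 in cf5.
have [pf [rf [[pf0 hpf hrf pfD rfD] hfast]]] := @main D eps kf s2 (- a) c 0 0 b (- 1) (2 * kf) d
   (F 0 0) (fun x => s2 * F 0 1 x) (F 1 0) (fun x => s2 * F 1 1 x)
   (drop0 (TA 0 0)) (fun m => s2 * drop0 (TA 0 1) m) (drop0 (TA 1 0)) (fun m => s2 * drop0 (TA 1 1) m)
   eps0 hDe kf0 kfK ak aK s20 hs0 (And3 n0K n0K bK) (And4 n1K cf5 dK cK)
   (ltac:(by rewrite !drop00 mulr0)) (And4 (tF 0 0) (ts 0 1) (tF 1 0) (ts 1 1)).
clear main.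
exists ks, kf, (fun i => if i == 0 then rs else ps), (fun i => if i == 0 then pf else fun l => s2 * rf l).
split; first by split.
have w0 l : 0 <= expw be l by apply: expw_ge0; exact: ltW.
have ups (u : nat -> R) l : `|u l| <= 2 * expw be l -> `|u l| <= 2 * La * expw be l.
  by move=> h; apply: le_trans h _; rewrite ler_wpM2r // ler_peMr.
split.
  split.
  - by move=> i l Dl; case: ifP => _; [exact: rsD|exact: psD].
  - by move=> i l Dl; case: ifP => _; [exact: pfD|rewrite rfD // mulr0].
  - by move=> i l; case: ifP => _; [exact: hrs|exact: ups].
  - move=> i l; case: ifP => _; first exact: ups.
    rewrite normrM (ger0_norm s20); apply: le_trans (hrf l); rewrite ler_piMl //.
  - move=> l /=; rewrite normrM (ger0_norm s20).
    have -> : 2 * La * s2 * expw be l = s2 * (2 * La * expw be l) by ring.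
    by rewrite ler_wpM2l.
have q0 : 0 <= 2^-1 ^+ D :> R by rewrite exprn_ge0 // invr_ge0.
have CrD : 0 <= Cr * 2^-1 ^+ D by rewrite mulr_ge0 // ltW.
have bks := le_trans bek ks0; have bkf := le_trans bek kf0.
have CrQ : Cr * 2^-1 ^+ D <= (1 + Q) * Cr * 2^-1 ^+ D.
  by rewrite -mulrA ler_peMl // lerDl ltW.
have mun : mu != 0 by rewrite gt_eqF.
have epsn : eps != 0 by rewrite gt_eqF.
split => //.
- move=> x i /andP[x0 x1].
  have t0 : 0 <= x / mu by rewrite divr_ge0 // ltW.
  have mx : mu * (x / mu) = x by field.
  have [hs hr] := hslow (x / mu) t0 (eq_ind_r (fun z => z <= 1) x1 mx).
  rewrite mx in hs hr.
  have hs' := layer_decay CrD be0 bks mu0 x0 hs.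
  have hr' := layer_decay CrD be0 bks mu0 x0 hr.
  set ex := expR _ in hs' hr'.
  have es : eps ^+ 2 * mu ^- 2 = s2 by rewrite /s2; field.
  have E0 : A 0 0 x * layer D rs ks mu x + A 0 1 x * layer D ps ks mu x
     - eps ^+ 2 * (mu ^- 2 * layer D (layer_dcoef ks (layer_dcoef ks rs)) ks mu x) = ex * (a * pol D rs (x / mu) + b * pol D ps (x / mu) +
         (- s2) * pol D (dcoef (dcoef rs)) (x / mu) + 2 * ks * s2 * pol D (dcoef rs) (x / mu) + s2 * (- ks ^+ 2) * pol D rs (x / mu) + F 0 1 x * pol D ps (x / mu) + F 0 0 x * pol D rs (x / mu)).
    by rewrite (mulrA (eps ^+ 2)) es /layer -/ex pol_layer_dcoef2 /F -/a -/b; ring.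
  have E1 : A 1 0 x * layer D rs ks mu x + A 1 1 x * layer D ps ks mu x
     - mu ^+ 2 * (mu ^- 2 * layer D (layer_dcoef ks (layer_dcoef ks ps)) ks mu x) =
     ex * (- pol D (dcoef (dcoef ps)) (x / mu) + 2 * ks * pol D (dcoef ps) (x / mu) + s2 * (q * pol D (dcoef (dcoef rs)) (x / mu) + - (2 * ks) * q * pol D (dcoef rs) (x / mu) + q * ks ^+ 2 * pol D rs (x / mu)) + (F 1 1 x + - q * F 0 1 x) * pol D ps (x / mu) + (F 1 0 x + - q * F 0 0 x) * pol D rs (x / mu))
     + q * (ex * (a * pol D rs (x / mu) + b * pol D ps (x / mu) +
         (- s2) * pol D (dcoef (dcoef rs)) (x / mu) + 2 * ks * s2 * pol D (dcoef rs) (x / mu) + s2 * (- ks ^+ 2) * pol D rs (x / mu) + F 0 1 x * pol D ps (x / mu) + F 0 0 x * pol D rs (x / mu))).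
    have qa : q * a = c by rewrite /q divfK // gt_eqF.
    have kd : ks ^+ 2 = d - q * b by rewrite ks2 /lam /q; field; rewrite gt_eqF.
    rewrite (mulrA (mu ^+ 2)) divff ?expf_neq0 // mul1r /layer -/ex pol_layer_dcoef2 /F -/a -/b -/c -/d -qa kd.
    ring.
  move: i; apply: ord2P; rewrite /diagc /=.
    by rewrite E0; apply: le_trans hr' CrQ.
  rewrite E1; apply: le_trans (ler_normD _ _) _; rewrite (normrM q).
  have -> : (1 + Q) * Cr * 2^-1 ^+ D = Cr * 2^-1 ^+ D + Q * (Cr * 2^-1 ^+ D) by ring.
  by apply: lerD => //; apply: ler_pM.
- move=> x i /andP[x0 x1].
  have t0 : 0 <= x / eps by rewrite divr_ge0 // ltW.
  have mx : eps * (x / eps) = x by field.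
  have [hs hr] := hfast (x / eps) t0 (eq_ind_r (fun z => z <= 1) x1 mx).
  rewrite mx in hs hr.
  have hs' := layer_decay CrD be0 bkf eps0 x0 hs.
  have hr' := layer_decay CrD be0 bkf eps0 x0 hr.
  set ex := expR _ in hs' hr'.
  have es : mu ^+ 2 * eps ^- 2 * s2 = 1 by rewrite /s2; field; rewrite mun epsn.
  have laZ u : layer D (fun l => s2 * u l) kf eps x = s2 * layer D u kf eps x by rewrite /layer polZ; ring.
  have opZ u : layer_dcoef kf (layer_dcoef kf (fun l => s2 * u l)) = fun l => s2 * layer_dcoef kf (layer_dcoef kf u) l.
    by apply/funext => l; rewrite !layer_dcoef2 /dcoef; ring.
  have E0 : A 0 0 x * layer D pf kf eps x + A 0 1 x * layer D (fun l => s2 * rf l) kf eps x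
     - eps ^+ 2 * (eps ^- 2 * layer D (layer_dcoef kf (layer_dcoef kf pf)) kf eps x) =
     ex * (- pol D (dcoef (dcoef pf)) (x / eps) + 2 * kf * pol D (dcoef pf) (x / eps) + s2 * (0 * pol D (dcoef (dcoef rf)) (x / eps) + 0 * pol D (dcoef rf) (x / eps) + b * pol D rf (x / eps)) + F 0 0 x * pol D pf (x / eps) + s2 * F 0 1 x * pol D rf (x / eps)).
    rewrite laZ (mulrA (eps ^+ 2)) divff ?expf_neq0 // mul1r /layer -/ex pol_layer_dcoef2 kf2 /F -/a -/b; ring.
  have E1 : A 1 0 x * layer D pf kf eps x + A 1 1 x * layer D (fun l => s2 * rf l) kf eps x
     - mu ^+ 2 * (eps ^- 2 * layer D (layer_dcoef kf (layer_dcoef kf (fun l => s2 * rf l))) kf eps x) =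
     ex * (- a * pol D rf (x / eps) + c * pol D pf (x / eps) + (-1) * pol D (dcoef (dcoef rf)) (x / eps) + 2 * kf * pol D (dcoef rf) (x / eps) + s2 * d * pol D rf (x / eps) + F 1 0 x * pol D pf (x / eps) + s2 * F 1 1 x * pol D rf (x / eps)).
    rewrite opZ !laZ (mulrA (eps ^- 2)) (mulrA (mu ^+ 2)) (mulrA (mu ^+ 2)) es mul1r /layer -/ex pol_layer_dcoef2 kf2 /F -/c -/d; ring.
  move: i; apply: ord2P; rewrite /diagc /=.
    by rewrite E0; apply: le_trans hs' CrQ.
  by rewrite E1; apply: le_trans hr' CrQ.
Qed.
End EndLayers.

(** * Matching boundary values; passing to the classes of the theorem *)

Section Matching.
Context {R : realType}.
Implicit Types (a b p r : nat -> R) (f w : R -> R) (t x kap nu : R).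

Lemma layerZ D c a kap nu x : layer D (fun l => c * a l) kap nu x = c * layer D a kap nu x.
Proof. by rewrite /layer polZ; ring. Qed.

Lemma layer_dcoef2Z c kap a : layer_dcoef kap (layer_dcoef kap (fun l => c * a l)) = fun l => c * layer_dcoef kap (layer_dcoef kap a) l.
Proof. by apply/funext => l; rewrite !layer_dcoef2 /dcoef; ring. Qed.

Lemma layer0 D a kap nu : layer D a kap nu 0 = a 0%N.
Proof.
rewrite /layer mul0r mulr0 oppr0 expR0 mulr1 /pol big_ord_recl expr0 mulr1 big1 ?addr0 // => i _.
by rewrite exprS mul0r mulr0.
Qed.

(** The matrix with columns (z, 1) and (1, f) has determinant z f - 1, which stays
    away from 0. *)
Lemma solve_boundary (z f w0 w1 M Om : R) : `|z| <= M -> `|f| <= M -> `|z * f| <= 2^-1 ->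
  `|w0| <= Om -> `|w1| <= Om ->
  exists c1 c2, [/\ c1 * z + c2 = w0, c1 + c2 * f = w1,
    `|c1| <= (2 * (1 + M) + (1 + 2 * (1 + M) * M)) * Om & `|c2| <= (2 * (1 + M) + (1 + 2 * (1 + M) * M)) * Om].
Proof.
move=> hz hf hzf h0 h1.
have M0 : 0 <= M by apply: le_trans hz.
have Om0 : 0 <= Om by apply: le_trans h0.
pose g := 1 - z * f.
have g2 : 2^-1 <= g by have := ler_norm (z * f); rewrite /g; lra.
have g0 : 0 < g by lra.
pose c1 := (w1 - w0 * f) / g; pose c2 := w0 - c1 * z.
have b1 : `|c1| <= 2 * (1 + M) * Om.
  rewrite /c1 normrM normfV (gtr0_norm g0) ler_pdivrMr //.
  apply: le_trans (ler_normB _ _) _; rewrite normrM.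
  have e1 : `|w0| * `|f| <= Om * M by apply: ler_pM.
  have e2 : 2 * (1 + M) * Om * 2^-1 <= 2 * (1 + M) * Om * g by rewrite ler_wpM2l //; nonneg; lra.
  lra.
have b2 : `|c2| <= (1 + 2 * (1 + M) * M) * Om.
  rewrite /c2; apply: le_trans (ler_normB _ _) _; rewrite normrM.
  have e1 : `|c1| * `|z| <= 2 * (1 + M) * Om * M by apply: ler_pM.
  lra.
have p1 : 0 <= 2 * (1 + M) * Om by apply: le_trans b1.
have p2 : 0 <= (1 + 2 * (1 + M) * M) * Om by apply: le_trans b2.
exists c1, c2; split.
- by rewrite /c2; ring.
- rewrite /c2 /c1 /g; field; rewrite -/g gt_eqF //.
- by rewrite mulrDl; lra.
- by rewrite mulrDl; lra.
Qed.

(** The second component of the fast layer is O(s^2), so for s small the values of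
    the two layers at the endpoint are independent uniformly in eps and mu. *)
Lemma matched_layers (Ca ga al : R) : 1 <= Ca -> 0 < ga -> 0 < al -> al <= 1 ->
  exists be k0 K s0 tau0 M Cr : R, [/\ 0 < be, 6 * be <= k0, 0 < s0 & 0 < tau0] /\
   [/\ 0 < M, 0 < Cr & 0 < K] /\
  forall (A : 'I_2 -> 'I_2 -> R -> R) (TA : 'I_2 -> 'I_2 -> nat -> R),
   (forall i j, taylor_at0 Ca ga (A i j) (TA i j)) -> al <= TA 0 0 0%N ->
   al <= TA 0 0 0%N * TA 1 1 0%N - TA 0 1 0%N * TA 1 0 0%N ->
  forall (D : nat) (eps mu Om : R) (om : 'I_2 -> R), 0 < eps -> eps <= mu -> (eps / mu) ^+ 2 <= s0 -> D.+1%:R * mu <= tau0 ->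
   (forall i, `|om i| <= Om) ->
  exists (ks kf : R) (ys yf : 'I_2 -> nat -> R),
   [/\ k0 <= ks, ks <= K, k0 <= kf & kf <= K] /\
   [/\ forall i l, (D < l)%N -> ys i l = 0, forall i l, (D < l)%N -> yf i l = 0,
     forall i l, `|ys i l| <= M * Om * expw be l, forall i l, `|yf i l| <= M * Om * expw be l &
     forall l, `|yf 1 l| <= M * Om * (eps / mu) ^+ 2 * expw be l] /\
   (forall i, ys i 0%N + yf i 0%N = om i) /\
   forall x i, 0 <= x <= 1 ->
    `|A i 0 x * (layer D (ys 0) ks mu x + layer D (yf 0) kf eps x)
      + A i 1 x * (layer D (ys 1) ks mu x + layer D (yf 1) kf eps x)
      - diagc eps mu i * (mu ^- 2 * layer D (layer_dcoef ks (layer_dcoef ks (ys i))) ks mu x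
                          + eps ^- 2 * layer D (layer_dcoef kf (layer_dcoef kf (yf i))) kf eps x)|
     <= Cr * Om * 2^-1 ^+ D.
Proof.
move=> Ca1 ga0 al0 al1.
have [be [k0 [K [s0 [tau0 [M [Cr [[be0 bek s00 tau00] [[M0 Cr0 K0] main]]]]]]]]] := end_layers Ca1 ga0 al0 al1.
pose kk := 2 * (1 + M) + (1 + 2 * (1 + M) * M).
have M1 : 0 < 1 + M by rewrite addr_gt0.
have kk0 : 0 < kk by rewrite /kk !(addr_gt0, mulr_gt0).
have kkn := ltW kk0.
exists be, k0, K, (Num.min s0 (Num.min (2 * M ^+ 2)^-1 1)), tau0, (M * kk), (2 * kk * Cr).
split; first by split => //; rewrite !lt_min s00 invr_gt0 ltr01 andbT /= mulr_gt0 // exprn_gt0.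
split; first by split => //; rewrite !mulr_gt0.
move=> A TA tA a11 adet D eps mu Om om eps0 epsmu; rewrite !le_min => /andP[hs0 /andP[hs1 hs2]] hD hom.
have [ks [kf [zs [zf [hk [[zsD zfD zsb zfb zfb1] [zs1 zf0 rs rf]]]]]]] := main A TA tA a11 adet D eps mu eps0 epsmu hs0 hD.
clear main.
have s20 : 0 <= (eps / mu) ^+ 2 by exact: sqr_ge0.
set s2 := (eps / mu) ^+ 2 in hs0 hs1 hs2 zfb1 s20 *.
have w00 : expw be 0 = 1 by rewrite /expw expr0 fact0 divr1.
have hz : `|zs 0 0%N| <= M by have := zsb 0 0%N; rewrite w00 mulr1.
have hf : `|zf 1 0%N| <= M by have := zfb 1 0%N; rewrite w00 mulr1.
have hzf : `|zs 0 0%N * zf 1 0%N| <= 2^-1.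
  have h1 := zfb1 0%N; rewrite w00 mulr1 in h1.
  rewrite normrM; apply: le_trans (_ : M * (M * s2) <= _); first by apply: ler_pM.
  have -> : 2^-1 = M * (M * (2 * M ^+ 2)^-1) by field; rewrite gt_eqF.
  by do 2 (apply: ler_wpM2l; first exact: ltW).
have [c1 [c2 [e1 e2 b1 b2]]] := solve_boundary hz hf hzf (hom 0) (hom 1).
rewrite -/kk in b1 b2.
have w0 l : 0 <= expw be l by apply: expw_ge0; exact: ltW.
have Om0 : 0 <= Om by apply: le_trans (hom 0).
exists ks, kf, (fun i l => c1 * zs i l), (fun i l => c2 * zf i l).
split => //.
split.
  split.
  - by move=> i l Dl; rewrite zsD // mulr0.
  - by move=> i l Dl; rewrite zfD // mulr0.
  - move=> i l; rewrite normrM.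
    have -> : M * kk * Om * expw be l = kk * Om * (M * expw be l) by ring.
    exact: ler_pM.
  - move=> i l; rewrite normrM.
    have -> : M * kk * Om * expw be l = kk * Om * (M * expw be l) by ring.
    exact: ler_pM.
  - move=> l; rewrite normrM.
    have -> : M * kk * Om * s2 * expw be l = kk * Om * (M * s2 * expw be l) by ring.
    exact: ler_pM.
split; first by apply: ord2P; rewrite ?zs1 ?zf0 ?mulr1.
move=> x i xI; rewrite !layer_dcoef2Z !layerZ.
have q0 : 0 <= 2^-1 ^+ D :> R by rewrite exprn_ge0 // invr_ge0.
have h1 := ler_pM (normr_ge0 c1) (normr_ge0 _) b1 (rs x i xI).
have h2 := ler_pM (normr_ge0 c2) (normr_ge0 _) b2 (rf x i xI).
rewrite -!normrM in h1 h2.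
have -> : 2 * kk * Cr * Om * 2^-1 ^+ D = kk * Om * (Cr * 2^-1 ^+ D) + kk * Om * (Cr * 2^-1 ^+ D) by ring.
apply: le_trans (lerD h1 h2); apply: le_trans (ler_normD _ _); apply: le_of_eq; congr `|_|; ring.
Qed.

Lemma classA_of_tower C ga (F : nat -> R -> R) w : 0 <= C -> 0 <= ga -> tower F -> tbound C ga F ->
  (forall x, 0 <= x <= 1 -> w x = F 0%N x) -> classA 1 C ga w.
Proof.
move=> C0 ga0 tF bF wF; split; first exact: tower_smooth wF.
have inI x : unitI x -> 0 <= x <= 1 by case/unitIE/andP => h1 h2; rewrite !ltW.
move=> n; apply: normLoo_le.
  by rewrite mulr_ge0 ?mulr_ge0 ?exprn_ge0 // le_max ler0n.
move=> x Ix; rewrite (tower_derive1n n tF (fun y Iy => wF y (inI y Iy)) Ix).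
rewrite normrM normr_nat mulrC; apply: ler_pM => //; first exact: bF (inI x Ix).
apply: le_trans (fact_le_exp n) _; apply: lerXn2r; rewrite ?nnegrE ?le_max ?lexx ?ler0n //.
Qed.

Lemma classA_0 C ga : 0 <= C -> 0 <= ga -> classA 1 C ga (fun _ : R => 0).
Proof.
move=> C0 ga0; apply: (@classA_of_tower _ _ (fun _ _ => 0)) => // [n|n x _].
  by split; [exact: cont01_cst|move=> x _; rewrite mulr0; exact: der_cst].
by rewrite normr0 mulr_ge0 // exprn_ge0.
Qed.

Lemma classBL_0 nu C ga : 0 <= nu -> 0 <= C -> 0 <= ga -> classBL nu C ga (fun _ : R => 0).
Proof.
move=> nu0 C0 ga0; split.
  by apply: entire_eq (entireZ 0 (@entire_exp R 0)) => x; rewrite mul0r.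
move=> n x _; rewrite (@rtower_derive1n _ (fun _ _ => 0) (fun m y => der_cst 0 y)).
by rewrite normr0 !mulr_ge0 ?exprn_ge0 ?invr_ge0 ?exprn_ge0 ?expR_ge0.
Qed.

Lemma matrix_norm_le (m n : nat) (M : 'M[R]_(m.+1, n.+1)) eta : 0 <= eta ->
  (forall i j, `|M i j| <= eta) -> `|M| <= eta.
Proof.
move=> e0 h; rewrite /Num.norm /= mx_normrE; apply/bigmax_leP; split => // -[i j] _; exact: h.
Qed.

(** Both regimes of the theorem end here. *)
Lemma remainder_bounds (al Ca eta ep m : R) (A : R -> 'M[R]_2) (U : R -> 'cV[R]_2)
    (u1 u2 : 'I_2 -> R -> R) :
  0 < al -> 0 <= Ca -> 0 <= eta -> 0 < ep <= 1 -> 0 < m <= 1 ->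
  (forall x i j, unitI x -> `|A x i j| <= Ca) ->
  (forall (x : R) (xi : 'cV[R]_2), 0 <= x <= 1 ->
     al ^+ 2 * (xi^T *m xi) 0 0 <= (xi^T *m A x *m xi) 0 0) ->
  (forall i, C1on (component U i) (u1 i)) -> (forall i, C1on (u1 i) (u2 i)) ->
  (forall i, `|U 0 i 0| <= eta) -> (forall i, `|U 1 i 0| <= eta) ->
  (forall x i, unitI x -> `|(A x *m U x) i 0 - diagc ep m i * u2 i x| <= eta) ->
  [/\ classical_regular U,
    ((norm_bd U)%:E + normLoo_vec (opL ep m A U) <= (2 * eta)%:E)%E &
    (normE ep m al U <= (energy_cst al Ca * eta)%:E)%E].
Proof.
move=> al0 Ca0 eta0 hep hm hA hell h1 h2 b0 b1 hL; split; last exact: energy_bound h1 h2 b0 b1 hL.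
- move=> i; split; first by case: (h1 i).
  move=> x Ix; have [_ _ /(_ x Ix) d1] := h1 i; have [_ _ /(_ x Ix) d2] := h2 i.
  split; first by case: d1.
  have e y : unitI y -> u1 i y = (component U i)^`() y.
    by move=> Iy; symmetry; apply: der_derive1; have [_ _] := h1 i; apply.
  by case: (der_eqI e Ix d2).
- have d2 i x : unitI x -> derive1n 2 (component U i) x = u2 i x.
    move=> Ix; rewrite derive1nS derive1n1.
    have e y : unitI y -> u1 i y = (component U i)^`() y.
      by move=> Iy; symmetry; apply: der_derive1; have [_ _] := h1 i; apply.
    have [_ _ /(_ x Ix) d2] := h2 i; exact: der_derive1 (der_eqI e Ix d2).
  have -> : (2 * eta)%:E = (eta%:E + eta%:E)%E by rewrite -EFinD; congr EFin; ring.
  apply: leeD.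
    rewrite lee_fin /norm_bd ge_max; apply/andP; split; apply: matrix_norm_le => // i j; rewrite (ord1 j); [exact: b0|exact: b1].
  apply: normLoo_le => // x Ix; rewrite normr_id; apply: matrix_norm_le => // i j.
  rewrite (ord1 j) /opL mxE [X in `|X + _|]mxE diag_sqE mxE (d2 i x Ix) addrC.
  exact: hL.
Qed.
End Matching.

(** * The decomposition for small mu and small eps/mu *)

Section MainRegime.
Context {R : realType}.
Implicit Types (a b p r : nat -> R) (f w : R -> R) (t x kap nu : R).

Lemma pow_half_le (c mu : R) : 0 < c -> 0 < mu ->
  2^-1 ^+ Num.truncn (c / mu) <= 2 * expR (- (c * ln 2 / mu)).
Proof.
move=> c0 mu0; set N := Num.truncn _.
have cm : 0 <= c / mu by rewrite divr_ge0 // ltW.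
have /andP[_ hN] := truncn_itv cm; rewrite -/N in hN.
have ln20 : 0 < ln 2 :> R by rewrite ln_gt0 // ltr1n.
have h : expR (- (N.+1%:R * ln 2)) <= expR (- (c * ln 2 / mu)).
  rewrite ler_expR lerN2 mulrAC ler_wpM2r //; exact: ltW.
have e2 : expR (- (N.+1%:R * ln 2)) = 2^-1 ^+ N.+1 :> R.
  by rewrite -mulrN expRM_natl expRN lnK // posrE.
rewrite e2 exprS in h.
have : 2 * (2^-1 * 2^-1 ^+ N) <= 2 * expR (- (c * ln 2 / mu)) by apply: ler_wpM2l.
by rewrite mulrA divff ?mul1r.
Qed.

Lemma two_sided0 D a kap b kap' nu x :
  two_sided D a kap b kap' nu 0 x = layer D a kap nu x + layer D b kap' nu (1 - x).
Proof. by rewrite /two_sided /= !expr0 invr1 !mul1r. Qed.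

Lemma two_sided2 D a kap b kap' nu x : two_sided D a kap b kap' nu 2 x =
  nu ^- 2 * layer D (layer_dcoef kap (layer_dcoef kap a)) kap nu x + nu ^- 2 * layer D (layer_dcoef kap' (layer_dcoef kap' b)) kap' nu (1 - x).
Proof. by rewrite /two_sided /= sqrrN exprVn. Qed.

Lemma tbound_refl C ga (F : nat -> R -> R) : tbound C ga F -> tbound C ga (trefl F).
Proof.
move=> h n x /andP[x0 x1]; rewrite /trefl normrM normrX normrN1 expr1n mul1r; apply: h.
by apply/andP; split; lra.
Qed.

Lemma layer_far D a kap nu mu be k0 M : 0 < be -> 6 * be <= k0 -> k0 <= kap -> 0 < nu -> nu <= mu -> 0 <= M ->
  (forall l, `|a l| <= M * expw be l) -> `|layer D a kap nu 1| <= M * expR (- (k0 / 2 / mu)).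
Proof.
move=> be0 bek kk nu0 num M0 ha.
apply: le_trans (layer_bound D kap (ltW be0) nu0 ler01 M0 ha) _.
apply: ler_wpM2l => //; rewrite ler_expR lerN2 div1r.
apply: ler_pM; [lra|by rewrite invr_ge0; lra|lra|].
by rewrite lef_pV2 ?posrE //; lra.
Qed.

(** Layers at the right endpoint are layers at 0 of the reflected coefficients.
    At 0 the sum of W and the left layers vanishes exactly; the right layers
    contribute only their exponentially small tails. *)
Lemma main_regime (C ga al : R) (TA : 'I_2 -> 'I_2 -> nat -> R -> R) (TF : 'I_2 -> nat -> R -> R) :
  1 <= C -> 0 < ga -> 0 < al -> al <= 1 ->
  (forall i j, tower (TA i j)) -> (forall i, tower (TF i)) ->
  (forall i j, tbound C ga (TA i j)) -> (forall i, tbound C ga (TF i)) ->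
  (forall x, 0 <= x <= 1 -> al <= TA 0 0 0%N x) -> (forall x, 0 <= x <= 1 -> al <= tdet TA 0 x) ->
  exists CW gW CBL gBL k0 c0 s0 b Ce : R,
   [/\ 0 < CW, 0 < gW, 0 < CBL & 0 < gBL] /\ [/\ 0 < k0, 0 < c0, 0 < s0, 0 < b & 0 < Ce] /\
  forall eps mu : R, 0 < eps -> eps <= mu -> mu <= c0 -> (eps / mu) ^+ 2 <= s0 ->
  exists W Ut Uh : 'I_2 -> nat -> R -> R,
   [/\ forall i, tower (W i), forall i, tbound CW gW (W i),
     forall i n x, is_derive x 1 (Ut i n) (Ut i n.+1 x) &
     forall i n x, is_derive x 1 (Uh i n) (Uh i n.+1 x)] /\
   [/\ forall i, classBL (2 / k0 * mu) CBL gBL (Ut i 0%N),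
     forall i, classBL (2 / k0 * eps) CBL gBL (Uh i 0%N) &
     classBL (2 / k0 * eps) (CBL * (eps / mu) ^+ 2) gBL (Uh 1 0%N)] /\
   [/\ forall i, `|W i 0%N 0 + Ut i 0%N 0 + Uh i 0%N 0| <= Ce * expR (- (b / mu)),
     forall i, `|W i 0%N 1 + Ut i 0%N 1 + Uh i 0%N 1| <= Ce * expR (- (b / mu)) &
     forall x i, 0 <= x <= 1 ->
       `|TA i 0 0%N x * (W 0 0%N x + Ut 0 0%N x + Uh 0 0%N x)
         + TA i 1 0%N x * (W 1 0%N x + Ut 1 0%N x + Uh 1 0%N x)
         - diagc eps mu i * (2 * W i 2%N x + Ut i 2%N x + Uh i 2%N x) - TF i 0%N x|
       <= Ce * expR (- (b / mu))].
Proof.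
move=> C1 ga0 al0 al1 tA tF bA bF ha11 hdet.
have C0 : 0 < C by lra.
have x00 : 0 <= (0 : R) <= 1 by rewrite lexx ler01.
have x11 : 0 <= (1 : R) <= 1 by rewrite lexx ler01.
have tayL i j := tower_taylor_at0 (ltW C0) ga0 (tA i j) (bA i j).
have tayR i j := tower_taylor_at0 (ltW C0) ga0 (tower_refl (tA i j)) (tbound_refl (bA i j)).
have a11L := ha11 0 x00.
have adL : al <= TA 0 0 0%N 0 * TA 1 1 0%N 0 - TA 0 1 0%N 0 * TA 1 0 0%N 0 by rewrite -tdet0 hdet.
have reflE (F : nat -> R -> R) x : trefl F 0 x = F 0%N (1 - x) by rewrite /trefl expr0 mul1r.
have a11R : al <= trefl (TA 0 0) 0 0 by rewrite reflE subr0 ha11.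
have adR : al <= trefl (TA 0 0) 0 0 * trefl (TA 1 1) 0 0 - trefl (TA 0 1) 0 0 * trefl (TA 1 0) 0 0.
  by rewrite !reflE subr0 -tdet0 hdet.
have [CW [gW [kap [Cr1 [[CW0 gW0 kap0 Cr10] outer]]]]] := outer_expansion C0 ga0 al0 tA tF bA bF hdet.
have [be [k0 [K [s0 [tau0 [M [Cr2 [[be0 bek s00 tau00] [[M0 Cr20 K0] layers]]]]]]]]] := matched_layers C1 ga0 al0 al1.
pose c1 := Num.min kap tau0 / 2.
have c10 : 0 < c1 by rewrite divr_gt0 // lt_min kap0.
have ln20 : 0 < ln 2 :> R by rewrite ln_gt0 // ltr1n.
have k00 : 0 < k0 by lra.
(* the two sources of smallness: truncation at order N, and the tails of the
   layers at the opposite endpoint *)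
pose b := Num.min (c1 * ln 2) (k0 / 2).
have b0 : 0 < b by rewrite lt_min mulr_gt0 // divr_gt0.
pose MW := M * CW; have MW0 : 0 < MW by rewrite mulr_gt0.
pose Ce := 2 * (Cr1 + 2 * (Cr2 * CW)) + 2 * MW.
have Cr2W : 0 < Cr2 * CW by rewrite mulr_gt0.
have CrW : 0 < Cr1 + 2 * (Cr2 * CW) by apply: addr_gt0 => //; exact: mulr_gt0.
have CrWn := ltW CrW.
have Ce0 : 0 < Ce by rewrite /Ce; clear - CrW MW0; lra.
exists CW, gW, (2 * MW), (2 / k0 * (be + K)), k0, c1, s0, b, Ce.
split.
  split => //; first by rewrite mulr_gt0.
  by rewrite mulr_gt0 ?divr_gt0 // addr_gt0.
split; first by split.
move=> eps mu eps0 epsmu muc hs.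
have mu0 : 0 < mu by exact: lt_le_trans eps0 epsmu.
pose N := Num.truncn (c1 / mu).
have hN : N.+1%:R * mu <= Num.min kap tau0.
  have cm : 0 <= c1 / mu by rewrite divr_ge0 // ltW.
  have /andP[hN _] := truncn_itv cm; rewrite -/N in hN.
  have hN2 : N%:R * mu <= c1 by rewrite -ler_pdivlMr.
  by rewrite -natr1 mulrDl mul1r; rewrite /c1 in hN2 muc; clear - hN2 muc; lra.
have hN1 : N.+1%:R * mu <= kap by apply: le_trans hN _; rewrite ge_min lexx.
have hN2 : N.+1%:R * mu <= tau0 by apply: le_trans hN _; rewrite ge_min lexx orbT.
have hd i : `|diagc eps mu i| <= mu ^+ 2.
  rewrite /diagc; case: ifP => _; rewrite ger0_norm ?sqr_ge0 //.
  by rewrite lerXn2r // nnegrE ltW.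
have [W [tW bW rW]] := outer (diagc eps mu) mu N mu0 hd hN1.
clear outer.
have W0 i x : 0 <= x <= 1 -> `|- W i 0%N x| <= CW.
  by move=> xI; rewrite normrN; have := bW i 0%N x xI; rewrite expr0 mulr1.
have [ksL [kfL [ysL [yfL [[L1 L2 L3 L4] [[L5 L6 L7 L8 L9] [L10 L11]]]]]]] := layers _ _ tayL a11L adL N eps mu CW (fun i => - W i 0%N 0) eps0 epsmu hs hN2 (fun i => W0 i 0 x00).
have [ksR [kfR [ysR [yfR [[R1 R2 R3 R4] [[R5 R6 R7 R8 R9] [R10 R11]]]]]]] := layers _ _ tayR a11R adR N eps mu CW (fun i => - W i 0%N 1) eps0 epsmu hs hN2 (fun i => W0 i 1 x11).
clear layers.
rewrite -/MW in L7 L8 L9 R7 R8 R9.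
have MWn := ltW MW0.
have s20 : 0 <= (eps / mu) ^+ 2 by exact: sqr_ge0.
have e1 : 2^-1 ^+ N <= 2 * expR (- (b / mu)).
  apply: le_trans (pow_half_le c10 mu0) _; apply: ler_wpM2l => //.
  by rewrite ler_expR lerN2 ler_wpM2r ?invr_ge0 ?(ltW mu0) // ge_min lexx.
have e2 : expR (- (k0 / 2 / mu)) <= expR (- (b / mu)).
  by rewrite ler_expR lerN2 ler_wpM2r ?invr_ge0 ?(ltW mu0) // ge_min lexx orbT.
have eb : 0 <= expR (- (b / mu)) by exact: expR_ge0.
exists W, (fun i => two_sided N (ysL i) ksL (ysR i) ksR mu), (fun i => two_sided N (yfL i) kfL (yfR i) kfR eps).
split.
  split => // i n x; apply: two_sided_der; by [exact: L5|exact: R5|exact: L6|exact: R6].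
split.
  split=> [i|i|].
  - by apply: (two_sided_BL be0 bek L1 L2 R1 R2 mu0 MWn); [exact: L5|exact: R5|exact: L7|exact: R7].
  - by apply: (two_sided_BL be0 bek L3 L4 R3 R4 eps0 MWn); [exact: L6|exact: R6|exact: L8|exact: R8].
  - have -> : 2 * MW * (eps / mu) ^+ 2 = 2 * (MW * (eps / mu) ^+ 2) by ring.
    apply: (two_sided_BL be0 bek L3 L4 R3 R4 eps0 (mulr_ge0 MWn s20)); [exact: L6|exact: R6|exact: L9|exact: R9].
have far (P Q : R) : `|P| <= MW * expR (- (k0 / 2 / mu)) -> `|Q| <= MW * expR (- (k0 / 2 / mu)) ->
   `|P + Q| <= Ce * expR (- (b / mu)).
  move=> hP hQ; apply: le_trans (ler_normD _ _) _.
  have h1 := ler_wpM2l MWn e2.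
  have h2 : 0 <= 2 * (Cr1 + 2 * (Cr2 * CW)) * expR (- (b / mu)) by apply: mulr_ge0 => //; exact: mulr_ge0.
  by rewrite /Ce mulrDl; clear - hP hQ h1 h2; lra.
split.
- move=> i; rewrite !two_sided0 !layer0 subr0.
  have -> : W i 0%N 0 + (ysL i 0%N + layer N (ysR i) ksR mu 1) + (yfL i 0%N + layer N (yfR i) kfR eps 1) =
     W i 0%N 0 + (ysL i 0%N + yfL i 0%N) + (layer N (ysR i) ksR mu 1 + layer N (yfR i) kfR eps 1) by ring.
  rewrite L10 subrr add0r; apply: far.
    exact: layer_far be0 bek R1 mu0 (lexx mu) MWn (R7 i).
  exact: layer_far be0 bek R3 eps0 epsmu MWn (R8 i).
- move=> i; rewrite !two_sided0 subrr !layer0.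
  have -> : W i 0%N 1 + (layer N (ysL i) ksL mu 1 + ysR i 0%N) + (layer N (yfL i) kfL eps 1 + yfR i 0%N) =
     W i 0%N 1 + (ysR i 0%N + yfR i 0%N) + (layer N (ysL i) ksL mu 1 + layer N (yfL i) kfL eps 1) by ring.
  rewrite R10 subrr add0r; apply: far.
    exact: layer_far be0 bek L1 mu0 (lexx mu) MWn (L7 i).
  exact: layer_far be0 bek L3 eps0 epsmu MWn (L8 i).
- move=> x i xI; rewrite !two_sided0 !two_sided2.
  have xI' : 0 <= 1 - x <= 1 by case/andP: xI => x0 x1; rewrite subr_ge0 x1 gerBl x0.
  have h1 := rW x i xI.
  have h2 := L11 x i xI.
  have h3 := R11 (1 - x) i xI'; rewrite !reflE subKr in h3.
  apply: le_trans (_ : Cr1 * 2^-1 ^+ N + Cr2 * CW * 2^-1 ^+ N + Cr2 * CW * 2^-1 ^+ N <= _).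
    apply: le_trans (lerD (lerD h1 h2) h3).
    apply: le_trans (lerD (ler_normD _ _) (lexx _)); apply: le_trans (ler_normD _ _).
    by apply: le_of_eq; congr `|_|; ring.
  have q1 := ler_wpM2l (ltW Cr10) e1; have q2 := ler_wpM2l (ltW Cr2W) e1.
  have q3 : 0 <= 2 * MW * expR (- (b / mu)) by apply: mulr_ge0 => //; exact: mulr_ge0.
  by rewrite /Ce mulrDl; clear - q1 q2 q3; lra.
Qed.
End MainRegime.

(** * The theorem *)

Section Final.
Context {R : realType}.

Lemma tbound_widen C C' ga ga' (F : nat -> R -> R) : 0 <= C -> C <= C' -> 0 <= ga -> ga <= ga' ->
  tbound C ga F -> tbound C' ga' F.
Proof. by move=> h1 h2 h3 h4 h; apply/tbound_rising0; apply: tbound_rising_widen h2 h3 h4 _ => //; apply/tbound_rising0. Qed.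

(** Test with (a22, - a21), which A maps to (det A, 0). *)
Lemma ellipticity (al : R) (A : 'M[R]_2) : 0 < al ->
  (forall xi : 'cV[R]_2, al ^+ 2 * (xi^T *m xi) 0 0 <= (xi^T *m A *m xi) 0 0) ->
  al ^+ 2 <= A 0 0 /\ al ^+ 4 <= A 0 0 * A 1 1 - A 0 1 * A 1 0.
Proof.
move=> al0 h.
have h2 x y : al ^+ 2 * (x ^+ 2 + y ^+ 2) <= x * (A 0 0 * x + A 0 1 * y) + y * (A 1 0 * x + A 1 1 * y).
  have := h (\col_i (if i == 0 then x else y)).
  by rewrite -mulmxA !row_mul2 !mulmx2E !mxE /= !expr2.
have a11 := h2 1 0; have a22 := h2 0 1; have ad := h2 (A 1 1) (- A 1 0).
have al2 : 0 < al ^+ 2 by rewrite exprn_gt0.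
have h22 : al ^+ 2 <= A 1 1 by lra.
split; first by lra.
have A0 : 0 < A 1 1 by lra.
have h3 : al ^+ 2 * A 1 1 <= A 0 0 * A 1 1 - A 0 1 * A 1 0.
  rewrite -(ler_pM2l A0).
  have h4 : 0 <= al ^+ 2 * A 1 0 ^+ 2 by rewrite mulr_ge0 ?sqr_ge0 // ltW.
  lra.
apply: le_trans h3; have -> : al ^+ 4 = al ^+ 2 * al ^+ 2 by rewrite -exprD.
by rewrite ler_wpM2l // ltW.
Qed.

Lemma rtower_C1on (F : nat -> R -> R) n : (forall n (x : R), is_derive x 1 (F n) (F n.+1 x)) ->
  C1on (F n) (F n.+1).
Proof.
by move=> h; split=> [||x _]; [apply: cont01_cont => x; exact: der_cont (h n x)|apply: cont01_cont => x; exact: der_cont (h n.+1 x)|exact: h].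
Qed.

(** Outside the main regime one of the two exponentials is bounded below; as
    eps/mu is at most 1, its square being larger than s0 makes itself larger. *)
Lemma exp_lower (b c0 s0 eps mu : R) : 0 < b -> 0 < c0 -> 0 < s0 -> 0 < eps -> eps <= mu ->
  ~ (mu <= c0 /\ (eps / mu) ^+ 2 <= s0) ->
  expR (- (b / c0 + b / s0)) <= expR (- (b / mu)) + expR (- (b * mu / eps)).
Proof.
move=> b0 c00 s00 eps0 epsmu hn.
have mu0 : 0 < mu by lra.
have hc : 0 < b / c0 by rewrite divr_gt0.
have hs : 0 < b / s0 by rewrite divr_gt0.
have E1 := expR_ge0 (- (b / mu)); have E2 := expR_ge0 (- (b * mu / eps)).
have [mc|mc] := leP mu c0.
  have [sc|sc] := leP ((eps / mu) ^+ 2) s0; first by case: hn.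
  suff h : expR (- (b / c0 + b / s0)) <= expR (- (b * mu / eps)) by lra.
  rewrite ler_expR lerN2.
  have em1 : eps / mu <= 1 by rewrite ler_pdivrMr ?mul1r.
  have em0 : 0 < eps / mu by rewrite divr_gt0.
  have em : s0 <= eps / mu.
    by apply: le_trans (ltW sc) _; rewrite expr2 ler_piMl // ltW.
  have -> : b * mu / eps = b / (eps / mu) by field; rewrite !gt_eqF.
  have : b / (eps / mu) <= b / s0 by rewrite ler_pM2l // lef_pV2 ?posrE.
  lra.
suff h : expR (- (b / c0 + b / s0)) <= expR (- (b / mu)) by lra.
rewrite ler_expR lerN2.
have : b / mu <= b / c0 by rewrite ler_pM2l // lef_pV2 ?posrE // ltW.
lra.
Qed.
End Final.

Unset Implicit Arguments.

Theorem theorem4p1 (R : realType) (f g : R -> R) (A : R -> 'M[R]_2)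
  (Cf gf Cg gg Ca ga alpha : R)
  (hCf : 0 < Cf) (hgf : 0 < gf) (hCg : 0 < Cg) (hgg : 0 < gg)
  (hCa : 0 < Ca) (hga : 0 < ga)
  (hf : analytic_data Cf gf f) (hg : analytic_data Cg gg g)
  (hA : forall i j : 'I_2, analytic_data Ca ga (fun x => A x i j))
  (halpha : 0 < alpha)
  (hell : forall (x : R) (xi : 'cV[R]_2), 0 <= x <= 1 ->
     alpha ^+ 2 * (xi^T *m xi) 0 0 <= (xi^T *m A x *m xi) 0 0) :
  exists CW CBL gW gBL delta C b : R,
    [/\ 0 < CW, 0 < CBL, 0 < gW & 0 < gBL] /\ [/\ 0 < delta, 0 < C & 0 < b] /\
    forall eps mu : R, 0 < eps -> eps <= mu -> mu <= 1 ->
    forall U : R -> 'cV[R]_2,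
    is_solution eps mu A (fun x => \col_(i < 2) if i == 0 then f x else g x) U ->
    exists W Ut Uh Rm : R -> 'cV[R]_2,
      (forall x : R, 0 <= x <= 1 -> U x = W x + Ut x + Uh x + Rm x) /\
      (forall i : 'I_2, classA 1 CW gW (component W i)) /\
      (forall i : 'I_2, classBL (delta * mu) CBL gBL (component Ut i)) /\
      (forall i : 'I_2, classBL (delta * eps) CBL gBL (component Uh i)) /\
      classical_regular Rm /\
      ((norm_bd Rm)%:E + normLoo_vec (opL eps mu A Rm) <=
         (C * (expR (- (b / mu)) + expR (- (b * mu / eps))))%:E)%E /\
      (normE eps mu alpha Rm <=
         (C * (expR (- (b / mu)) + expR (- (b * mu / eps))))%:E)%E /\
      classBL (delta * eps) (CBL * (eps / mu) ^+ 2) gBL (component Uh 1).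
Proof.
have [Tf [tTf bTf fE]] := tower_of_data hCf hgf hf.
have [Tg [tTg bTg gE]] := tower_of_data hCg hgg hg.
have exA (ij : 'I_2 * 'I_2) := tower_of_data hCa hga (hA ij.1 ij.2).
have [T hT] := choice exA; pose TA i j := T (i, j).
have tTA i j : tower (TA i j) by case: (hT (i, j)).
have bTA i j : tbound Ca ga (TA i j) by case: (hT (i, j)).
have AE i j x : 0 <= x <= 1 -> TA i j 0%N x = A x i j by case: (hT (i, j)) => _ _; apply.
clearbody TA; clear T hT exA.
pose TF (i : 'I_2) := if i == 0 then Tf else Tg.
pose F x : 'cV[R]_2 := \col_(i < 2) if i == 0 then f x else g x.
have FE i x : 0 <= x <= 1 -> TF i 0%N x = F x i 0.
  by move=> xI; rewrite mxE /TF; case: ifP => _; [exact: fE|exact: gE].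
have tTF i : tower (TF i) by rewrite /TF; case: ifP.
pose C1 := Cf + Cg + Ca + 1; pose ga1 := gf + gg + ga.
have C11 : 1 <= C1 by rewrite /C1; lra.
have ga10 : 0 < ga1 by rewrite /ga1; lra.
have bTF i : tbound C1 ga1 (TF i).
  by rewrite /TF; case: ifP => _; [apply: tbound_widen bTf|apply: tbound_widen bTg]; rewrite /C1 /ga1; lra.
have bTA1 i j : tbound C1 ga1 (TA i j) by apply: tbound_widen (bTA i j); rewrite /C1 /ga1; lra.
pose al := Num.min 1 (Num.min (alpha ^+ 2) (alpha ^+ 4)).
have al0 : 0 < al by rewrite !lt_min ltr01 !exprn_gt0.
have al1 : al <= 1 by rewrite ge_min lexx.
have h11 x : 0 <= x <= 1 -> al <= TA 0 0 0%N x.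
  move=> xI; rewrite AE //; have [h _] := ellipticity halpha (fun xi => hell x xi xI).
  by apply: le_trans h; rewrite !ge_min lexx orbT.
have hdet x : 0 <= x <= 1 -> al <= tdet TA 0 x.
  move=> xI; rewrite tdet0 !AE //; have [_ h] := ellipticity halpha (fun xi => hell x xi xI).
  by apply: le_trans h; rewrite !ge_min lexx !orbT.
have [CW [gW [CBL [gBL [k0 [c0 [s0 [b [Ce [[CW0 gW0 CBL0 gBL0] [[k00 c00 s00 b0 Ce0] main]]]]]]]]]]] :=
  main_regime C11 ga10 al0 al1 tTA tTF bTA1 bTF h11 hdet.
pose KE := energy_cst alpha Ca + 1.
have KE2 : 2 <= KE by rewrite /KE; have := energy_cst_ge1 alpha Ca; lra.
have KEe : energy_cst alpha Ca <= KE by rewrite /KE; lra.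
pose e0 := expR (- (b / c0 + b / s0)).
have e00 : 0 < e0 by exact: expR_gt0.
pose C := KE * (Ce + C1 / e0).
have C1e : 0 < C1 / e0 by rewrite divr_gt0 //; lra.
have KE0 : 0 < KE by lra.
exists CW, CBL, gW, gBL, (2 / k0), C, b.
split; first by split.
split; first by split => //; [rewrite divr_gt0|rewrite mulr_gt0 // addr_gt0].
move=> eps mu eps0 epsmu mu1 U hU.
have mu0 : 0 < mu by lra.
have hep : 0 < eps <= 1 by rewrite eps0; lra.
have hm : 0 < mu <= 1 by rewrite mu0.
have cA i j : cont01 (fun x => A x i j) by case: (hA i j) => -[].
have cF i : cont01 (fun x => F x i 0).
  by apply: cont01_eq (tTF i 0%N).1 => x xI; exact: FE.
have hsol := solution_C2 eps0 mu0 cA cF hU.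
have exu i : exists u1, C1on (component U i) u1 /\ C1on u1 (fun x => ((A x *m U x) i 0 - F x i 0) / diagc eps mu i).
  by have [_ _ [u1 h1 h2]] := hsol i; exists u1.
have [u1 hu1] := choice exu.
have U0 i : U 0 i 0 = 0 by case: (hsol i).
have U1 i : U 1 i 0 = 0 by case: (hsol i).
have inI (x : R) : unitI x -> 0 <= x <= 1 by case/unitIE/andP => x0 x1; rewrite !ltW.
have bA x i j : unitI x -> `|A x i j| <= Ca.
  by move=> /inI xI; rewrite -AE //; have := bTA i j 0%N x xI; rewrite expr0 mulr1.
have dn0 i : diagc eps mu i != 0 by rewrite /diagc; case: ifP => _; rewrite expf_neq0 // gt_eqF.
set E := expR (- (b / mu)) + expR (- (b * mu / eps)).
have E0 : 0 < E by rewrite addr_gt0 ?expR_gt0.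
(* both regimes only have to bound the data of the remainder by [eta] *)
have finish eta (X Y : \bar R) : eta <= (Ce + C1 / e0) * E -> 0 <= eta -> (X <= (2 * eta)%:E)%E ->
    (Y <= (energy_cst alpha Ca * eta)%:E)%E -> (X <= (C * E)%:E)%E /\ (Y <= (C * E)%:E)%E.
  move=> h1 h0 hX hY.
  have h3 : KE * eta <= C * E by rewrite /C -mulrA ler_wpM2l // ltW.
  split; [apply: le_trans hX _|apply: le_trans hY _]; rewrite lee_fin; apply: le_trans h3; exact: ler_wpM2r.
have [hreg|hreg] := pselect (mu <= c0 /\ (eps / mu) ^+ 2 <= s0).
- have [muc hs] := hreg.
  have [W [Ut [Uh [[tW bW dUt dUh] [[BLt BLh BLh1] [bd0 bd1 res]]]]]] := main eps mu eps0 epsmu muc hs.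
  pose Wv x : 'cV[R]_2 := \col_i W i 0%N x.
  pose Utv x : 'cV[R]_2 := \col_i Ut i 0%N x.
  pose Uhv x : 'cV[R]_2 := \col_i Uh i 0%N x.
  pose Rm x := U x - Wv x - Utv x - Uhv x.
  have cE (V : 'I_2 -> nat -> R -> R) i : component (fun x => \col_i V i 0%N x) i = V i 0%N.
    by apply/funext => x; rewrite /component mxE.
  have RmE i x : Rm x i 0 = U x i 0 - W i 0%N x - Ut i 0%N x - Uh i 0%N x by rewrite !mxE.
  pose eta := Ce * expR (- (b / mu)).
  have eta0 : 0 <= eta by rewrite mulr_ge0 ?expR_ge0 // ltW.
  have etaE : eta <= (Ce + C1 / e0) * E.
    by apply: ler_pM; rewrite ?expR_ge0 ?(ltW Ce0) // ?lerDl ?expR_ge0 // ltW.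
  have [|||||reg hX hY] := @remainder_bounds R alpha Ca eta eps mu A Rm
     (fun i x => u1 i x - 1%:R * W i 1%N x - Ut i 1%N x - Uh i 1%N x)
     (fun i x => ((A x *m U x) i 0 - F x i 0) / diagc eps mu i - 1%:R * (2%:R * W i 2%N x) - Ut i 2%N x - Uh i 2%N x)
     halpha (ltW hCa) eta0 hep hm bA hell.
  + move=> i; have [h1 h2] := hu1 i.
    apply: C1on_eql (C1onB (C1onB (C1onB h1 (tower_C1on 0 (tW i))) (rtower_C1on 0 (dUt i))) (rtower_C1on 0 (dUh i))) => x _.
    by rewrite /component RmE.
  + move=> i; have [h1 h2] := hu1 i.
    exact: C1onB (C1onB (C1onB h2 (C1onZ 1%:R (tower_C1on 1 (tW i)))) (rtower_C1on 1 (dUt i))) (rtower_C1on 1 (dUh i)).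
  + move=> i; apply: le_trans (bd0 i); rewrite RmE U0 -normrN; apply: le_of_eq; congr `|_|; ring.
  + move=> i; apply: le_trans (bd1 i); rewrite RmE U1 -normrN; apply: le_of_eq; congr `|_|; ring.
  + move=> x i Ix; have xI := inI x Ix; apply: le_trans (res x i xI); rewrite -normrN.
    apply: le_of_eq; congr `|_|; rewrite !mulmx2E !RmE !AE // FE //.
    by field; exact: dn0.
  have [hX' hY'] := finish eta _ _ etaE eta0 hX hY.
  exists Wv, Utv, Uhv, Rm; split; first by move=> x _; rewrite /Rm; apply/matrixP => i j; rewrite !mxE; ring.
  split; first by move=> i; rewrite cE; apply: (classA_of_tower _ _ (tW i) (bW i)) => //; exact: ltW.
  split; first by move=> i; rewrite cE.
  split; first by move=> i; rewrite cE.
  by do !split => //; rewrite cE; case: BLh1.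
- have eta0 : 0 <= C1 by lra.
  have etaE : C1 <= (Ce + C1 / e0) * E.
    have h := exp_lower b0 c00 s00 eps0 epsmu hreg.
    have h1 : C1 / e0 * e0 <= C1 / e0 * E by rewrite ler_wpM2l // ltW.
    rewrite divfK ?gt_eqF // in h1; rewrite mulrDl.
    have h2 : 0 <= Ce * E by rewrite mulr_ge0 // ltW.
    lra.
  have [|||reg hX hY] := @remainder_bounds R alpha Ca C1 eps mu A U
     u1 (fun i x => ((A x *m U x) i 0 - F x i 0) / diagc eps mu i)
     halpha (ltW hCa) eta0 hep hm bA hell (fun i => (hu1 i).1) (fun i => (hu1 i).2).
  + by move=> i; rewrite U0 normr0.
  + by move=> i; rewrite U1 normr0.
  + move=> x i Ix; rewrite mulrC divfK // subKr -FE ?inI //.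
    by have := bTF i 0%N x (inI x Ix); rewrite expr0 mulr1.
  have [hX' hY'] := finish C1 _ _ etaE eta0 hX hY.
  have c0E i : component (fun _ : R => 0 : 'cV[R]_2) i = fun=> 0.
    by apply/funext => x; rewrite /component mxE.
  have dk : 0 <= 2 / k0 by rewrite divr_ge0 // ltW.
  have BL0 nu Cb : 0 < nu -> 0 <= Cb -> classBL (2 / k0 * nu) Cb gBL (fun _ : R => 0).
    by move=> nu0 Cb0; apply: classBL_0 => //; [rewrite mulr_ge0 // ltW|exact: ltW].
  exists (fun=> 0), (fun=> 0), (fun=> 0), U; split; first by move=> x _; rewrite !add0r.
  split; first by move=> i; rewrite c0E; apply: classA_0; exact: ltW.
  split; first by move=> i; rewrite c0E; apply: BL0 => //; exact: ltW.
  split; first by move=> i; rewrite c0E; apply: BL0 => //; exact: ltW.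
  split => //; split => //; split => //.
  by rewrite c0E; apply: BL0 => //; rewrite mulr_ge0 ?sqr_ge0 // ltW.
Qed.
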